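(* Fix $\alpha>\frac13$. For every $c>-1$ there exists a ground state of the constrained minimization problem $\inf_{u\in Y_0}\mathcal B_c(u)$, that is, there exists $\phi\in Y_0$ satisfying $$\mathcal B_c(\phi)=\inf_{u\in Y_0}\mathcal B_c(u).$$ If $\alpha\le2$, the ground state has an even, single-lobe profile $\phi$ (with the maximum placed at $x=0$ by translation).
   Context: $\mathbb T=[-\pi,\pi]$ with periodic boundary conditions; functions are real-valued and $2\pi$-periodic. $D^{s}$ is the Fourier multiplier $\widehat{D^{s}g}(m)=|m|^{s}\widehat g(m)$, $m\in\mathbb Z$. $$\mathcal B_c(u):=\frac12\int_{-\pi}^{\pi}\left[(D^{\frac\alpha2}u)^2+cu^2\right]dx,$$ $$Y_0:=\left\{u\in H^{\frac\alpha2}_{\rm per}(\mathbb T):\ \int_{-\pi}^{\pi}u^3dx=1,\ \int_{-\pi}^{\pi}u\,dx=0\right\}.$$ A profile is single-lobe if it has only one maximum and only one minimum on $\mathbb T$; without loss of generality (using translation invariance) the maximum is placed at $x=0$. *)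

(* Defs.v *)
From HB Require Import structures.
From mathcomp Require Import all_boot all_order all_algebra.
From mathcomp Require Import all_classical all_reals all_analysis.
From mathcomp Require Import complex.

Set Implicit Arguments.
Unset Strict Implicit.
Unset Printing Implicit Defensive.

Import Order.TTheory GRing.Theory Num.Theory.
Import numFieldNormedType.Exports.

Local Open Scope classical_set_scope.
Local Open Scope ring_scope.

(* Functions on the circle are 2 pi-periodic functions R -> R.  Elements of
   L^2 and of H^s are represented by functions, not by a.e.-classes. *)

Definition circle (R : realType) : set R := `[- pi, pi].
Arguments circle R : clear implicits.

Definition L2_per (R : realType) (u : R -> R) : Prop :=
  [/\ periodic u (pi *+ 2),
      measurable_fun setT u
    & lebesgue_measure.-integrable (circle R) (fun x => (u x ^+ 2)%:E)].

(* (2 pi)^-1 \int u(x) e^{- i m x} dx, split into real and imaginary parts *)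
Definition fourier_coef (R : realType) (u : R -> R) (m : int) : R[i] :=
  Complex
    ((pi *+ 2)^-1 *
       \int[lebesgue_measure]_(x in circle R) (u x * cos (m%:~R * x)))
    (- ((pi *+ 2)^-1 *
       \int[lebesgue_measure]_(x in circle R) (u x * sin (m%:~R * x)))).

Definition H_per (R : realType) (s : R) (u : R -> R) : Prop :=
  L2_per u /\
  (\esum_(m in [set: int])
     (((1 + `|m%:~R : R| ^+ 2) `^ s *
       ComplexField.Normc.normc (fourier_coef u m) ^+ 2)%:E) < +oo)%E.

Definition is_Dpow (R : realType) (s : R) (u g : R -> R) : Prop :=
  L2_per g /\
  forall m : int,
    fourier_coef g m = real_complex R (`|m%:~R : R| `^ s) * fourier_coef u m.

(* For u in H^s with 0 < s, a function g as in [is_Dpow] exists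
   (Riesz-Fischer) and is unique up to a.e. equality; the default value 0 is
   only reached for u for which D^s u is not in L^2. *)
Definition Dpow (R : realType) (s : R) (u : R -> R) : R -> R :=
  xget (fun=> 0) [set g | is_Dpow s u g].

Definition Bfun (R : realType) (alpha c : R) (u : R -> R) : R :=
  2^-1 * \int[lebesgue_measure]_(x in circle R)
           (Dpow (alpha / 2) u x ^+ 2 + c * u x ^+ 2).

Definition Y0 (R : realType) (alpha : R) : set (R -> R) :=
  [set u | [/\ H_per (alpha / 2) u,
               \int[lebesgue_measure]_(x in circle R) (u x ^+ 3) = 1
             & \int[lebesgue_measure]_(x in circle R) u x = 0]].

(* The infimum is taken in the extended reals, where it is the true greatest
   lower bound. *)
Definition ground_state (R : realType) (alpha c : R) (phi : R -> R) : Prop :=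
  Y0 alpha phi /\
  (Bfun alpha c phi)%:E =
    ereal_inf [set (Bfun alpha c u)%:E | u in Y0 alpha].

Definition is_local_max (R : realType) (u : R -> R) (x : R) : Prop :=
  \forall y \near x, u y <= u x.

Definition is_local_min (R : realType) (u : R -> R) (x : R) : Prop :=
  \forall y \near x, u x <= u y.

(* Maxima and minima are local ones (in the wide sense, so plateaus are
   excluded by uniqueness), counted on the fundamental domain `]- pi, pi] since
   - pi and pi are the same point of the circle.  Continuity is required because
   u is determined only up to a.e. equality: extrema at points are those of the
   continuous representative. *)
Definition single_lobe (R : realType) (u : R -> R) : Prop :=
  [/\ continuous u,
      (exists! x : R, x \in `]- pi, pi] /\ is_local_max u x)
    & (exists! x : R, x \in `]- pi, pi] /\ is_local_min u x)].

(* Main.v *)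
Require Import Defs.
From HB Require Import structures.
From mathcomp Require Import all_boot all_order all_algebra.
From mathcomp Require Import all_classical all_reals all_analysis.
From mathcomp Require Import measurable_realfun complex.
From mathcomp Require Import ring lra zify.

Set Implicit Arguments.
Unset Strict Implicit.
Unset Printing Implicit Defensive.

Import Order.TTheory GRing.Theory Num.Theory.
Import numFieldNormedType.Exports.

Local Open Scope classical_set_scope.
Local Open Scope ring_scope.

(* Existence: in Fourier coefficients [2 B_c u] is the coercive quadratic form
   [sum (|m|^alpha + c) a_m^2].  The coefficients of a minimizing sequence
   converge along a subsequence; because [H^(beta/2)] embeds into [L^3] for some
   [1/3 < beta < alpha] and high frequencies are uniformly small in that norm, the
   cubic constraint passes to the limit.

   Symmetry: a ground state solves [D^alpha u + c u = L u^2 + const].  A bootstrap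
   in weighted [l^2] spaces of Fourier coefficients gives
   [sum |m|^alpha |a_m| < oo], so [u] is continuous and solves the equation
   pointwise.  Write [u = e + o] with [o] the odd part about a point [t], and
   replace [o] by the odd function equal to [|o|] on a half circle.  This keeps
   the constraints, and it does not increase the energy when [alpha <= 2]:
   [m^alpha] is an integral over [s] of positive multiples of [m^2 / (m^2 + s)]
   (or a limit of those for [alpha = 2]), and [(s - d^2/dx^2)^-1] has a kernel that
   decreases with the distance on the circle.  The polarized function is therefore
   a ground state, and the strong maximum principle for its odd part shows that
   [o] is either identically zero or without zeros on the open half circle.
   Applied at every [t], with a maximum placed at 0, this dichotomy gives evenness
   and strict monotonicity on [0, pi]. *)

(** * Integration over the circle *)

(** The threshold 1/3 enters twice. [L^3] norms of dyadic blocks are summable on [H^(beta/2)] when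
    [beta > 1/3], and the convolution estimate of the bootstrap needs [sigma + 2 alpha > 1] with
    some [sigma < alpha]. For [alpha <= 1] the energy does not bound the sup norm, so regularity has
    to start from weighted [l^2] sums alone. Polarization suits the constraints because, by parity,
    the integral of [(e + o)^3] is that of [e^3 + 3 e o^2] and the mean is that of [e]: only [o^2]
    enters. It also enters the term with [c] only through its integral, so the sign of [c] does not
    matter. Since the polarized function is itself a minimizer, it satisfies the same equation, and
    this is what makes a maximum principle available; the argument therefore reaches every ground
    state and not just a rearranged one. The unknown constant in the equation comes from the
    mean-zero constraint and is invisible to odd parts. *)

Section CircleIntegral.
Context {R : realType}.
Implicit Types (f g u v : R -> R) (x y a b : R).

Local Notation mu := (@lebesgue_measure R).

Definition itg f := mu.-integrable (circle R) (EFin \o f).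
Definition I f : R := \int[mu]_(x in circle R) f x.

Lemma aeS (P Q : R -> Prop) : (forall x, P x -> Q x) ->
  {ae mu, forall x, P x} -> {ae mu, forall x, Q x}.
Proof.
by move=> PQ; apply: filterS => //; exact: (ae_filter_ringOfSetsType mu).
Qed.

Lemma aeI (P Q : R -> Prop) : {ae mu, forall x, P x} ->
  {ae mu, forall x, Q x} -> {ae mu, forall x, P x /\ Q x}.
Proof.
move=> hP hQ.
have := @filterI _ _ (ae_filter_ringOfSetsType mu) _ _ hP hQ.
exact: aeS.
Qed.

Lemma measurable_circle : measurable (circle R : set (measurableTypeR R)).
Proof. exact: measurable_itv. Qed.
Hint Resolve measurable_circle : core.

Lemma circle_measure : mu (circle R) = (pi *+ 2)%:E.
Proof.
rewrite /circle lebesgue_measure_itv/= lte_fin ifT; last first.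
  by have := @pi_gt0 R; lra.
by rewrite -EFinB opprK mulr2n.
Qed.

Lemma itgD f g : itg f -> itg g -> itg (fun x => f x + g x).
Proof. by move=> hf hg; have := integrableD measurable_circle hf hg. Qed.

Lemma itgZ c f : itg f -> itg (fun x => c * f x).
Proof. by move=> hf; have := integrableZl measurable_circle c hf. Qed.

Lemma itgN f : itg f -> itg (fun x => - f x).
Proof. by move=> hf; have := integrableN hf. Qed.

Lemma itgB f g : itg f -> itg g -> itg (fun x => f x - g x).
Proof. by move=> hf hg; apply: itgD hf (itgN hg). Qed.

Lemma eq_itg f g : f =1 g -> itg f -> itg g.
Proof. by move=> /funext ->. Qed.

Lemma itg_le f g : measurable_fun setT f -> (forall x, `|f x| <= g x) ->
  itg g -> itg f.
Proof.
move=> mf fg ig.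
apply: (le_integrable measurable_circle _ _ ig).
  by apply/measurable_EFinP; exact: measurable_funTS.
by move=> x _ /=; rewrite lee_fin (le_trans (fg x))// ler_norm.
Qed.

Lemma itg_cst c : itg (fun=> c).
Proof.
apply: measurable_bounded_integrable => //.
- by apply: le_lt_trans (ltry (pi *+ 2 : R)); rewrite -circle_measure.
- by exists `|c|; split => // M cM x _ /=; rewrite ltW.
Qed.

Lemma itg_bounded f M : measurable_fun setT f -> (forall x, `|f x| <= M) ->
  itg f.
Proof. by move=> mf fM; apply: (itg_le mf fM); exact: itg_cst. Qed.

Lemma itg_norm f : itg f -> itg (fun x => `|f x|).
Proof. by move=> hf; have := integrable_norm hf. Qed.

Lemma ID f g : itg f -> itg g -> I (fun x => f x + g x) = I f + I g.
Proof. by move=> hf hg; rewrite /I RintegralD. Qed.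

Lemma IB f g : itg f -> itg g -> I (fun x => f x - g x) = I f - I g.
Proof. by move=> hf hg; rewrite /I RintegralB. Qed.

Lemma IZ c f : itg f -> I (fun x => c * f x) = c * I f.
Proof. by move=> hf; rewrite /I RintegralZl. Qed.

Lemma IN f : itg f -> I (fun x => - f x) = - I f.
Proof.
move=> hf; rewrite -mulN1r -IZ//; congr I; apply/funext => x.
by rewrite mulN1r.
Qed.

Lemma I_cst c : I (fun=> c) = c * (pi *+ 2).
Proof.
rewrite /I Rintegral_cst//; congr (_ * _).
by rewrite -[RHS]/(fine (pi *+ 2)%:E) -circle_measure.
Qed.

Lemma I_ge0 f : (forall x, circle R x -> 0 <= f x) -> 0 <= I f.
Proof. by move=> h; rewrite /I; exact: Rintegral_ge0. Qed.

Lemma I_le f g : itg f -> itg g -> (forall x, circle R x -> f x <= g x) ->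
  I f <= I g.
Proof. by move=> hf hg fg; rewrite /I le_Rintegral. Qed.

Lemma I_norm f : itg f -> `|I f| <= I (fun x => `|f x|).
Proof. by move=> hf; rewrite /I le_normr_Rintegral. Qed.

Lemma I_EFin f : itg f -> (I f)%:E = (\int[mu]_(x in circle R) (f x)%:E)%E.
Proof. by move=> hf; rewrite /I /Rintegral fineK//; exact: integrable_fin_num. Qed.

Lemma I_ae f g : itg f -> measurable_fun setT g ->
  {ae mu, forall x, circle R x -> f x = g x} -> itg g /\ I f = I g.
Proof.
move=> hf mg fg.
have mf : measurable_fun (circle R) (EFin \o f) by case/integrableP: hf.
have mg' : measurable_fun (circle R) (EFin \o g).
  by apply/measurable_EFinP; exact: measurable_funTS.
have fgE : ae_eq mu (circle R) (EFin \o f) (EFin \o g).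
  apply: aeS fg => x + Dx => /(_ Dx) /= -> //.
split.
  apply/integrableP; split => //.
  case/integrableP : hf => _; apply: le_lt_trans.
  rewrite le_eqVlt; apply/orP; left; apply/eqP.
  apply: ae_eq_integral => //; try exact: measurableT_comp.
  by apply: aeS fg => x + Dx => /(_ Dx) /= ->.
rewrite /I /Rintegral; congr fine.
by apply: ae_eq_integral.
Qed.

Lemma I0_ae f : measurable_fun setT f -> (forall x, 0 <= f x) -> itg f ->
  I f = 0 -> {ae mu, forall x, circle R x -> f x = 0}.
Proof.
move=> mf f0 hf If0.
have mf' : measurable_fun (circle R) (EFin \o f).
  by apply/measurable_EFinP; exact: measurable_funTS.
have /(@ae_eq_integral_abs _ _ _ mu (circle R) measurable_circle) H := mf'.
have : (\int[mu]_(x in circle R) `|(EFin \o f) x| = 0)%E.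
  rewrite -[RHS](_ : (I f)%:E = _); last by rewrite If0.
  by rewrite I_EFin//; apply: eq_integral => x _ /=; rewrite ger0_norm.
by move/H; apply: aeS => x /= h Dx; case: (h Dx).
Qed.

End CircleIntegral.
Global Hint Resolve measurable_circle : core.

(** * Translation and reflection of integrals over the circle *)

Section Translation.
Context {R : realType}.
Local Notation mu := (@lebesgue_measure R).

Lemma measurable_shift (a : R) : measurable_fun setT (fun x : R => x + a).
Proof. by apply: measurable_funD => //; exact: measurable_cst. Qed.


Lemma lebesgue_measure_shift (a : R) (A : set R) : measurable A ->
  pushforward mu ((fun x => x + a) : _ -> measurableTypeR R) A = mu A.
Proof.
move=> mA; apply/esym/lebesgue_measure_unique => //=.
  exact: measurable_shift.
move=> _ _ [[b c]] _ <-; rewrite /pushforward.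
have -> : (fun x : R => x + a) @^-1` `]b, c]%classic = `]b - a, c - a]%classic.
  by apply/seteqP; split=> x /=; rewrite !in_itv/= ltrBlDr lerBrDr.
rewrite !lebesgue_measure_itv/= !lte_fin ltrD2r; case: ifP => // _.
by rewrite -!EFinB opprB addrA subrK.
Qed.

Lemma ge0_integral_shift (a : R) (D : set R) (f : R -> \bar R) :
  measurable D -> measurable_fun D f -> (forall x, 0 <= f x)%E ->
  (\int[mu]_(x in D) f x = \int[mu]_(x in (fun x => x + a)%R @^-1` D) f (x + a)%R)%E.
Proof.
move=> mD mf f0.
pose phi : measurableTypeR R -> measurableTypeR R := fun x => x + a.
have mphi : measurable_fun setT phi := measurable_shift a.
transitivity (\int[pushforward mu phi]_(y in (D : set (measurableTypeR R))) f y)%E.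
  apply: eq_measure_integral => A mA _.
  by symmetry; have := lebesgue_measure_shift a mA.
by rewrite ge0_integral_pushforward.
Qed.

(* The part beyond [pi] is moved back by one period. *)
Lemma ge0_integral_circle_shift (a : R) (f : R -> \bar R) :
  measurable_fun setT f -> (forall x, 0 <= f x)%E ->
  (forall x, f (x + pi *+ 2)%R = f x) ->
  (\int[mu]_(x in circle R) f (x + a)%R = \int[mu]_(x in circle R) f x)%E.
Proof.
move=> mf f0 perf; have pi0 := @pi_gt0 R.
have mS (g : R -> \bar R) (D : set R) : measurable_fun setT g ->
    measurable_fun D g by move=> mg; exact: measurable_funTS.
suff H b : (0 <= b < pi *+ 2)%R ->
    (\int[mu]_(x in circle R) f (x + b)%R = \int[mu]_(x in circle R) f x)%E.
  pose k := Num.floor (a / (pi *+ 2)).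
  have p2 : (0 < pi *+ 2 :> R)%R by lra.
  pose b := (a - k%:~R * (pi *+ 2))%R.
  have hb : (0 <= b < pi *+ 2)%R.
    have := floor_itv (a / (pi *+ 2)); rewrite -/k => /andP[].
    rewrite ler_pdivlMr// ltr_pdivrMr// intrD mulrDl mul1r /b => *.
    by apply/andP; split; lra.
  rewrite -(H b hb); apply: eq_integral => x _.
  have perfn (n : nat) y : f (y + n%:R * (pi *+ 2))%R = f y.
    elim: n => [|n IH]; first by rewrite mul0r addr0.
    by rewrite -IH -[RHS]perf; congr f; rewrite -natr1 mulrDl mul1r addrA.
  have perfz (z : int) y : f (y + z%:~R * (pi *+ 2))%R = f y.
    case: z => n; first exact: perfn.
    by rewrite NegzE mulrNz mulNr -(perfn n.+1 (y - _))%R subrK.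
  by rewrite -(perfz k (x + b)%R) /b; congr f; lra.
move=> /andP[b0 b2].
have := @ge0_integral_shift b `[- pi + b, pi + b]%classic f (measurable_itv _) (mS _ _ mf) f0.
have -> : (fun x => x + b)%R @^-1` `[(- pi + b)%R, (pi + b)%R]%classic = circle R.
  by apply/seteqP; split => x /=; rewrite /circle/= !in_itv/= !lerD2r.
move=> <-.
have -> : `[(- pi + b)%R, (pi + b)%R]%classic =
    `[(- pi + b)%R, pi]%classic `|` `]pi, (pi + b)%R]%classic :> set R.
  by rewrite -itv_bndbnd_setU// bnd_simp; lra.
rewrite ge0_integral_setU//=; last first.
- apply/disj_setPS => y [/=]; rewrite !in_itv/= => /andP[_ yx] /andP[].
  by rewrite ltNge yx.
- exact: mS.
have -> : circle R = `[(- pi)%R, (- pi + b)%R[%classic `|`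
    `[(- pi + b)%R, pi]%classic :> set R.
  by rewrite -itv_bndbnd_setU// bnd_simp; lra.
rewrite ge0_integral_setU//=; last first.
- apply/disj_setPS => y [/=]; rewrite !in_itv/= => /andP[_ yx] /andP[].
  by rewrite leNgt yx.
- exact: mS.
rewrite addeC; congr (_ + _)%E.
have := @ge0_integral_shift (pi *+ 2) `]pi, (pi + b)%R]%classic f (measurable_itv _) (mS _ _ mf) f0.
have -> : (fun x => x + pi *+ 2)%R @^-1` `]pi, (pi + b)%R]%classic =
    `](- pi)%R, (- pi + b)%R]%classic :> set R.
  by apply/seteqP; split => x /=; rewrite !in_itv/= => /andP[? ?]; apply/andP;
    split; lra.
move=> ->.
under eq_integral do rewrite perf.
rewrite integral_itv_obnd_cbnd; last exact: mS.
rewrite -integral_itv_bndo_bndc//; exact: mS.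
Qed.

Lemma I_shift (a : R) (f : R -> R) : measurable_fun setT f ->
  periodic f (pi *+ 2) -> I (fun x => f (x + a)) = I f.
Proof.
move=> mf perf; rewrite /I /Rintegral; congr fine.
rewrite integralE [RHS]integralE.
have mE : measurable_fun setT (EFin \o f) by exact/measurable_EFinP.
congr (_ - _)%E.
  rewrite -(ge0_integral_circle_shift a (measurable_funepos mE))//.
    by apply: eq_integral => x _; rewrite !funeposE.
  by move=> x; rewrite !funeposE/= perf.
rewrite -(ge0_integral_circle_shift a (measurable_funeneg mE))//.
  by apply: eq_integral => x _; rewrite !funenegE.
by move=> x; rewrite !funenegE/= perf.
Qed.

Lemma itg_shift (a : R) (f : R -> R) : measurable_fun setT f ->
  periodic f (pi *+ 2) -> itg f -> itg (fun x => f (x + a)).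
Proof.
move=> mf perf /integrableP[m1 h]; apply/integrableP; split.
  apply/measurable_EFinP; apply: measurable_funTS.
  by apply: measurableT_comp mf (measurable_shift a).
rewrite (_ : (\int[_]_(x in _) _ = \int[mu]_(x in circle R) `|(f x)%:E|)%E)//.
rewrite -(ge0_integral_circle_shift a (f := fun x => `|(f x)%:E|%E))//.
  by apply: measurableT_comp => //; exact/measurable_EFinP.
by move=> x; rewrite perf.
Qed.

Lemma I_reflect (f : R -> R) : measurable_fun setT f ->
  I (fun x => f (- x)) = I f.
Proof.
move=> mf; rewrite /I /Rintegral; congr fine.
have H (g : R -> \bar R) : measurable_fun setT g -> (forall x, 0 <= g x)%E ->
   (\int[mu]_(x in circle R) g (- x)%R = \int[mu]_(x in circle R) g x)%E.
  move=> mg g0.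
  pose phi : measurableTypeR R -> measurableTypeR R := fun x => - x.
  have mphi : measurable_fun setT phi := @oppr_measurable R setT.
  transitivity (\int[pushforward mu phi]_(y in circle R) g y)%E; last first.
    apply: eq_measure_integral => A mA _.
    by have := lebesgue_measureN mA.
  rewrite ge0_integral_pushforward//; last exact: measurable_funTS.
  congr (\int[_]_(_ in _) _)%E.
  apply/seteqP; split => x; rewrite /circle /phi/= !in_itv/= => /andP[h1 h2];
    apply/andP; split.
  - by rewrite lerN2.
  - by rewrite lerNl.
  - by rewrite lerNl.
  - by rewrite -lerN2.
rewrite integralE [RHS]integralE.
have mE : measurable_fun setT (EFin \o f) by exact/measurable_EFinP.
congr (_ - _)%E.
  rewrite -(H _ (measurable_funepos mE))//.
  by apply: eq_integral => x _; rewrite !funeposE.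
rewrite -(H _ (measurable_funeneg mE))//.
by apply: eq_integral => x _; rewrite !funenegE.
Qed.

Lemma I_odd (f : R -> R) : measurable_fun setT f -> itg f ->
  (forall x, f (- x) = - f x) -> I f = 0.
Proof.
move=> mf itf fN; have := I_reflect mf.
rewrite (_ : I (fun x => f (- x)) = - I f); first by lra.
by rewrite -IN//; congr I; apply/funext.
Qed.

Lemma ae_shift (a : R) (P : R -> Prop) : {ae mu, forall x, P x} ->
  {ae mu, forall x, P (x + a)}.
Proof.
move=> [N [mN N0 PN]].
exists ((fun x => x + a) @^-1` N); split.
- by rewrite -[X in measurable X]setTI; exact: (measurable_shift a).
- by have := lebesgue_measure_shift a mN; rewrite /pushforward => ->.
- by move=> x /= Px; apply: PN.
Qed.

End Translation.

(** * Series of functions *)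

Section Series.
Context {R : realType}.
Implicit Types (f g : nat -> R) (B : R).

Definition sumE f : \bar R := (\sum_(0 <= k <oo) (f k)%:E)%E.

Lemma sumE_le f B : (forall k, 0 <= f k) -> (forall n, \sum_(k < n) f k <= B) ->
  (sumE f <= B%:E)%E.
Proof.
move=> f0 fB; apply: lime_le.
  by apply: is_cvg_nneseries => n _ _; rewrite lee_fin.
by apply: nearW => n; rewrite big_mkord sumEFin lee_fin.
Qed.

Lemma sumE_ge f n : (forall k, 0 <= f k) -> ((\sum_(k < n) f k)%:E <= sumE f)%E.
Proof.
move=> f0; rewrite -sumEFin -(big_mkord xpredT (fun k => (f k)%:E)).
by apply: nneseries_lim_ge => k _ _; rewrite lee_fin.
Qed.

Lemma sumE_ge0 f : (forall k, 0 <= f k) -> (0 <= sumE f)%E.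
Proof. by move=> f0; apply: nneseries_ge0 => n _ _; rewrite lee_fin. Qed.

Lemma sumE_fin f : (forall k, 0 <= f k) -> (sumE f < +oo)%E ->
  {B | 0 <= B & sumE f = B%:E}.
Proof.
move=> f0 h; exists (fine (sumE f)); first by rewrite fine_ge0// sumE_ge0.
by rewrite fineK// ge0_fin_numE// sumE_ge0.
Qed.

Lemma sumE_real f B : (forall k, 0 <= f k) -> sumE f = B%:E ->
  forall n, \sum_(k < n) f k <= B.
Proof. by move=> f0 h n; rewrite -lee_fin -h sumE_ge. Qed.

Lemma sumE_approx f B : (forall k, 0 <= f k) -> sumE f = B%:E ->
  forall e, 0 < e -> exists n, forall m, (n <= m)%N -> B - e < \sum_(k < m) f k.
Proof.
move=> f0 h e e0; apply: contrapT => /forallNP H.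
suff : (sumE f <= (B - e)%:E)%E by rewrite h lee_fin; lra.
apply: sumE_le => // n; have /existsNP[m /not_implyP[nm /negP]] := H n.
rewrite -leNgt; apply: le_trans.
rewrite -!(big_mkord xpredT f) [leRHS](big_cat_nat (n := n))//=.
by rewrite lerDl sumr_ge0.
Qed.

Lemma le_sumE f g : (forall k, 0 <= f k) -> (forall k, f k <= g k) ->
  (sumE f <= sumE g)%E.
Proof.
by move=> f0 fg; apply: lee_nneseries => n *; rewrite lee_fin.
Qed.

Lemma sumE_Z f B : 0 <= B -> (forall k, 0 <= f k) ->
  sumE (fun k => B * f k) = (B%:E * sumE f)%E.
Proof.
move=> B0 f0; rewrite /sumE -nneseriesZl//.
by move=> k _; rewrite lee_fin.
Qed.

Lemma sumE_D f g : (forall k, 0 <= f k) -> (forall k, 0 <= g k) ->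
  sumE (fun k => f k + g k) = (sumE f + sumE g)%E.
Proof.
by move=> f0 g0; rewrite /sumE -nneseriesD// => k *; rewrite lee_fin.
Qed.

Lemma sum_le_widen f n m : (forall k, 0 <= f k) -> (n <= m)%N ->
  \sum_(k < n) f k <= \sum_(k < m) f k.
Proof.
move=> f0 nm; rewrite -!(big_mkord xpredT f) [leRHS](big_cat_nat (n := n))//=.
by rewrite lerDl sumr_ge0.
Qed.

Lemma geometric_sum_le (r : R) n : 0 < r < 1 ->
  \sum_(k < n) r ^+ k <= (1 - r)^-1.
Proof.
move=> /andP[r0 r1]; have d : 0 < 1 - r by lra.
rewrite -[leRHS]mul1r ler_pdivlMr// mulrC.
have -> : (1 - r) * (\sum_(i < n) r ^+ i) = 1 - r ^+ n.
  elim: n => [|n IH]; first by rewrite big_ord0 expr0; lra.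
  rewrite big_ord_recr/= mulrDr IH exprS; ring.
by rewrite gerBl exprn_ge0 ?ltW.
Qed.

Lemma cvg_of_bounded_abs (a : nat -> R) B :
  (forall n, \sum_(k < n) `|a k| <= B) -> cvgn (series a).
Proof.
move=> aB; apply: normed_cvg.
rewrite (_ : [normed series a] = fun n => \sum_(k < n) `|a k|); last first.
  by apply/funext => n; rewrite /normed_series_of/= seriesEord.
apply: nondecreasing_is_cvgn.
  by apply/nondecreasing_seqP => n; rewrite big_ord_recr/= lerDl.
by exists B => _ [n _ <-].
Qed.

Lemma limn_norm_le (u : nat -> R) B l N : u @ \oo --> l ->
  (forall n, (N <= n)%N -> `|u n| <= B) -> `|l| <= B.
Proof.
move=> cu uB; have cn : `|u n| @[n --> \oo] --> `|l| by exact: cvg_norm.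
have <- := cvg_lim (@Rhausdorff R) cn.
apply: limr_le; first by apply/cvg_ex; exists `|l|.
by exists N => // n /= Nn; exact: uB.
Qed.

End Series.

(** * Convexity inequalities with geometric weights *)

Section WeightedPowers.
Context {R : realType}.

(** Induction on [p]: the defect of one step is [r (1 - r) (x - y) (x^(p+1) - y^(p+1))], whose two
    differences have the same sign. *)
Lemma convex_pow (p : nat) (r x y : R) : 0 < r < 1 -> 0 <= x -> 0 <= y ->
  ((1 - r) * x + r * y) ^+ p.+1 <= (1 - r) * x ^+ p.+1 + r * y ^+ p.+1.
Proof.
move=> /andP[r0 r1] x0 y0; elim: p => [|p IH]; first by rewrite !expr1.
rewrite exprS.
have h : 0 <= (1 - r) * x + r * y.
  by apply: addr_ge0; apply: mulr_ge0 => //; lra.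
apply: le_trans (ler_wpM2l h IH) _.
rewrite -subr_ge0 [x ^+ p.+2]exprS [y ^+ p.+2]exprS.
set X := x ^+ p.+1; set Y := y ^+ p.+1.
have -> : (1 - r) * (x * X) + r * (y * Y) -
   ((1 - r) * x + r * y) * ((1 - r) * X + r * Y) =
   r * (1 - r) * ((x - y) * (X - Y)) by ring.
apply: mulr_ge0; first by apply: mulr_ge0; lra.
case: (leP x y) => xy.
  by apply: mulr_le0; rewrite subr_le0 //; apply: lerXn2r.
apply: mulr_ge0; rewrite subr_ge0; first exact: ltW.
by apply: lerXn2r => //; exact: ltW.
Qed.

Lemma pow_add_le (p : nat) (r x y : R) : 0 < r < 1 -> 0 <= x -> 0 <= y ->
  (x + y) ^+ p.+1 <= x ^+ p.+1 / (1 - r) ^+ p + y ^+ p.+1 / r ^+ p.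
Proof.
move=> /andP[r0 r1] x0 y0; have d : 0 < 1 - r by lra.
have := @convex_pow p r (x / (1 - r)) (y / r).
rewrite r0 r1 => /(_ isT (divr_ge0 x0 (ltW d)) (divr_ge0 y0 (ltW r0))).
have E (a b : R) : 0 < b -> b * (a / b) = a.
  by move=> b0; rewrite mulrC divfK// gt_eqF.
rewrite !E// => /le_trans; apply.
have E2 (a b : R) : 0 < b -> b * (a / b) ^+ p.+1 = a ^+ p.+1 / b ^+ p.
  move=> b0; rewrite expr_div_n [b ^+ p.+1]exprS invfM mulrCA mulVKf//.
  by rewrite gt_eqF.
by rewrite !E2.
Qed.

(** Jensen's inequality for the weights [(1 - r) r^j]. It stands in for Minkowski's inequality:
    after integration, norms of order [r^j] beat the factors [r^(-j p)] and leave a geometric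
    series. *)
Lemma pow_sum_le (p : nat) (r : R) (x : nat -> R) n : 0 < r < 1 ->
  (forall j, 0 <= x j) ->
  (\sum_(j < n) x j) ^+ p.+1 <=
    (1 - r) ^- p * \sum_(j < n) r ^- (j * p) * x j ^+ p.+1.
Proof.
move=> r01 x0; have /andP[r0 r1] := r01; have d : 0 < 1 - r by lra.
elim: n x x0 => [|n IH] x x0; first by rewrite !big_ord0 expr0n/= mulr0.
have E (f : nat -> R) : \sum_(j < n.+1) f j = f 0%N + \sum_(j < n) f j.+1.
  by rewrite big_ord_recl.
rewrite (E x) (E (fun j => r ^- (j * p) * x j ^+ p.+1)) /= ?mul0n expr0 invr1 mul1r.
have := IH (fun j => x j.+1) (fun j => x0 j.+1).
set S := \sum_(i < n) _; set T := \sum_(i < n) _ => h.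
have -> : \sum_(j < n) r ^- (j.+1 * p) * x j.+1 ^+ p.+1 = r ^- p * T.
  rewrite mulr_sumr; apply: eq_bigr => i _.
  by rewrite mulSn exprD invfM mulrA.
have S0 : 0 <= S by apply: sumr_ge0.
apply: le_trans (pow_add_le p r01 (x0 0%N) S0) _.
rewrite mulrDr [X in X + _]mulrC lerD2l mulrCA [X in X <= _]mulrC.
by rewrite ler_wpM2l// invr_ge0 exprn_ge0// ltW.
Qed.

End WeightedPowers.

(** * Series of functions converging in [L^p] *)

Section SeriesLp.
Context {R : realType}.
Local Notation mu := (@lebesgue_measure R).
Implicit Types (v : nat -> R -> R) (x : R).

(* The limit superior makes the sum of a series of functions measurable without
   any convergence hypothesis; it is junk where the series diverges. *)
Definition slim v x : R := fine (limn_esup (fun n => (\sum_(j < n) v j x)%:E)).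

Lemma measurable_slim v : (forall j, measurable_fun setT (v j)) ->
  measurable_fun setT (slim v).
Proof.
move=> mv; apply: measurableT_comp => //.
apply: measurable_fun_limn_esup => n; apply/measurable_EFinP.
exact: measurable_sum.
Qed.

Lemma slim_cvg v x : cvgn (series (fun j => v j x)) ->
  (\sum_(j < n) v j x) @[n --> \oo] --> slim v x.
Proof.
move=> /cvg_ex[/= l hl].
have hl' : (\sum_(j < n) v j x) @[n --> \oo] --> l.
  by move: hl; rewrite seriesEord.
rewrite (_ : slim v x = l)//; rewrite /slim.
have h : ((\sum_(j < n) v j x)%:E) @[n --> \oo] --> l%:E by apply: cvg_EFin => //; exact: nearW.
by rewrite (cvg_limn_einf_sup h).2.
Qed.

(** A bound on the weighted series bounds all sums of [|v (n + j) x|], so the series converges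
    absolutely at [x] and the tail estimate passes to the limit. *)
Lemma slim_tail (p : nat) (r g : R) v x (n : nat) : 0 < r < 1 ->
  (forall m, \sum_(j < m) r ^- (j * p) * `|v (n + j)%N x| ^+ p.+1 <= g) ->
  (\sum_(j < m) v j x) @[m --> \oo] --> slim v x /\
  `|slim v x - \sum_(j < n) v j x| ^+ p.+1 <= (1 - r) ^- p * g.
Proof.
move=> r01 vg; have /andP[r0 r1] := r01.
set G := (1 - r) ^- p * g.
have GS m : (\sum_(j < m) `|v (n + j)%N x|) ^+ p.+1 <= G.
  apply: le_trans (@pow_sum_le _ p r (fun j => `|v (n + j)%N x|) m r01 _) _ => //.
  by rewrite ler_wpM2l// invr_ge0 exprn_ge0//; lra.
have G0 : 0 <= G by apply: le_trans (GS 0%N); rewrite big_ord0 expr0n.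
have S1 m : \sum_(j < m) `|v (n + j)%N x| <= 1 + G.
  have := GS m; set t := \sum_(j < m) _ => tG.
  have [t1|t1] := leP t 1; first by lra.
  suff : t <= t ^+ p.+1 by lra.
  by rewrite exprS ler_peMr ?exprn_ege1//; lra.
have cv : cvgn (series (fun j => v j x)).
  apply: (@cvg_of_bounded_abs _ _ (\sum_(k < n) `|v k x| + (1 + G))) => m.
  apply: (@le_trans _ _ (\sum_(k < n + m) `|v k x|)).
    by apply: (@sum_le_widen _ (fun k => `|v k x|)) => //; rewrite leq_addl.
  by rewrite big_split_ord/= lerD2l; exact: S1.
split; first exact: slim_cvg.
rewrite -normrX.
apply: (@limn_norm_le _ (fun m => (\sum_(j < n + m) v j x - \sum_(j < n) v j x) ^+ p.+1) _ _ 0%N).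
  apply: (cvg_comp (fun m => \sum_(j < n + m) v j x - \sum_(j < n) v j x)
    (fun t => t ^+ p.+1)); last exact: exprn_continuous.
  apply: cvgB; last exact: cvg_cst.
  have := slim_cvg cv; rewrite -(cvg_shiftn n).
  by under eq_fun do rewrite addnC.
move=> m _; rewrite normrX; apply: le_trans (GS m).
rewrite lerXn2r ?nnegrE ?sumr_ge0//.
by rewrite big_split_ord/= addrAC subrr add0r ler_norm_sum.
Qed.

(** Completeness of [L^(p+1)] for series with geometrically decaying norms, with an explicit rate.
    The exponent covers at once [L^2], for Riesz-Fischer, and [L^3], for the embedding. *)
Lemma slim_Lp (p : nat) (r K : R) v : 0 < r < 1 -> 0 <= K ->
  (forall j, measurable_fun setT (v j)) ->
  (forall j, \int[mu]_(x in circle R) (`|v j x| ^+ p.+1)%:E <=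
     (K * r ^+ (j * p.+1))%:E)%E ->
  forall n, (\int[mu]_(x in circle R) (`|slim v x - \sum_(j < n) v j x| ^+ p.+1)%:E
    <= (K * r ^+ (n * p.+1) / (1 - r) ^+ p.+1)%:E)%E.
Proof.
move=> r01 K0 mv vK n; have /andP[r0 r1] := r01.
have d : 0 < 1 - r by lra.
pose h j x := r ^- (j * p) * `|v (n + j)%N x| ^+ p.+1.
have h0 j x : 0 <= h j x by rewrite mulr_ge0// ?invr_ge0 exprn_ge0// ltW.
have mh j : measurable_fun setT (h j).
  apply: measurable_funM; first exact: measurable_cst.
  by apply: measurable_funX; apply: measurableT_comp.
have mhE j : measurable_fun (circle R) (fun x => (h j x)%:E).
  by apply/measurable_EFinP; exact: measurable_funTS.
have hE0 j x : circle R x -> (0 <= (h j x)%:E)%E by rewrite lee_fin.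
have mser : measurable_fun (circle R) (fun x => \sum_(0 <= j <oo) (h j x)%:E)%E.
  by apply: (@ge0_emeasurable_sum _ _ R _ _ xpredT) => // k x Cx _; exact: hE0.
apply: (@le_trans _ _ (\int[mu]_(x in circle R)
    (((1 - r) ^- p)%:E * \sum_(0 <= j <oo) (h j x)%:E))%E).
  apply: ge0_le_integral => //.
  - apply/measurable_EFinP; apply: measurable_funX; apply: measurableT_comp => //.
    apply: measurable_funB; last first.
      by apply: measurable_sum => j; apply: measurable_funTS; exact: mv.
    by apply: measurable_funTS; exact: measurable_slim.
  - exact: measurable_funeM.
  - move=> x _.
    (* Where the weighted series diverges the right side is infinite, so the junk value of [slim]
       there does no harm. *)
    have [hlt|] := ltP (\sum_(0 <= j <oo) (h j x)%:E)%E +oo%E; last first.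
      rewrite leye_eq => /eqP ->; rewrite gt0_muley ?leey// lte_fin.
      by rewrite invr_gt0 exprn_gt0.
    have [g g0 hg] := sumE_fin (fun j => h0 j x) hlt.
    rewrite /sumE in hg; rewrite hg -EFinM lee_fin.
    have := @slim_tail p r g v x n r01.
    by case=> // m; have := sumE_real (fun j => h0 j x) hg m.
rewrite ge0_integralZl//; first last.
- by rewrite lee_fin invr_ge0 exprn_ge0// ltW.
- by move=> x _; apply: nneseries_ge0 => k _ _; rewrite lee_fin.
have E : (\int[mu]_(x in circle R) (\sum_(0 <= j <oo) (h j x)%:E) =
    \sum_(0 <= j <oo) \int[mu]_(x in circle R) (h j x)%:E)%E.
  by apply: integral_nneseries.
rewrite E.
apply: (@le_trans _ _ (((1 - r) ^- p)%:E * (K * r ^+ (n * p.+1) / (1 - r))%:E)%E).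
  apply: lee_wpmul2l; first by rewrite lee_fin invr_ge0 exprn_ge0// ltW.
  apply: (@le_trans _ _ (sumE (fun j => K * r ^+ (n * p.+1) * r ^+ j))).
    apply: lee_nneseries => [j _ _|j _]; first by apply: integral_ge0 => x Cx; exact: hE0.
    under eq_integral do rewrite EFinM.
    rewrite ge0_integralZl//; last 2 first.
    - apply/measurable_EFinP; apply: measurable_funX; apply: measurableT_comp => //.
      by apply: measurable_funTS; exact: mv.
    - by rewrite lee_fin invr_ge0 exprn_ge0// ltW.
    apply: le_trans (lee_wpmul2l _ (vK _)) _.
      by rewrite lee_fin invr_ge0 exprn_ge0// ltW.
    rewrite -EFinM lee_fin mulrCA -mulrA ler_wpM2l//.
    rewrite mulnDl exprD mulrCA; apply: ler_wpM2l; first by rewrite exprn_ge0// ltW.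
    rewrite (mulnS j p) (addnC j) exprD mulrA mulVf ?mul1r//.
    by apply: expf_neq0; rewrite gt_eqF.
  apply: sumE_le => [j|m].
    by rewrite !mulr_ge0// exprn_ge0// ltW.
  rewrite -mulr_sumr ler_wpM2l//; last exact: geometric_sum_le.
  by rewrite mulr_ge0// exprn_ge0// ltW.
by rewrite -EFinM lee_fin exprS invfM [X in X <= _]mulrC mulrA.
Qed.

End SeriesLp.

(** * The trigonometric basis *)

Section Basis.
Context {R : realType}.
Implicit Types (f g u v : R -> R) (x y t : R) (a b : nat -> R) (j k n m : nat) (z : int).

Local Notation mu := (@lebesgue_measure R).

Lemma measurable_cont f : continuous f -> measurable_fun setT f.
Proof. by move=> cf; exact: continuous_measurable_fun. Qed.

Lemma measurable_cosZ t : measurable_fun setT (fun x => cos (t * x)).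
Proof.
apply: measurable_cont => x; apply: continuous_comp; last exact: continuous_cos.
by apply: cvgM; [exact: cvg_cst|exact: cvg_id].
Qed.

Lemma measurable_sinZ t : measurable_fun setT (fun x => sin (t * x)).
Proof.
apply: measurable_cont => x; apply: continuous_comp; last exact: continuous_sin.
by apply: cvgM; [exact: cvg_cst|exact: cvg_id].
Qed.

Lemma itg_cosZ t : itg (fun x => cos (t * x)).
Proof. by apply: (@itg_bounded _ _ 1 (measurable_cosZ t)) => x; exact: cos_max. Qed.

Lemma cos_periodz z x : cos (x + z%:~R * (pi *+ 2)) = cos x.
Proof.
have H n y : cos (y + n%:R * (pi *+ 2)) = cos y.
  by have := periodicn (@cosD2pi R) n y; rewrite mulr_natl.
case: z => n; first exact: H.
by rewrite NegzE mulrNz mulNr -(H n.+1 (x - _)) subrK.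
Qed.

Lemma sin_periodz z x : sin (x + z%:~R * (pi *+ 2)) = sin x.
Proof.
have H n y : sin (y + n%:R * (pi *+ 2)) = sin y.
  by have := periodicn (@sinD2pi R) n y; rewrite mulr_natl.
case: z => n; first exact: H.
by rewrite NegzE mulrNz mulNr -(H n.+1 (x - _)) subrK.
Qed.

(** Translation by [pi / z] changes the sign of the integrand, so the integral is its own
    opposite. *)
Lemma I_cosz z : z != 0 -> I (fun x : R => cos (z%:~R * x)) = 0.
Proof.
move=> z0; have zR : z%:~R != 0 :> R by rewrite intr_eq0.
have := @I_shift R (pi / z%:~R) _ (measurable_cosZ z%:~R).
rewrite (_ : I (fun x => cos (z%:~R * (x + pi / z%:~R))) =
    - I (fun x : R => cos (z%:~R * x))).
  move=> h; have {h} := h _; set J := I _ => h; suff : - J = J by lra.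
  by apply: h => x; rewrite mulrDr cos_periodz.
rewrite -IN; last exact: itg_cosZ.
congr I; apply/funext => x.
by rewrite mulrDr mulrCA divff// mulr1 cosDpi.
Qed.

Lemma I_cosz0 : I (fun x : R => cos (0%:~R * x)) = pi *+ 2.
Proof.
rewrite -[RHS]mul1r -I_cst; congr I; apply/funext => x.
by rewrite mul0r cos0.
Qed.

(* The orthonormal trigonometric basis: index 0 is the constant, index [2m - 1]
   is [sin (m x)] and index [2m] is [cos (m x)]; [fr] is the frequency. *)
Definition fr k : R := (uphalf k)%:R.
Definition nrm k : R := (Num.sqrt (if k == 0%N then pi *+ 2 else pi))^-1.
Definition tr k x : R := if odd k then sin (fr k * x) else cos (fr k * x).
Definition e k x : R := nrm k * tr k x.

Lemma nrm_gt0 k : 0 < nrm k.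
Proof.
by rewrite invr_gt0 sqrtr_gt0; case: eqP => _; have := @pi_gt0 R; lra.
Qed.

Lemma nrm_le1 k : nrm k <= 1.
Proof.
rewrite invf_le1 ?sqrtr_gt0; last by case: eqP => _; have := @pi_gt0 R; lra.
rewrite -[leLHS]sqrtr1 ler_wsqrtr//.
by case: eqP => _; have := @pi_ge2 R; lra.
Qed.

Lemma nrm2 k : nrm k ^+ 2 = (if k == 0%N then pi *+ 2 else pi)^-1.
Proof.
rewrite /nrm exprVn sqr_sqrtr//.
by case: eqP => _; have := @pi_gt0 R; lra.
Qed.

Lemma tr_le1 k x : `|tr k x| <= 1.
Proof. by rewrite /tr; case: ifP => _; [exact: sin_max|exact: cos_max]. Qed.

Lemma e_le1 k x : `|e k x| <= 1.
Proof.
rewrite /e normrM (ger0_norm (ltW (nrm_gt0 k))).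
by rewrite mulr_ile1// ?tr_le1 ?nrm_le1// ltW// nrm_gt0.
Qed.

Lemma continuous_tr k : continuous (tr k).
Proof.
rewrite /tr => x; case: (odd k); apply: continuous_comp.
- by apply: cvgM; [exact: cvg_cst|exact: cvg_id].
- exact: continuous_sin.
- by apply: cvgM; [exact: cvg_cst|exact: cvg_id].
- exact: continuous_cos.
Qed.

Lemma continuous_e k : continuous (e k).
Proof.
by move=> x; apply: cvgM; [exact: cvg_cst|exact: continuous_tr].
Qed.

Lemma measurable_e k : measurable_fun setT (e k).
Proof. exact: measurable_cont (@continuous_e k). Qed.

Lemma periodic_e k : periodic (e k) (pi *+ 2).
Proof.
move=> x; rewrite /e /tr /fr mulrDr -[(uphalf k)%:R]/((uphalf k)%:Z%:~R).
by rewrite sin_periodz cos_periodz.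
Qed.

Lemma e_odd k x : odd k -> e k (- x) = - e k x.
Proof. by move=> ok; rewrite /e /tr ok mulrN sinN mulrN. Qed.

Lemma e_even k x : ~~ odd k -> e k (- x) = e k x.
Proof. by move=> /negbTE ok; rewrite /e /tr ok mulrN cosN. Qed.

Lemma fr_uphalf_inj j k : odd j = odd k -> uphalf j = uphalf k -> j = k.
Proof.
have H n : n = ((uphalf n).*2 - odd n)%N.
  by rewrite -[in RHS](odd_double_half n) uphalf_half; lia.
by move=> h1 h2; rewrite (H j) (H k) h1 h2.
Qed.

Lemma itg_tr_mul j k : itg (fun x => tr j x * tr k x).
Proof.
apply: (@itg_bounded _ _ 1) => [|x].
  apply: measurable_cont => x; apply: cvgM; exact: continuous_tr.
by rewrite normrM mulr_ile1// tr_le1.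
Qed.

Lemma I_tr_mul j k : I (fun x => tr j x * tr k x) =
  if j == k then (if j == 0%N then pi *+ 2 else pi) else 0.
Proof.
pose zB : int := (uphalf j)%:Z - (uphalf k)%:Z.
pose zD : int := (uphalf j)%:Z + (uphalf k)%:Z.
have zBE : zB%:~R = fr j - fr k :> R by rewrite /zB intrB.
have zDE : zD%:~R = fr j + fr k :> R by rewrite /zD intrD.
have IB' : I (fun x : R => cos (zB%:~R * x)) = if uphalf j == uphalf k then pi *+ 2 else 0.
  case: eqP => [h|h]; last by rewrite I_cosz// /zB subr_eq0 eqz_nat; apply/eqP.
  by rewrite /zB h subrr I_cosz0.
have ID' : I (fun x : R => cos (zD%:~R * x)) =
    if (uphalf j == 0)%N && (uphalf k == 0)%N then pi *+ 2 else 0.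
  case: ifPn => [/andP[/eqP h1 /eqP h2]|h]; first by rewrite /zD h1 h2 I_cosz0.
  by rewrite I_cosz// /zD -PoszD eqz_nat addn_eq0.
have [oj|oj] := boolP (odd j); have [ok|ok] := boolP (odd k).
- rewrite (_ : (fun x => _) = fun x => 2^-1 * (cos (zB%:~R * x) - cos (zD%:~R * x))).
    rewrite IZ; last by apply: itgB; exact: itg_cosZ.
    rewrite IB ?IB' ?ID'; [|exact: itg_cosZ|exact: itg_cosZ].
    have j0 : (uphalf j == 0)%N = false by case: j oj {zB zD zBE zDE IB' ID'}.
    have j0' : (j == 0)%N = false by case: j oj {zB zD zBE zDE IB' ID' j0}.
    rewrite j0 j0' /= subr0; case: eqP => [h|h].
      by rewrite (fr_uphalf_inj _ h) ?oj ?ok// eqxx; lra.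
    by case: eqP => [jk|]; [rewrite jk in h|rewrite mulr0].
  apply/funext => x; rewrite /tr oj ok zBE zDE mulrBl mulrDl cosB cosD; lra.
- rewrite (_ : (j == k) = false); last by apply/eqP => jk; rewrite -jk oj in ok.
  apply: I_odd => [||x]; last by rewrite /tr oj (negbTE ok) !mulrN sinN cosN mulNr.
    by apply: measurable_cont => x; apply: cvgM; exact: continuous_tr.
  exact: itg_tr_mul.
- rewrite (_ : (j == k) = false); last by apply/eqP => jk; rewrite jk ok in oj.
  apply: I_odd => [||x]; last by rewrite /tr ok (negbTE oj) !mulrN sinN cosN mulrN.
    by apply: measurable_cont => x; apply: cvgM; exact: continuous_tr.
  exact: itg_tr_mul.
- rewrite (_ : (fun x => _) = fun x => 2^-1 * (cos (zB%:~R * x) + cos (zD%:~R * x))).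
    rewrite IZ; last by apply: itgD; exact: itg_cosZ.
    rewrite ID ?IB' ?ID'; [|exact: itg_cosZ|exact: itg_cosZ].
    have j0 i : ~~ odd i -> (uphalf i == 0)%N = (i == 0)%N by case: i => [|[]].
    rewrite !j0//; case: eqP => [h|h].
      rewrite (fr_uphalf_inj _ h) ?(negbTE oj) ?(negbTE ok)// eqxx andbb.
      by case: eqP => _; lra.
    have jk : (j == k) = false by apply/eqP => jk; rewrite jk in h.
    rewrite jk; case: ifP => [/andP[/eqP h1 /eqP h2]|_]; last by lra.
    by rewrite h1 h2 in jk.
  apply/funext => x; rewrite /tr (negbTE oj) (negbTE ok) zBE zDE mulrBl mulrDl cosB cosD; lra.
Qed.

Lemma I_e_mul j k : I (fun x => e j x * e k x) = (j == k)%:R.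
Proof.
rewrite (_ : (fun x => _) = fun x => nrm j * nrm k * (tr j x * tr k x)).
  rewrite IZ; last exact: itg_tr_mul.
  rewrite I_tr_mul; case: eqP => [->|_]; last by rewrite mulr0.
  rewrite -expr2 nrm2 mulVf//; apply: lt0r_neq0.
  by case: eqP => _; have := @pi_gt0 R; lra.
by apply/funext => x; rewrite /e; ring.
Qed.

Definition L2 u := measurable_fun setT u /\ itg (fun x => u x ^+ 2).

Lemma L2_mul u v : L2 u -> L2 v -> itg (fun x => u x * v x).
Proof.
move=> [mu_ iu] [mv iv].
apply: (@itg_le _ _ (fun x => u x ^+ 2 + v x ^+ 2)) => [|x|].
- exact: measurable_funM.
- rewrite normrM -(real_normK (num_real (u x))) -(real_normK (num_real (v x))).
  have := normr_ge0 (u x); have := normr_ge0 (v x); nra.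
- exact: itgD.
Qed.

Lemma L2D u v : L2 u -> L2 v -> L2 (fun x => u x + v x).
Proof.
move=> hu hv; have huv := L2_mul hu hv; case: hu hv => [m1 i1] [m2 i2].
split; first exact: measurable_funD.
apply: (@eq_itg _ (fun x => u x ^+ 2 + v x ^+ 2 + 2 * (u x * v x))) => [x|].
  by ring.
by apply: itgD; [exact: itgD|exact: itgZ].
Qed.

Lemma L2Z t u : L2 u -> L2 (fun x => t * u x).
Proof.
move=> [m1 i1]; split; first by apply: measurable_funM => //; exact: measurable_cst.
by apply: eq_itg (itgZ (t ^+ 2) i1) => x; rewrite exprMn.
Qed.

Lemma L2B u v : L2 u -> L2 v -> L2 (fun x => u x - v x).
Proof.
move=> hu hv; have := L2D hu (L2Z (-1) hv).
by under [X in L2 X]eq_fun do rewrite mulN1r.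
Qed.

Lemma L2_bounded u M : measurable_fun setT u -> (forall x, `|u x| <= M) -> L2 u.
Proof.
move=> mu_ uM; split => //; apply: (@itg_bounded _ _ (M ^+ 2)) => [|x].
  exact: measurable_funX.
by rewrite normrX lerXn2r// nnegrE// (le_trans (normr_ge0 _) (uM x)).
Qed.

Lemma L2_cst t : L2 (fun=> t).
Proof. by apply: (@L2_bounded _ `|t|) => //; exact: measurable_cst. Qed.

Lemma L2_e k : L2 (e k).
Proof. exact: L2_bounded (measurable_e k) (e_le1 k). Qed.

Lemma L2_itg u : L2 u -> itg u.
Proof.
move=> hu; have := L2_mul hu (L2_cst 1).
by apply: eq_itg => x; rewrite mulr1.
Qed.

Lemma L2_mul_bounded u v M : L2 u -> measurable_fun setT v ->
  (forall x, `|v x| <= M) -> L2 (fun x => u x * v x).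
Proof.
move=> [mu_ iu] mv vM; split; first exact: measurable_funM.
apply: (itg_le _ _ (itgZ (M ^+ 2) iu)) => [|x].
  by apply: measurable_funX; exact: measurable_funM.
rewrite exprMn mulrC ger0_norm; last by apply: mulr_ge0; exact: sqr_ge0.
rewrite ler_wpM2r ?sqr_ge0// -(real_normK (num_real (v x))) lerXn2r// nnegrE//.
exact: le_trans (normr_ge0 _) (vM x).
Qed.

Lemma cauchy_schwarz u v : L2 u -> L2 v ->
  I (fun x => u x * v x) ^+ 2 <= I (fun x => u x ^+ 2) * I (fun x => v x ^+ 2).
Proof.
move=> hu hv; have huv := L2_mul hu hv.
set A := I (fun x => u x ^+ 2); set B := I (fun x => v x ^+ 2).
set D := I (fun x => u x * v x).
have quad t s : 0 <= t ^+ 2 * A + 2 * t * s * D + s ^+ 2 * B.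
  have : 0 <= I (fun x => (t * u x + s * v x) ^+ 2) by apply: I_ge0 => x _; exact: sqr_ge0.
  rewrite (_ : (fun x => _) = fun x => t ^+ 2 * u x ^+ 2 +
     2 * t * s * (u x * v x) + s ^+ 2 * v x ^+ 2); last by apply/funext => x; ring.
  rewrite ID ?ID ?IZ//; first [exact: itgZ (proj2 hu)|exact: itgZ (proj2 hv)|
   exact: itgZ huv|exact: (proj2 hu)|exact: (proj2 hv)|by apply: itgD;
     [exact: itgZ (proj2 hu)|exact: itgZ]].
have A0 : 0 <= A by apply: I_ge0 => x _; exact: sqr_ge0.
have B0 : 0 <= B by apply: I_ge0 => x _; exact: sqr_ge0.
have [B1|B1] := eqVneq B 0.
  have [->|D0] := eqVneq D 0; first by rewrite expr0n/= mulr_ge0.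
  (* For [B = 0] the form takes here the value [- D^2 (A + 2)], which is negative unless [D = 0]. *)
  have := quad D (- (A + 1)); rewrite B1.
  have : 0 < D ^+ 2 by rewrite exprn_even_gt0.
  nra.
have Bp : 0 < B by rewrite lt_def B1.
have := quad B (- D); nra.
Qed.

Definition coef u k : R := I (fun x => u x * e k x).
Definition psum a n x : R := \sum_(k < n) a k * e k x.

Lemma itg_ue u k : L2 u -> itg (fun x => u x * e k x).
Proof. by move=> hu; exact: L2_mul hu (L2_e k). Qed.

Lemma fcoefD u v k : L2 u -> L2 v ->
  coef (fun x => u x + v x) k = coef u k + coef v k.
Proof.
move=> hu hv; rewrite /coef -ID; [|exact: itg_ue|exact: itg_ue].
by congr I; apply/funext => x; rewrite mulrDl.
Qed.

Lemma fcoefZ t u k : L2 u -> coef (fun x => t * u x) k = t * coef u k.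
Proof.
move=> hu; rewrite /coef -IZ; last exact: itg_ue.
by congr I; apply/funext => x; rewrite mulrA.
Qed.

Lemma fcoefB u v k : L2 u -> L2 v ->
  coef (fun x => u x - v x) k = coef u k - coef v k.
Proof.
move=> hu hv; rewrite /coef -IB; [|exact: itg_ue|exact: itg_ue].
by congr I; apply/funext => x; rewrite mulrBl.
Qed.

Lemma coef_e j k : coef (e j) k = (j == k)%:R.
Proof. exact: I_e_mul. Qed.

Lemma continuous_psum a n : continuous (psum a n).
Proof.
elim: n => [|n IH] x.
  rewrite (_ : psum a 0 = fun=> 0); first exact: cvg_cst.
  by apply/funext => y; rewrite /psum big_ord0.
rewrite (_ : psum a n.+1 = fun y => psum a n y + a n * e n y); last first.
  by apply/funext => y; rewrite /psum big_ord_recr.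
apply: cvgD; first exact: IH.
by apply: cvgM; [exact: cvg_cst|exact: continuous_e].
Qed.

Lemma measurable_psum a n : measurable_fun setT (psum a n).
Proof. exact: measurable_cont (@continuous_psum a n). Qed.

Lemma periodic_psum a n : periodic (psum a n) (pi *+ 2).
Proof. by move=> x; apply: eq_bigr => k _; rewrite periodic_e. Qed.

Lemma psum_le a n x : `|psum a n x| <= \sum_(k < n) `|a k|.
Proof.
apply: le_trans (ler_norm_sum _ _ _) _; apply: ler_sum => k _.
by rewrite normrM ler_piMr ?e_le1.
Qed.

Lemma L2_psum a n : L2 (psum a n).
Proof. exact: L2_bounded (measurable_psum a n) (psum_le a n). Qed.

Lemma coef_psum a n k : coef (psum a n) k = if (k < n)%N then a k else 0.
Proof.
elim: n => [|n IH].
  rewrite /coef (_ : (fun x => _) = fun=> 0) ?I_cst ?mul0r//.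
  by apply/funext => x; rewrite /psum big_ord0 mul0r.
rewrite (_ : psum a n.+1 = fun y => psum a n y + a n * e n y); last first.
  by apply/funext => y; rewrite /psum big_ord_recr.
rewrite fcoefD; [|exact: L2_psum|exact/L2Z/L2_e].
rewrite IH fcoefZ; last exact: L2_e.
rewrite coef_e; case: (ltngtP k n) => [kn|kn|->].
- by rewrite (ltn_trans kn)// mulr0 addr0.
- by rewrite ltnNge kn/= mulr0 addr0.
- by rewrite ltnSn mulr1 add0r.
Qed.

Lemma I_mul_psum u a n : L2 u ->
  I (fun x => u x * psum a n x) = \sum_(k < n) a k * coef u k.
Proof.
move=> hu; elim: n => [|n IH].
  rewrite big_ord0 (_ : (fun x => _) = fun=> 0) ?I_cst ?mul0r//.
  by apply/funext => x; rewrite /psum big_ord0 mulr0.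
rewrite big_ord_recr/= -IH (_ : (fun x => _) = fun x => u x * psum a n x +
   a n * (u x * e n x)).
  by rewrite ID ?IZ//; [exact: itg_ue|exact: L2_mul hu (L2_psum _ _)|exact/itgZ/itg_ue].
by apply/funext => x; rewrite /psum big_ord_recr/=; ring.
Qed.

Lemma bessel_eq u n : L2 u ->
  I (fun x => (u x - psum (coef u) n x) ^+ 2) =
  I (fun x => u x ^+ 2) - \sum_(k < n) coef u k ^+ 2.
Proof.
move=> hu; have hp := L2_psum (coef u) n.
rewrite (_ : (fun x => _) = fun x => u x ^+ 2 - 2 * (u x * psum (coef u) n x) +
  psum (coef u) n x * psum (coef u) n x); last by apply/funext => x; ring.
have i1 := L2_mul hu hp.
rewrite ID; last first.
- exact: L2_mul.
- by apply: itgB; [exact: (proj2 hu)|exact: itgZ].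
rewrite IB; [|exact: (proj2 hu)|exact: itgZ].
rewrite IZ// !I_mul_psum//.
have -> : \sum_(k < n) coef u k * coef (psum (coef u) n) k = \sum_(k < n) coef u k ^+ 2.
  by apply: eq_bigr => k _; rewrite coef_psum ltn_ord expr2.
have -> : \sum_(k < n) coef u k * coef u k = \sum_(k < n) coef u k ^+ 2.
  by apply: eq_bigr => k _; rewrite expr2.
lra.
Qed.

Lemma bessel u n : L2 u -> \sum_(k < n) coef u k ^+ 2 <= I (fun x => u x ^+ 2).
Proof.
move=> hu; rewrite -subr_ge0 -bessel_eq//.
by apply: I_ge0 => x _; exact: sqr_ge0.
Qed.

End Basis.

(** * Completeness of the trigonometric system *)

Section StepApproximation.
Context {R : realType}.

Lemma bernoulli_ge (a : R) N : 0 <= a <= 1 -> 1 - N%:R * a <= (1 - a) ^+ N.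
Proof.
move=> /andP[a0 a1]; elim: N => [|N IH]; first by rewrite expr0; lra.
rewrite exprS -natr1; have d : 0 <= 1 - a by lra.
have := ler_wpM2l d IH; have : 0 <= N%:R * a ^+ 2 by rewrite mulr_ge0// sqr_ge0.
lra.
Qed.

Lemma bernoulli_le (a : R) N : 0 <= a <= 1 -> (1 - a) ^+ N * (1 + N%:R * a) <= 1.
Proof.
move=> /andP[a0 a1]; elim: N => [|N IH]; first by rewrite expr0; lra.
rewrite exprS -natr1; have d : 0 <= (1 - a) ^+ N by rewrite exprn_ge0//; lra.
apply: le_trans IH.
rewrite [X in X * _]mulrC -mulrA; apply: ler_wpM2l => //.
have : 0 <= N%:R * a ^+ 2 by rewrite mulr_ge0// sqr_ge0.
have := sqr_ge0 a; lra.
Qed.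

(* [1 - s^n] raised to the power [s0^-n] tends to the indicator of [s < s0]. *)
Lemma step_cvg (s s0 : R) : 0 < s0 <= 1 -> 0 <= s <= 1 -> s != s0 ->
  ((1 - s ^+ n) ^+ (Num.truncn (s0 ^- n)) @[n --> \oo] --> ((s < s0)%R%:R : R))%classic.
Proof.
move=> /andP[p0 p1] /andP[s_0 s_1] ss0.
have an n : 0 <= s ^+ n <= 1 by rewrite exprn_ge0// exprn_ile1.
have w0 n N : 0 <= (1 - s ^+ n) ^+ N.
  by rewrite exprn_ge0//; have := an n; lra.
have w1 n N : (1 - s ^+ n) ^+ N <= 1.
  by rewrite exprn_ile1//; have := an n; lra.
have iv n : 0 < s0 ^- n by rewrite invr_gt0 exprn_gt0.
(* The Bernoulli inequalities give a geometric rate, of ratio [s / s0] below the threshold and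
   [s0 / s] above it. *)
suff [q [q0 q1 hq]] : exists q : R, [/\ 0 <= q, q < 1 & forall n,
   `|(1 - s ^+ n) ^+ (Num.truncn (s0 ^- n)) - (s < s0)%R%:R| <= q ^+ n].
  apply/cvgrPdist_le => eps eps0.
  have /cvgrPdist_le /(_ eps eps0) : q ^+ n @[n --> \oo] --> (0 : R).
    by apply: cvg_expr; rewrite ger0_norm.
  apply: filterS => n; rewrite sub0r normrN ger0_norm ?exprn_ge0// distrC.
  exact: le_trans.
case: (ltP s s0) => [lt|ge].
  exists (s / s0); split; first by rewrite divr_ge0// ltW.
    by rewrite ltr_pdivrMr// mul1r.
  move=> n; rewrite /= distrC ger0_norm; last by rewrite subr_ge0.
  have := bernoulli_ge (Num.truncn (s0 ^- n)) (an n).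
  have : (Num.truncn (s0 ^- n))%:R * s ^+ n <= (s / s0) ^+ n.
    rewrite expr_div_n mulrC ler_wpM2l ?exprn_ge0//.
    by have /andP[] := truncn_itv (ltW (iv n)).
  lra.
have gt : s0 < s by rewrite lt_def ss0.
have sp : 0 < s by lra.
exists (s0 / s); split; first by rewrite divr_ge0// ltW.
  by rewrite ltr_pdivrMr// mul1r.
move=> n; rewrite subr0 ger0_norm//.
have := bernoulli_le (Num.truncn (s0 ^- n)) (an n).
set w := (1 - s ^+ n) ^+ _; set N := Num.truncn _ => h.
have h2 : s ^+ n / s0 ^+ n <= 1 + N%:R * s ^+ n.
  have /andP[_] := truncn_itv (ltW (iv n)); rewrite -/N -natr1 => h3.
  have : s ^+ n * s0 ^- n <= s ^+ n * (N%:R + 1).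
    by rewrite ler_wpM2l ?exprn_ge0// ltW.
  have := an n; lra.
have h4 : w * (s ^+ n / s0 ^+ n) <= 1.
  by apply: le_trans h; rewrite ler_wpM2l// w0.
rewrite expr_div_n -[leRHS]mul1r -ler_pdivrMr; last first.
  by rewrite divr_gt0// exprn_gt0.
by rewrite invf_div.
Qed.

Lemma cos_arc (x y d : R) : 0 < d -> - pi < y - d -> y + d < pi ->
  - pi <= x <= pi -> ((cos d < cos (x - y)) = (`|x - y| < d)) *
                     ((cos (x - y) < cos d) = (d < `|x - y|)).
Proof.
move=> d0 h1 h2 /andP[x1 x2]; have pi0 := @pi_gt0 R.
rewrite -(cos_norm (x - y)).
have n0 : 0 <= `|x - y| by [].
have n2 : `|x - y| < pi *+ 2 - d.
  by rewrite ltr_norml; apply/andP; split; lra.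
have dpi : d < pi by lra.
have [le|gt] := leP `|x - y| pi.
  have hd : d \in `[0, pi] by rewrite in_itv/= !ltW.
  have hx : `|x - y| \in `[0, pi] by rewrite in_itv/= n0 le.
  by rewrite !ltr_cos.
have -> : cos `|x - y| = cos (pi *+ 2 - `|x - y|).
  by rewrite -cosN -[LHS]cosD2pi addrC.
have hd : d \in `[0, pi] by rewrite in_itv/= !ltW.
have hx : pi *+ 2 - `|x - y| \in `[0, pi] by rewrite in_itv/=; lra.
by rewrite !ltr_cos//; split; [rewrite !ltNge|]; lra.
Qed.

End StepApproximation.

Section Completeness.
Context {R : realType}.
Local Notation mu := (@lebesgue_measure R).
Context (u : R -> R).
Context (mu_ : measurable_fun setT u) (iu : itg u).

Implicit Types (f g : R -> R) (M t a b x y : R).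

(* [V] is the space of bounded multipliers [f] such that [u f] is orthogonal to
   every trigonometric function.  It is stable under multiplication by
   [cos (x - y)], and polynomials in [cos (x - y)] approximate indicators of arcs. *)
Let V f := [/\ measurable_fun setT f, exists M, forall x, `|f x| <= M &
  forall z : int, I (fun x => u x * f x * cos (z%:~R * x)) = 0 /\
                  I (fun x => u x * f x * sin (z%:~R * x)) = 0].

Let itg_uf f M : measurable_fun setT f -> (forall x, `|f x| <= M) ->
  itg (fun x => u x * f x).
Proof.
move=> mf fM; apply: (itg_le _ _ (itgZ M (itg_norm iu))) => [|x].
  exact: measurable_funM.
by rewrite normrM mulrC ler_wpM2r.
Qed.

Let itg_ufc f M t : measurable_fun setT f -> (forall x, `|f x| <= M) ->
  itg (fun x => u x * f x * cos (t * x)).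
Proof.
move=> mf fM; apply: (@eq_itg _ (fun x => u x * (f x * cos (t * x)))) => [x|].
  by rewrite mulrA.
apply: (@itg_uf _ M); first by apply: measurable_funM => //; exact: measurable_cosZ.
move=> x; rewrite normrM; apply: le_trans (fM x); rewrite ler_piMr//.
exact: cos_max.
Qed.

Let itg_ufs f M t : measurable_fun setT f -> (forall x, `|f x| <= M) ->
  itg (fun x => u x * f x * sin (t * x)).
Proof.
move=> mf fM; apply: (@eq_itg _ (fun x => u x * (f x * sin (t * x)))) => [x|].
  by rewrite mulrA.
apply: (@itg_uf _ M); first by apply: measurable_funM => //; exact: measurable_sinZ.
move=> x; rewrite normrM; apply: le_trans (fM x); rewrite ler_piMr//.
exact: sin_max.
Qed.

Let V_lin f g a b : V f -> V g -> V (fun x => a * f x + b * g x).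
Proof.
move=> [mf [M fM] Vf] [mg [N gN] Vg]; split.
- by apply: measurable_funD; apply: measurable_funM => //; exact: measurable_cst.
- exists (`|a| * M + `|b| * N) => x; apply: le_trans (ler_normD _ _) _.
  by rewrite !normrM lerD// ler_wpM2l.
- move=> z; have [f1 f2] := Vf z; have [g1 g2] := Vg z; split.
    rewrite (_ : (fun x => _) = fun x => a * (u x * f x * cos (z%:~R * x)) +
       b * (u x * g x * cos (z%:~R * x))); last by apply/funext => x; ring.
    have i1 := itg_ufc z%:~R mf fM; have i2 := itg_ufc z%:~R mg gN.
    by rewrite ID ?IZ ?f1 ?g1 ?mulr0 ?addr0//; exact: itgZ.
  rewrite (_ : (fun x => _) = fun x => a * (u x * f x * sin (z%:~R * x)) +
     b * (u x * g x * sin (z%:~R * x))); last by apply/funext => x; ring.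
  have i1 := itg_ufs z%:~R mf fM; have i2 := itg_ufs z%:~R mg gN.
  by rewrite ID ?IZ ?f2 ?g2 ?mulr0 ?addr0//; exact: itgZ.
Qed.

(** Multiplication by [cos x] only moves the frequency [z] to [z + 1] and [z - 1]. *)
Let V_cos f : V f -> V (fun x => f x * cos x).
Proof.
move=> [mf [M fM] Vf].
have mc : measurable_fun setT (@cos R) by exact: measurable_cont (@continuous_cos R).
split; first exact: measurable_funM.
  exists M => x; rewrite normrM; apply: le_trans (fM x).
  by rewrite ler_piMr// cos_max.
move=> z; have [c1 s1] := Vf (z + 1); have [c2 s2] := Vf (z - 1).
split.
  rewrite (_ : (fun x => _) = fun x => 2^-1 * (u x * f x * cos ((z + 1)%:~R * x) +
    u x * f x * cos ((z - 1)%:~R * x))).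
    have i1 := itg_ufc (z + 1)%:~R mf fM; have i2 := itg_ufc (z - 1)%:~R mf fM.
    by rewrite IZ ?ID ?c1 ?c2 ?addr0 ?mulr0//; exact: itgD.
  by apply/funext => x; rewrite intrD intrB mulrBl mulrDl mul1r cosB cosD; field.
rewrite (_ : (fun x => _) = fun x => 2^-1 * (u x * f x * sin ((z + 1)%:~R * x) +
  u x * f x * sin ((z - 1)%:~R * x))).
  have i1 := itg_ufs (z + 1)%:~R mf fM; have i2 := itg_ufs (z - 1)%:~R mf fM.
  by rewrite IZ ?ID ?s1 ?s2 ?addr0 ?mulr0//; exact: itgD.
by apply/funext => x; rewrite intrD intrB mulrBl mulrDl mul1r sinB sinD; field.
Qed.

Let V_sin f : V f -> V (fun x => f x * sin x).
Proof.
move=> [mf [M fM] Vf].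
have mc : measurable_fun setT (@sin R) by exact: measurable_cont (@continuous_sin R).
split; first exact: measurable_funM.
  exists M => x; rewrite normrM; apply: le_trans (fM x).
  by rewrite ler_piMr// sin_max.
move=> z; have [c1 s1] := Vf (z + 1); have [c2 s2] := Vf (z - 1).
split.
  rewrite (_ : (fun x => _) = fun x => 2^-1 * (u x * f x * sin ((z + 1)%:~R * x) -
    u x * f x * sin ((z - 1)%:~R * x))).
    have i1 := itg_ufs (z + 1)%:~R mf fM; have i2 := itg_ufs (z - 1)%:~R mf fM.
    by rewrite IZ ?IB ?s1 ?s2 ?subr0 ?mulr0//; exact: itgB.
  by apply/funext => x; rewrite intrD intrB mulrBl mulrDl mul1r sinB sinD; field.
rewrite (_ : (fun x => _) = fun x => 2^-1 * (u x * f x * cos ((z - 1)%:~R * x) -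
  u x * f x * cos ((z + 1)%:~R * x))).
  have i1 := itg_ufc (z + 1)%:~R mf fM; have i2 := itg_ufc (z - 1)%:~R mf fM.
  by rewrite IZ ?IB ?c1 ?c2 ?subr0 ?mulr0//; exact: itgB.
by apply/funext => x; rewrite intrB intrD mulrBl mulrDl mul1r cosB cosD; field.
Qed.

Context (u0 : forall k, coef u k = 0).

Let I_tr0 k : I (fun x => u x * tr k x) = 0.
Proof.
have h := u0 k; have n0 := nrm_gt0 (R := R) k.
have : nrm k * I (fun x => u x * tr k x) = 0.
  rewrite -IZ -?[RHS]h.
    by congr I; apply/funext => x; rewrite /e; ring.
  apply: (itg_uf _ (tr_le1 k)); exact: measurable_cont (@continuous_tr R k).
by move/eqP; rewrite mulf_eq0 gt_eqF//= => /eqP.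
Qed.

Let V1 : V (fun=> 1).
Proof.
have c n : I (fun x => u x * 1 * cos (n%:R * x)) = 0.
  rewrite -(I_tr0 n.*2); congr I; apply/funext => x.
  by rewrite mulr1 /tr odd_double /fr uphalf_double.
have s n : I (fun x => u x * 1 * sin (n%:R * x)) = 0.
  case: n => [|n].
    rewrite (_ : (fun x => _) = fun=> 0) ?I_cst ?mul0r//.
    by apply/funext => x; rewrite mul0r sin0 mulr0.
  rewrite -(I_tr0 n.*2.+1); congr I; apply/funext => x.
  by rewrite mulr1 /tr /= odd_double /= /fr /= doubleK.
split; [exact: measurable_cst|by exists 1 => x; rewrite normr1|].
case=> n; first by split; [exact: c|exact: s].
rewrite NegzE; split.
  by rewrite -(c n.+1); congr I; apply/funext => x; rewrite mulrNz mulNr cosN.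
rewrite -[RHS]oppr0 -(s n.+1) -IN; last first.
  by apply: (@itg_ufs _ 1); [exact: measurable_cst|move=> x; rewrite normr1].
by congr I; apply/funext => x; rewrite mulrNz mulNr sinN mulrN.
Qed.

(** An affine image of [cos (x - y)] with values in [0, 1], as [step_cvg] requires. *)
Let sh y x : R := (1 + cos (x - y)) / 2.

Let V_sh y f : V f -> V (fun x => f x * sh y x).
Proof.
move=> Vf; have := V_lin (2^-1) 1 Vf (V_lin (cos y / 2) (sin y / 2) (V_cos Vf) (V_sin Vf)).
congr V; apply/funext => x; rewrite /sh cosB; by field.
Qed.

Let V_pow y n f : V f -> V (fun x => f x * sh y x ^+ n).
Proof.
move=> Vf; elim: n => [|n IH].
  by move: Vf; congr V; apply/funext => x; rewrite expr0 mulr1.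
by have := V_sh y IH; congr V; apply/funext => x; rewrite exprSr mulrA.
Qed.

Let V_step y n N : V (fun x => (1 - sh y x ^+ n) ^+ N).
Proof.
elim: N => [|N IH]; first by move: V1; congr V; apply/funext => x; rewrite expr0.
have := V_lin 1 (-1) IH (V_pow y n IH); congr V; apply/funext => x.
rewrite exprS; ring.
Qed.

Let sh01 y x : 0 <= sh y x <= 1.
Proof. by rewrite /sh; have := cos_geN1 (x - y); have := cos_le1 (x - y); lra. Qed.

Let continuous_sh y : continuous (sh y).
Proof.
move=> x; apply: cvgM; last exact: cvg_cst.
apply: cvgD; first exact: cvg_cst.
apply: (cvg_comp (fun x => x - y) (@cos R)); last exact: continuous_cos.
by apply: cvgB; [exact: cvg_id|exact: cvg_cst].
Qed.

(** Polynomials in [sh y], bounded by 1, tend to the indicator [g] of the complement of the arc.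
    Each is orthogonal to [u], and dominated convergence with bound [|u|] passes this to [g]; the
    arc itself follows because [u] has integral 0. *)
Lemma arc_integral0 (y d : R) : 0 < d -> - pi < y - d -> y + d < pi ->
  I (fun x => u x * (`|x - y| < d)%R%:R) = 0.
Proof.
move=> d0 h1 h2; have pi0 := @pi_gt0 R.
pose s0 : R := (1 + cos d) / 2.
have dpi : d < pi by lra.
have cd1 : cos d < 1.
  by rewrite -cos0 ltr_cos// in_itv/= ?lexx//; lra.
have cdN : -1 < cos d.
  by rewrite -cospi ltr_cos// in_itv/= ?lexx//; lra.
have s0p : 0 < s0 <= 1 by rewrite /s0; lra.
have shE x : (- pi <= x <= pi) -> ((s0 < sh y x) = (`|x - y| < d)) *
    ((sh y x < s0) = (d < `|x - y|)).
  move=> xC; rewrite -!(cos_arc d0 h1 h2 xC) /s0 /sh.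
  by rewrite !ltr_pM2r ?invr_gt0// !ltrD2l.
pose w n x := (1 - sh y x ^+ n) ^+ (Num.truncn (s0 ^- n)).
have w01 n x : `|w n x| <= 1.
  have /andP[a b] := sh01 y x.
  rewrite ger0_norm ?exprn_ge0 ?exprn_ile1//; rewrite ?subr_ge0 ?exprn_ile1//.
  by rewrite lerBlDr lerDl exprn_ge0.
have mw n : measurable_fun setT (w n) by case: (V_step y n (Num.truncn (s0 ^- n))).
have Iw n : I (fun x => u x * w n x) = 0.
  case: (V_step y n (Num.truncn (s0 ^- n))) => _ _ /(_ 0) [h _].
  rewrite -[RHS]h; congr I; apply/funext => x.
  by rewrite mul0r cos0 mulr1.
have Iu : I u = 0.
  case: V1 => _ _ /(_ 0) [h _]; rewrite -[RHS]h; congr I; apply/funext => x.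
  by rewrite mul0r cos0 !mulr1.
pose g x : R := (d < `|x - y|)%R%:R.
have mg : measurable_fun setT g.
  apply: (measurableT_comp (f := fun b : bool => b%:R : R)) => //.
  apply: measurable_fun_ltr; first exact: measurable_cst.
  apply: measurableT_comp => //.
  exact: measurable_shift.
have [|||||_ _] := @dominated_convergence _ _ R mu _ (measurable_circle (R := R))
  (fun n x => (u x * w n x)%:E) (fun x => (u x * g x)%:E) (fun x => `|u x|%:E).
- move=> n; apply/measurable_EFinP; apply: measurable_funTS.
  by apply: measurable_funM => //; exact: mw.
- apply/measurable_EFinP; apply: measurable_funTS.
  exact: measurable_funM.
(* [step_cvg] excludes the value [s0], which [sh y] takes on the circle only at the two endpoints of
   the arc. *)
- exists ([set y - d] `|` [set y + d]); split.
  + exact: measurableU.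
  + by rewrite measureU0//= ?lebesgue_measure_set1.
  + move=> x /= nx; apply: contrapT => /not_orP[/eqP n1 /eqP n2]; apply: nx => Cx.
    apply: cvg_EFin; first exact: nearW.
    apply: cvgM; first exact: cvg_cst.
    have xC : - pi <= x <= pi by move: Cx; rewrite /circle/= in_itv.
    have xn : `|x - y| != d.
      apply/negP => /eqP; case: (ger0P (x - y)) => _ hh.
        by move/eqP: n2; apply; lra.
      by move/eqP: n1; apply; lra.
    rewrite /g -(shE x xC).2; apply: step_cvg => //.
    apply/negP => /eqP E; have [e1 e2] := shE x xC.
    by move: e1 e2 xn; rewrite E ltxx; case: ltgtP.
- exact: itg_norm.
- apply: nearW => x n Cx; rewrite lee_fin normrM ler_piMr//.
rewrite [X in X @ _ --> _](_ : _ = cst 0%E); last first.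
  by apply/funext => n /=; rewrite -[RHS](congr1 EFin (Iw n)) (I_EFin (itg_uf (mw n) (w01 n))).
have ig : itg (fun x => u x * g x).
  by apply: (itg_uf (M := 1) mg) => x; rewrite /g; case: (_ < _); rewrite ?normr1 ?normr0.
rewrite -(I_EFin ig) => h0.
have {h0} Ig : I (fun x => u x * g x) = 0.
  have <- : limn (cst (0%E : \bar R)) = (I (fun x => u x * g x))%:E -> 0 = I (fun x => u x * g x).
    by rewrite lim_cst// => -[].
  by [].
  exact/cvg_lim.
have : I (fun x => u x - u x * g x) = 0 by rewrite IB// Iu Ig subr0.
have i1 : itg (fun x => u x - u x * g x) by exact: itgB.
move=> <-; symmetry.
have ml : measurable_fun setT (fun x => u x * (`|x - y| < d)%R%:R).
  apply: measurable_funM => //.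
  apply: (measurableT_comp (f := fun b : bool => b%:R : R)) => //.
  apply: measurable_fun_ltr; last exact: measurable_cst.
  apply: measurableT_comp => //.
  exact: measurable_shift.
apply: (proj2 (I_ae i1 ml _)).
exists ([set y - d] `|` [set y + d]); split.
- exact: measurableU.
- by rewrite measureU0//= ?lebesgue_measure_set1.
- move=> x /= nx; apply: contrapT => /not_orP[/eqP n1 /eqP n2]; apply: nx => Cx.
  have xn : `|x - y| != d.
    apply/negP => /eqP; case: (ger0P (x - y)) => _ hh.
      by move/eqP: n2; apply; lra.
    by move/eqP: n1; apply; lra.
  by rewrite /g; case: ltgtP xn => // _ _; rewrite ?mulr0 ?mulr1 ?subr0 ?subrr.
Qed.

(** All integrals over arcs vanish, so the primitive of [u], extended by 0 outside the circle, is
    constant inside; by Lebesgue's differentiation theorem its derivative is [u] almost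
    everywhere. *)
Lemma fourier_zero : {ae mu, forall x, circle R x -> u x = 0}.
Proof.
have pi0 := @pi_gt0 R.
pose v := u \_ (circle R).
have iv : mu.-integrable setT (EFin \o v).
  have := integrable_mkcond (EFin \o u) (measurable_circle (R := R)) (mu := mu).
  by rewrite /v -restrict_EFin => <-.
have iS (D : set R) : measurable D -> mu.-integrable D (EFin \o v).
  by move=> mD; apply: integrableS iv.
have locv : locally_integrable setT v by exact: integrable_locally measurable_circle iu.
have := FTC1Ny (fun y => iS _ (measurable_itv _)) locv.
pose F x := \int[mu]_(t in `]-oo, x]) v t.
have FE a b : - pi < a -> a < b -> b < pi -> F b = F a.
  move=> ha ab hb.
  have := Rintegral_itvB (f := v) (a := -oo%O) (b := BRight b) (x := a)
    (iS _ (measurable_itv _)).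
  rewrite bnd_simp => /(_ isT); rewrite bnd_simp => /(_ (ltW ab)).
  rewrite -/(F a) -/(F b) => h; apply/eqP; rewrite -subr_eq0 h; apply/eqP.
  rewrite -Rintegral_itv_bndo_bndc; last by apply: iS; exact: measurable_itv.
  have := @arc_integral0 ((a + b) / 2) ((b - a) / 2); rewrite /I => <-; last 3 first.
  - by lra.
  - by lra.
  - by lra.
  rewrite Rintegral_mkcond [RHS]Rintegral_mkcond; apply: eq_Rintegral => x _.
  rewrite !patchE !mem_setE !in_itv/= /v patchE /circle mem_setE in_itv/=.
  have -> : (`|x - (a + b) / 2| < (b - a) / 2) = (a < x < b).
    by rewrite ltr_norml; apply/idP/idP => /andP[? ?]; apply/andP; split; lra.
  case: ifPn => [/andP[ax xb]|_]; last by case: ifP; rewrite ?mulr0.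
  by rewrite (_ : - pi <= x <= pi) ?mulr1//; lra.
move=> hF.
have npi : {ae mu, forall x : R, x != - pi /\ x != pi}.
  exists ([set - pi] `|` [set pi]); split.
  - exact: measurableU.
  - by rewrite measureU0//= ?lebesgue_measure_set1.
  - move=> x /= nx; apply: contrapT => /not_orP[/eqP n1 /eqP n2]; exact: nx.
apply: aeS (aeI hF npi) => x /= [[dF dFE] [n1 n2]]; rewrite /circle/= in_itv/= => /andP[x1 x2].
have xpi : - pi < x < pi by rewrite (lt_neqAle x) n2 x2 lt_def n1 x1.
rewrite (_ : u x = v x); last first.
  by rewrite /v patchE ifT// inE /circle/= in_itv/= x1 x2.
rewrite -dFE derive1E.
rewrite (near_eq_derive (g := fun=> F x)) ?derive_cst//; last first.
near=> y; have yb : - pi < y < pi.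
  near: y; have : x \in `](- pi), pi[ by rewrite in_itv/=.
  by move=> hx; have := near_in_itvoo hx; apply: filterS => y; rewrite in_itv.
case: (ltgtP x y) => [xy|xy|->//]; last symmetry.
  by apply: FE => //; have := andP xpi; have := andP yb; lra.
by apply: FE => //; have := andP xpi; have := andP yb; lra.
Unshelve. all: by end_near. Qed.

End Completeness.

(** * Square-summable and absolutely summable Fourier series *)

Section RieszFischer.
Context {R : realType}.
Implicit Types (u v : R -> R) (a b : nat -> R) (k n m : nat) (B x : R).
Local Notation mu := (@lebesgue_measure R).

Lemma I_psum2 a n : I (fun x => psum a n x ^+ 2) = \sum_(k < n) a k ^+ 2.
Proof.
rewrite (_ : (fun x => _) = fun x => psum a n x * psum a n x); last first.
  by apply/funext => x; rewrite expr2.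
rewrite I_mul_psum; last exact: L2_psum.
by apply: eq_bigr => k _; rewrite coef_psum ltn_ord expr2.
Qed.

Lemma psumB a n m x : (n <= m)%N ->
  psum a m x - psum a n x = psum (fun k => if (k < n)%N then 0 else a k) m x.
Proof.
move=> nm; rewrite /psum -(subnKC nm) !big_split_ord/= addrAC subrr add0r.
rewrite [in RHS]big1 ?add0r => [|i _]; last by rewrite ltn_ord mul0r.
by apply: eq_bigr => i _; rewrite ltnNge leq_addr.
Qed.

Lemma sum2_drop a n m : (n <= m)%N ->
  \sum_(k < m) (if (k < n)%N then 0 else a k) ^+ 2 =
  \sum_(k < m) a k ^+ 2 - \sum_(k < n) a k ^+ 2.
Proof.
move=> nm; rewrite -(subnKC nm) !big_split_ord/= addrAC subrr add0r.
rewrite [in LHS]big1 ?add0r => [|i _]; last by rewrite ltn_ord expr0n.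
by apply: eq_bigr => i _; rewrite ltnNge leq_addr.
Qed.

(** The tails are cut down to [4^-(j+1)], so that the partial sums along [N] form a series to which
    [slim_Lp] applies with ratio 1/2. *)
Lemma geometric_blocks a B : (forall n, \sum_(k < n) a k ^+ 2 <= B) ->
  exists N : nat -> nat, [/\ N 0%N = 0%N, (forall j, (N j < N j.+1)%N) &
    forall j m, (N j.+1 <= m)%N ->
     \sum_(k < m) a k ^+ 2 - \sum_(k < N j.+1) a k ^+ 2 <= (2^-1) ^+ (j.+1 * 2)].
Proof.
move=> aB; have a0 k : 0 <= a k ^+ 2 by exact: sqr_ge0.
have fin : (sumE (fun k => (a k ^+ 2)%R) < +oo)%E.
  by apply: (le_lt_trans (sumE_le a0 aB)); rewrite ltry.
have [S S0 SE] := sumE_fin a0 fin.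
have H (j : nat) : {n | forall m, (n <= m)%N -> S - (2^-1) ^+ (j.+1 * 2) < \sum_(k < m) a k ^+ 2}.
  by apply: cid; apply: (sumE_approx a0 SE); rewrite exprn_gt0.
pose N := fix N j := if j is i.+1 then maxn (N i).+1 (sval (H i)) else 0%N.
exists N; split => // j; first by rewrite /= leq_maxl.
move=> m Nm; have h1 := sumE_real a0 SE m.
have := svalP (H j) (N j.+1) (leq_maxr _ _); lra.
Qed.

Lemma riesz_fischer a B : (forall n, \sum_(k < n) a k ^+ 2 <= B) ->
  exists v, [/\ periodic v (pi *+ 2), L2 v, coef v = a &
   forall eps, 0 < eps -> exists n, I (fun x => (v x - psum a n x) ^+ 2) < eps].
Proof.
move=> aB; have [N [N0 Ninc Ntail]] := geometric_blocks aB.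
have Nmono i j : (i <= j)%N -> (N i <= N j)%N.
  by move=> ij; apply: (homo_leq (f := N) (r := leq)) => //; [exact: leq_trans|move=> k;
    exact: ltnW].
have Nge j : (j <= N j)%N.
  by elim: j => // j IH; apply: leq_ltn_trans IH (Ninc j).
have B0 : 0 <= B by apply: le_trans (aB 0%N); rewrite big_ord0.
pose w j x := psum a (N j.+1) x - psum a (N j) x.
have Sw n x : \sum_(j < n) w j x = psum a (N n) x.
  elim: n => [|n IH]; first by rewrite big_ord0 N0 /psum big_ord0.
  by rewrite big_ord_recr/= IH /w addrC subrK.
have mw j : measurable_fun setT (w j).
  by apply: measurable_funB; exact: measurable_psum.
have r01 : 0 < (2^-1 : R) < 1 by apply/andP; split; lra.
have Iw j : I (fun x => w j x ^+ 2) = \sum_(k < N j.+1) a k ^+ 2 - \sum_(k < N j) a k ^+ 2.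
  rewrite -(sum2_drop _ (Nmono _ _ (leqnSn j))).
  rewrite -(I_psum2 (fun k => if (k < N j)%N then 0 else a k)).
  by congr I; apply/funext => x; rewrite /w psumB// Nmono.
have itw j : itg (fun x => w j x ^+ 2).
  by apply: (proj2 (L2B _ _)); exact: L2_psum.
(* [B] bounds the first block, about whose size nothing better is known; 1 covers the later ones. *)
have wK j : (\int[mu]_(x in circle R) (`|w j x| ^+ 2)%:E <= ((B + 1) * 2^-1 ^+ (j * 2))%:E)%E.
  rewrite (_ : (fun x => _) = fun x => (w j x ^+ 2)%:E); last first.
    by apply/funext => x; rewrite real_normK ?num_real.
  rewrite -(I_EFin (itw j)) lee_fin Iw.
  case: j => [|j].
    by rewrite N0 big_ord0 subr0 mul0n expr0 mulr1; have := aB (N 1%N); lra.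
  apply: le_trans (Ntail j (N j.+2) _) _; first exact: ltnW.
  by rewrite ler_peMl ?exprn_ge0//; lra.
have K0 : 0 <= B + 1 by lra.
have HL := @slim_Lp R 1 2^-1 (B + 1) w r01 K0 mw wK.
pose v := slim w.
have mv : measurable_fun setT v by exact: measurable_slim.
have perv : periodic v (pi *+ 2).
  move=> x; rewrite /v /slim; congr (fine (limn_esup _)); apply/funext => n.
  congr EFin; apply: eq_bigr => j _.
  by rewrite /w !periodic_psum.
pose q n : R := (B + 1) * 2^-1 ^+ (n * 2) / (1 - 2^-1) ^+ 2.
have Ld n : L2 (fun x => v x - psum a (N n) x) /\
    I (fun x => (v x - psum a (N n) x) ^+ 2) <= q n.
  have hh := HL n.
  have E : (\int[mu]_(x in circle R) (`|slim w x - \sum_(j < n) w j x| ^+ 2)%:E =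
     \int[mu]_(x in circle R) ((v x - psum a (N n) x) ^+ 2)%:E)%E.
    by apply: eq_integral => x _; rewrite real_normK ?num_real// Sw.
  rewrite E in hh.
  have mm : measurable_fun setT (fun x => v x - psum a (N n) x).
    by apply: measurable_funB => //; exact: measurable_psum.
  have ii : itg (fun x => (v x - psum a (N n) x) ^+ 2).
    apply/integrableP; split.
      by apply/measurable_EFinP; apply: measurable_funTS; exact: measurable_funX.
    rewrite (_ : (\int[_]_(_ in _) _ = \int[mu]_(x in circle R)
      ((v x - psum a (N n) x) ^+ 2)%:E)%E); last first.
      by apply: eq_integral => x _ /=; rewrite ger0_norm ?sqr_ge0.
    exact: le_lt_trans hh (ltry _).
  by split => //; rewrite -lee_fin (I_EFin ii).
have L2v : L2 v.
  have := L2D (Ld 0%N).1 (L2_psum a (N 0%N)).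
  by under [X in L2 X]eq_fun do rewrite subrK.
have q_small eps : 0 < eps -> exists n0, forall n, (n0 <= n)%N -> q n < eps.
  move=> eps0.
  have : q n @[n --> \oo] --> 0.
    rewrite (_ : q = geometric ((B + 1) / (1 - 2^-1) ^+ 2) (2^-1 ^+ 2)).
      apply: cvg_geometric; rewrite ger0_norm ?exprn_ge0// expr2; lra.
    by apply/funext => n; rewrite /q /geometric/= mulrAC mulnC exprM.
  move/cvgrPdist_lt => /(_ eps eps0)[n0 _ h]; exists n0 => n n0n.
  have := h n n0n; rewrite /= sub0r normrN; apply: le_lt_trans; exact: ler_norm.
exists v; split => //; last first.
  move=> eps eps0; have [n0 hn] := q_small _ eps0.
  by exists (N n0); apply: le_lt_trans (Ld n0).2 (hn _ _).
(* As soon as [N n > k], the number [coef v k - a k] is a coefficient of [v - psum a (N n)], hence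
   small by Cauchy-Schwarz. *)
apply/funext => k; apply/eqP; rewrite -subr_eq0 -sqrf_eq0 eq_le sqr_ge0 andbT.
apply/ler_addgt0Pl => eps eps0; rewrite addr0.
have [n0 hn] := q_small _ eps0.
pose n := maxn n0 k.+1.
have kN : (k < N n)%N by apply: leq_trans (Nge n); rewrite leq_maxr.
have := cauchy_schwarz (Ld n).1 (L2_e k).
rewrite -/(coef _ k) fcoefB//; last exact: L2_psum.
rewrite coef_psum kN => /le_trans; apply.
rewrite (_ : I (fun x => e k x ^+ 2) = 1); last first.
  by rewrite (_ : (fun x => _) = fun x => e k x * e k x) ?I_e_mul ?eqxx.
rewrite mulr1; apply: le_trans (Ld n).2 _; apply/ltW/hn.
exact: leq_maxl.
Qed.

Lemma L2_ae u v : L2 u -> measurable_fun setT v ->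
  {ae mu, forall x, circle R x -> u x = v x} -> L2 v.
Proof.
move=> [m1 i1] mv uv; split => //.
apply: (proj1 (I_ae i1 _ _)); first exact: measurable_funX.
by apply: aeS uv => x h Cx; rewrite h.
Qed.

Lemma coef_ae u v k : L2 u -> measurable_fun setT v ->
  {ae mu, forall x, circle R x -> u x = v x} -> coef u k = coef v k.
Proof.
move=> hu mv uv; apply: (proj2 (I_ae (itg_ue k hu) _ _)).
  by apply: measurable_funM => //; exact: measurable_e.
by apply: aeS uv => x h Cx; rewrite h.
Qed.

Lemma fourier_inj u v : L2 u -> L2 v -> coef u = coef v ->
  {ae mu, forall x, circle R x -> u x = v x}.
Proof.
move=> hu hv uv; have hd := L2B hu hv.
have := fourier_zero (proj1 hd) (L2_itg hd).
move=> h; apply: aeS (h _) => [x hx Cx|k]; last by rewrite fcoefB// uv subrr.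
by apply/eqP; rewrite -subr_eq0; apply/eqP; exact: hx.
Qed.

(** From the coefficients of [u], [riesz_fischer] rebuilds a function that is a limit of partial
    sums; completeness of the system identifies it with [u]. *)
Lemma parseval_approx u : L2 u -> forall eps, 0 < eps ->
  exists n, forall m, (n <= m)%N ->
    I (fun x => (u x - psum (coef u) m x) ^+ 2) < eps.
Proof.
move=> hu eps eps0.
have [v [_ hv cv vn]] := riesz_fischer (fun n => bessel n hu).
have [n hn] := vn _ eps0.
have uv := fourier_inj hu hv (esym cv).
exists n => m nm; apply: le_lt_trans hn.
rewrite (_ : I (fun x => (v x - _) ^+ 2) = I (fun x => (u x - psum (coef u) n x) ^+ 2)).
  rewrite !bessel_eq// lerB//.
  by apply: (@sum_le_widen _ (fun k => coef u k ^+ 2)) => // k; exact: sqr_ge0.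
symmetry; apply: (proj2 (I_ae _ _ _)).
- by apply: (proj2 (L2B _ _)) => //; exact: L2_psum.
- by apply: measurable_funX; apply: measurable_funB; [exact: (proj1 hv)|exact: measurable_psum].
- by apply: aeS uv => x h Cx; rewrite h.
Qed.

Lemma parseval u : L2 u ->
  sumE (fun k => coef u k ^+ 2) = (I (fun x => u x ^+ 2))%:E.
Proof.
move=> hu; apply/eqP; rewrite eq_le; apply/andP; split.
  by apply: sumE_le => [k|n]; [exact: sqr_ge0|exact: bessel].
apply/lee_addgt0Pr => eps eps0.
have [n /(_ n (leqnn n))] := parseval_approx hu eps0.
rewrite bessel_eq// => h.
apply: le_trans (leeD2r _ (sumE_ge n (fun k => sqr_ge0 (coef u k)))).
by rewrite -EFinD lee_fin; lra.
Qed.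

Lemma parseval_mul u v : L2 u -> L2 v ->
  (\sum_(k < n) coef u k * coef v k) @[n --> \oo] --> I (fun x => u x * v x).
Proof.
move=> hu hv; apply/cvgrPdist_le => /= eps eps0.
pose D := I (fun x => v x ^+ 2) + 1.
have D0 : 0 < D.
  rewrite /D; apply: ltr_wpDl => //; apply: I_ge0 => x _; exact: sqr_ge0.
have e2 : 0 < eps ^+ 2 / D by rewrite divr_gt0// exprn_gt0.
have [n hn] := parseval_approx hu e2.
exists n => // m /= nm; have {}hn := hn m nm.
have hd := L2B hu (L2_psum (coef u) m).
have -> : I (fun x => u x * v x) - \sum_(k < m) coef u k * coef v k =
    I (fun x => (u x - psum (coef u) m x) * v x).
  rewrite -I_mul_psum//.
  rewrite -IB; [|exact: L2_mul|by apply: L2_mul => //; exact: L2_psum].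
  by congr I; apply/funext => x; ring.
have h2 := cauchy_schwarz hd hv.
have h3 : I (fun x => (u x - psum (coef u) m x) * v x) ^+ 2 <= eps ^+ 2.
  apply: le_trans h2 _.
  apply: (@le_trans _ _ (eps ^+ 2 / D * D)); last by rewrite divfK// gt_eqF.
  apply: ler_pM; [by apply: I_ge0 => x _; exact: sqr_ge0|by apply: I_ge0 => x _;
    exact: sqr_ge0|exact: ltW|].
  by rewrite /D lerDl.
rewrite -(ler_pXn2r (n := 2))// ?nnegrE//; last exact: ltW.
by rewrite real_normK// num_real.
Qed.

End RieszFischer.

(** * Absolutely convergent trigonometric series *)

Section AbsolutelyConvergent.
Context {R : realType}.
Implicit Types (a b : nat -> R) (k n m : nat) (B x y : R).
Local Notation mu := (@lebesgue_measure R).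

Definition abscv a := exists B, forall n, \sum_(k < n) `|a k| <= B.

Definition synth a x : R := limn (fun n => psum a n x).

Lemma psum_abs_cvg (c f : nat -> R) : abscv c -> (forall k, `|f k| <= 1) ->
  cvgn (fun n => \sum_(k < n) c k * f k).
Proof.
move=> [B aB] f1.
have := @cvg_of_bounded_abs _ (fun k => c k * f k) B.
rewrite seriesEord; apply => n; apply: le_trans (aB n); apply: ler_sum => k _.
by rewrite normrM ler_piMr.
Qed.

Lemma abs_tail (c f : nat -> R) l : abscv c -> (forall k, `|f k| <= 1) ->
  (\sum_(k < n) c k * f k) @[n --> \oo] --> l ->
  forall n T, (forall m, (n <= m)%N -> \sum_(k < m) `|c k| - \sum_(k < n) `|c k| <= T) ->
  `|l - \sum_(k < n) c k * f k| <= T.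
Proof.
move=> ca f1 cl n T hT.
apply: (@limn_norm_le _ (fun m => \sum_(k < m) c k * f k - \sum_(k < n) c k * f k) _ _ n).
  by apply: cvgB => //; exact: cvg_cst.
move=> m nm; apply: le_trans (hT m nm).
rewrite -(subnKC nm) !big_split_ord/= !(addrAC _ _ (- _)) !subrr !add0r.
apply: le_trans (ler_norm_sum _ _ _) _; apply: ler_sum => k _.
by rewrite normrM ler_piMr.
Qed.

Lemma abscv_tail a : abscv a -> forall eps, 0 < eps -> exists n, forall p m,
  (n <= p)%N -> (p <= m)%N -> \sum_(k < m) `|a k| - \sum_(k < p) `|a k| <= eps.
Proof.
move=> [B aB] eps eps0; have a0 k : 0 <= `|a k| by [].
have fin : (sumE (fun k => `|a k|%R) < +oo)%E.
  by apply: (le_lt_trans (sumE_le a0 aB)); rewrite ltry.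
have [S S0 SE] := sumE_fin a0 fin.
have [n hn] := sumE_approx a0 SE eps0.
exists n => p m np pm; have := hn p np; have := sumE_real a0 SE m; lra.
Qed.

Lemma synth_cvg a x : abscv a -> psum a n x @[n --> \oo] --> synth a x.
Proof.
by move=> ca; apply: (@psum_abs_cvg a (fun k => e k x)) => // k; exact: e_le1.
Qed.

Lemma synth_unif a : abscv a -> forall eps, 0 < eps -> exists n, forall m x,
  (n <= m)%N -> `|synth a x - psum a m x| <= eps.
Proof.
move=> ca eps eps0; have [n hn] := abscv_tail ca eps0.
exists n => m x nm; apply: (@abs_tail a (fun k => e k x)) => //.
- by move=> k; exact: e_le1.
- exact: synth_cvg.
- by move=> p mp; exact: hn.
Qed.

Lemma continuous_synth a : abscv a -> continuous (synth a).
Proof.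
move=> ca x; apply/cvgrPdist_lt => eps eps0.
have e3 : 0 < eps / 4 by lra.
have [n /(_ n _ (leqnn n)) hn] := synth_unif ca e3.
have /cvgrPdist_lt/(_ _ e3) := @continuous_psum R a n x.
apply: filterS => y hy.
have := hn x; have := hn y; move: hy; rewrite !ltr_norml !ler_norml.
by move=> /andP[? ?] /andP[? ?] /andP[? ?]; apply/andP; split; lra.
Qed.

Lemma measurable_synth a : abscv a -> measurable_fun setT (synth a).
Proof. by move=> ca; exact: measurable_cont (continuous_synth ca). Qed.

Lemma periodic_synth a : periodic (synth a) (pi *+ 2).
Proof.
move=> x; rewrite /synth.
by under eq_fun do rewrite periodic_psum.
Qed.

Lemma synth_bound a : abscv a -> exists M, forall x, `|synth a x| <= M.
Proof.
move=> ca; have [B aB] := ca; exists B => x.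
apply: (@limn_norm_le _ (fun n => psum a n x) _ _ 0%N); first exact: synth_cvg.
move=> n _; exact: le_trans (psum_le _ _ _) (aB n).
Qed.

Lemma L2_synth a : abscv a -> L2 (synth a).
Proof.
move=> ca; have [M hM] := synth_bound ca.
exact: L2_bounded (measurable_synth ca) hM.
Qed.

Lemma coef_synth a : abscv a -> coef (synth a) = a.
Proof.
move=> ca; apply/funext => k; apply/eqP; rewrite -subr_eq0 -normr_le0.
apply/ler_addgt0Pl => eps eps0; rewrite addr0.
have p2 : 0 < pi *+ 2 :> R by have := @pi_gt0 R; lra.
have e2 : 0 < eps / (pi *+ 2) by exact: divr_gt0.
have [n hn] := synth_unif ca e2.
pose m := maxn n k.+1.
have km : (k < m)%N by rewrite leq_maxr.
have hd := L2B (L2_synth ca) (L2_psum a m).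
have : coef (fun x => synth a x - psum a m x) k = coef (synth a) k - a k.
  by rewrite fcoefB ?coef_psum ?km//; [exact: L2_synth|exact: L2_psum].
move=> <-; rewrite /coef; apply: le_trans (I_norm (itg_ue k hd)) _.
rewrite -[leRHS](divfK (lt0r_neq0 p2)) -I_cst; apply: I_le.
- exact/itg_norm/itg_ue.
- exact: itg_cst.
- move=> x _; rewrite normrM; apply: le_trans (hn m x _); last exact: leq_maxl.
  by rewrite ler_piMr// e_le1.
Qed.

Lemma ae_itv_exists (P : R -> Prop) (a b : R) : a < b -> {ae mu, forall x, P x} ->
  exists x, a < x < b /\ P x.
Proof.
move=> ab [N [mN N0 PN]]; apply: contrapT => H.
have sub : `]a, b[%classic `<=` N.
  move=> x; rewrite /= in_itv/= => xab; apply: PN => /= Px.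
  by apply: H; exists x.
have h := le_measure mu (mem_set (measurable_itv _)) (mem_set mN) sub.
have := le_trans h (eq_ind _ (fun z => (mu N <= z)%E) (lexx _) _ N0).
have E : mu `]a, b[%classic = (b - a)%:E.
  by rewrite lebesgue_measure_itv/= lte_fin ab -EFinB.
move=> /(eq_ind _ (fun z => (z <= 0)%E)) /(_ _ E); rewrite lee_fin; lra.
Qed.

Lemma periodicz (f : R -> R) (z : int) x : periodic f (pi *+ 2) ->
  f (x + z%:~R * (pi *+ 2)) = f x.
Proof.
move=> pf; have H n y : f (y + n%:R * (pi *+ 2)) = f y.
  by have := periodicn pf n y; rewrite mulr_natl.
case: z => n; first exact: H.
by rewrite NegzE mulrNz mulNr -(H n.+1 (x - _)) subrK.
Qed.

Lemma circle_reduce x : exists z : int, - pi < x + z%:~R * (pi *+ 2) <= pi.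
Proof.
have p2 : 0 < pi *+ 2 :> R by have := @pi_gt0 R; lra.
exists (Num.floor ((pi - x) / (pi *+ 2))).
have := floor_itv ((pi - x) / (pi *+ 2)); set z := Num.floor _ => /andP[].
rewrite ler_pdivlMr// ltr_pdivrMr// intrD mulrDl mul1r => h1 h2.
by apply/andP; split; lra.
Qed.

Lemma cont_ae_eq_circle (f g : R -> R) : continuous f -> continuous g ->
  {ae mu, forall x, circle R x -> f x = g x} -> forall x, circle R x -> f x = g x.
Proof.
move=> cf cg fg x; have pi0 := @pi_gt0 R.
rewrite /circle/= in_itv/= => /andP[x1 x2].
apply/eqP; rewrite -subr_eq0 -normr_le0; apply/ler_addgt0Pl => eps eps0; rewrite addr0.
have e2 : 0 < eps / 2 by lra.
have /cvgrPdist_lt/(_ _ e2) [d1 /= d10 h1] := cf x.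
have /cvgrPdist_lt/(_ _ e2) [d2 /= d20 h2] := cg x.
pose d := Num.min d1 d2.
have d0 : 0 < d by rewrite lt_min d10.
(* At [x = pi] or [x = - pi] only a one-sided neighbourhood lies in the circle, hence the
   intersection with the open interval. *)
have lt : Num.max (x - d) (- pi) < Num.min (x + d) pi.
  by rewrite lt_min !gt_max; apply/andP; split; apply/andP; split; lra.
have [y [/andP[]]] := ae_itv_exists lt fg.
rewrite gt_max lt_min => /andP[y1 y2] /andP[y3 y4] /(_ _)/= hy.
have fgy : f y = g y by apply: hy; rewrite /circle/= in_itv/= !ltW.
have xy : `|x - y| < d by rewrite ltr_norml; apply/andP; split; lra.
have := h1 y; have := h2 y; rewrite /ball/= fgy => k2 k1.
have {}k1 : `|f x - g y| < eps / 2 by apply: k1; apply: lt_le_trans xy _; rewrite ge_min lexx.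
have {}k2 : `|g x - g y| < eps / 2 by apply: k2; apply: lt_le_trans xy _; rewrite ge_min lexx orbT.
by move: k1 k2; rewrite !ltr_norml ler_norml => /andP[? ?] /andP[? ?]; apply/andP; split; lra.
Qed.

Lemma cont_ae_eq (f g : R -> R) : continuous f -> continuous g ->
  periodic f (pi *+ 2) -> periodic g (pi *+ 2) ->
  {ae mu, forall x, circle R x -> f x = g x} -> f =1 g.
Proof.
move=> cf cg pf pg fg x; have [z /andP[z1 z2]] := circle_reduce x.
rewrite -(periodicz z x pf) -(periodicz z x pg).
by apply: cont_ae_eq_circle => //; rewrite /circle/= in_itv/= z2 ltW.
Qed.

Lemma abscv_coef_eq (f : R -> R) : continuous f -> periodic f (pi *+ 2) ->
  L2 f -> abscv (coef f) -> f =1 synth (coef f).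
Proof.
move=> cf pf hf ca; apply: cont_ae_eq => //; first exact: continuous_synth.
  exact: periodic_synth.
by apply: fourier_inj => //; [exact: L2_synth|rewrite coef_synth].
Qed.

End AbsolutelyConvergent.

(** * The energy in Fourier coefficients *)

Section Energy.
Context {R : realType}.
Implicit Types (u v g : R -> R) (k n m : nat) (x y s alpha c : R).
Local Notation mu := (@lebesgue_measure R).

Lemma sum_pairs (g : nat -> R) n : \sum_(k < n.*2.+1) g k =
  g 0%N + \sum_(m < n) (g m.*2.+1 + g m.*2.+2).
Proof.
elim: n => [|n IH]; first by rewrite big_ord1 big_ord0 addr0.
by rewrite doubleS 2!big_ord_recr/= IH [in RHS]big_ord_recr/=; ring.
Qed.

Lemma sum_recl (f : nat -> R) n : \sum_(k < n.+1) f k = f 0%N + \sum_(k < n) f k.+1.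
Proof. by rewrite big_ord_recl. Qed.

Lemma esum_int (f : int -> R) : (forall z, 0 <= f z) ->
  (\esum_(m in [set: int]) (f m)%:E)%E =
  (sumE (fun n => f (Posz n)) + sumE (fun n => f (Negz n)))%E.
Proof.
move=> f0; rewrite (esumID (range Posz)); last by move=> i _; rewrite lee_fin.
rewrite setTI.
have -> : [set: int] `&` ~` range Posz = range Negz.
  apply/seteqP; split => [[n|n] [_ h]|_ [n _ <-]].
  - by exfalso; apply: h; exists n.
  - by exists n.
  - by split => // -[].
rewrite /sumE !nneseries_esumT; [|by move=> n; rewrite lee_fin|by move=> n; rewrite lee_fin].
by rewrite !esum_image//; move=> i j _ _ [].
Qed.

Lemma sumE_ltyP (f : nat -> R) : (forall k, 0 <= f k) ->
  ((sumE f < +oo)%E <-> exists B, forall n, \sum_(k < n) f k <= B).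
Proof.
move=> f0; split=> [/(sumE_fin f0)[B _ hB]|[B hB]].
  by exists B; exact: sumE_real.
by apply: le_lt_trans (sumE_le f0 hB) (ltry _).
Qed.

Lemma sumE_cvg (f : nat -> R) S : (forall k, 0 <= f k) ->
  (\sum_(k < n) f k) @[n --> \oo] --> S -> sumE f = S%:E.
Proof.
move=> f0 h; apply/cvg_lim => //.
rewrite (_ : (fun n => _) = fun n => (\sum_(k < n) f k)%:E).
  by apply: cvg_EFin h; exact: nearW.
by apply/funext => n; rewrite big_mkord sumEFin.
Qed.

Lemma cvg_sumE (f : nat -> R) S : (forall k, 0 <= f k) -> sumE f = S%:E ->
  (\sum_(k < n) f k) @[n --> \oo] --> S.
Proof.
move=> f0 h; apply/cvgrPdist_le => eps eps0.
have [n hn] := sumE_approx f0 h eps0; exists n => // m /= nm.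
have := hn m nm; have := sumE_real f0 h m => ? ?.
by rewrite ger0_norm; lra.
Qed.

Lemma L2_perP u : L2_per u <-> periodic u (pi *+ 2) /\ L2 u.
Proof. by split=> [[? ? ?]|[? [? ?]]]. Qed.

Lemma coef_tr u k : L2 u -> coef u k = nrm k * I (fun x => u x * tr k x).
Proof.
move=> hu; rewrite /coef -IZ.
  by congr I; apply/funext => x; rewrite /e; ring.
apply: L2_mul => //; apply: (L2_bounded _ (tr_le1 k)).
exact: measurable_cont (@continuous_tr _ k).
Qed.

(** At [z = 0] the index [(absz z).*2.-1] falls on 0, the constant function; the factor
    [Num.sg z = 0] removes this spurious term. *)
Lemma fourier_coefE u (z : int) : L2 u -> fourier_coef u z =
  Complex ((pi *+ 2)^-1 * (coef u (absz z).*2 / nrm (absz z).*2))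
    (- ((pi *+ 2)^-1 * ((Num.sg z)%:~R * (coef u (absz z).*2.-1 / nrm (absz z).*2.-1)))).
Proof.
move=> hu; rewrite /fourier_coef !coef_tr// ![nrm _ * _]mulrC.
rewrite !mulfK ?gt_eqF ?nrm_gt0//.
have cE : \int[mu]_(x in circle R) (u x * cos (z%:~R * x)) =
    I (fun x => u x * tr (absz z).*2 x).
  congr I; apply/funext => x; rewrite /tr odd_double /fr uphalf_double.
  by case: z => n //; rewrite NegzE mulrNz mulNr cosN abszN.
have sE : \int[mu]_(x in circle R) (u x * sin (z%:~R * x)) =
    (Num.sg z)%:~R * I (fun x => u x * tr (absz z).*2.-1 x).
  case: z {cE} => [[|n]|n] /=.
  - rewrite sgr0 mul0r -[RHS](mul0r (pi *+ 2)) -I_cst; congr I; apply/funext => x.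
    by rewrite mul0r sin0 mulr0.
  - rewrite gtr0_sg// mul1r; congr I; apply/funext => x.
    by rewrite /tr /= odd_double /= /fr /= doubleK.
  - rewrite ltr0_sg// mulN1r -IN; last first.
      apply: L2_mul => //; apply: (L2_bounded _ (tr_le1 _)).
      exact: measurable_cont (@continuous_tr _ _).
    congr I; apply/funext => x.
    by rewrite /tr /= odd_double /= /fr /= doubleK NegzE mulrNz mulNr sinN mulrN.
by rewrite cE sE.
Qed.

Lemma nrm_odd n : nrm n.*2.+1 = (Num.sqrt pi)^-1 :> R.
Proof. by []. Qed.

Lemma nrm_even n : nrm n.*2.+2 = (Num.sqrt pi)^-1 :> R.
Proof. by []. Qed.

Lemma normc_fourier u n : L2 u ->
  ComplexField.Normc.normc (fourier_coef u n.+1%:Z) ^+ 2 =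
  (4 * pi)^-1 * (coef u n.*2.+1 ^+ 2 + coef u n.*2.+2 ^+ 2).
Proof.
move=> hu; have pi0 := @pi_gt0 R; rewrite fourier_coefE//=.
rewrite sqr_sqrtr ?addr_ge0 ?sqr_ge0// doubleS /= nrm_odd nrm_even.
rewrite gtr0_sg// mul1r sqrrN !exprMn !exprVn invrK sqr_sqrtr ?ltW//.
by field; lra.
Qed.

Lemma normc_fourierN u n : L2 u ->
  ComplexField.Normc.normc (fourier_coef u (Negz n)) ^+ 2 =
  ComplexField.Normc.normc (fourier_coef u n.+1%:Z) ^+ 2.
Proof.
move=> hu; rewrite !fourier_coefE//= !sqr_sqrtr ?addr_ge0 ?sqr_ge0//.
by rewrite (gtr0_sg (x := n.+1%:Z))// (ltr0_sg (x := Negz n))// mulN1r mul1r mulrN opprK sqrrN.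
Qed.

(** At index 0 the symbol of the quadratic form would be [c], possibly negative. The value 1 keeps
    all weights positive and changes no energy on functions of mean zero. *)
Definition lam (alpha c : R) k : R := if k == 0%N then 1 else fr k `^ alpha + c.
Definition En alpha c u : \bar R := sumE (fun k => lam alpha c k * coef u k ^+ 2).

Lemma fr_ge1 k : (0 < k)%N -> 1 <= fr k :> R.
Proof. by case: k => // k _; rewrite /fr /= ler1n. Qed.

Lemma powR_le s x y : 0 <= s -> 0 <= x -> x <= y -> x `^ s <= y `^ s.
Proof.
move=> s0 x0 xy; apply: ge0_ler_powR => //; rewrite nnegrE//.
exact: le_trans xy.
Qed.

Lemma fr_pow_ge1 alpha k : 0 < alpha -> (0 < k)%N -> 1 <= fr k `^ alpha :> R.
Proof.
move=> a0 k0; apply: (@le_trans _ _ (1 `^ alpha)); first by rewrite powR1.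
by apply: powR_le; [exact: ltW|exact: ler01|exact: fr_ge1].
Qed.

Lemma lam_gt0 alpha c k : 0 < alpha -> -1 < c -> 0 < lam alpha c k.
Proof.
rewrite /lam; case: k => //= k a0 hc.
by have := @fr_pow_ge1 alpha k.+1 a0 isT; lra.
Qed.

(* [1 + min (c, 0)] is the ellipticity constant of the quadratic form. *)
Lemma lam_ge alpha c k : 0 < alpha -> -1 < c -> (0 < k)%N ->
  (1 + Num.min c 0) * fr k `^ alpha <= lam alpha c k.
Proof.
move=> a0 hc; rewrite /lam; case: k => //= k _.
have := @fr_pow_ge1 alpha k.+1 a0 isT; set p := fr _ `^ _ => h.
by rewrite minEle; case: ifPn; rewrite -?ltNge => ?; nra.
Qed.

Lemma lam_le alpha c k : 0 < alpha -> (0 < k)%N ->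
  lam alpha c k <= (1 + `|c|) * fr k `^ alpha.
Proof.
move=> a0; rewrite /lam; case: k => //= k _.
have := @fr_pow_ge1 alpha k.+1 a0 isT; set p := fr _ `^ _ => h.
have := ler_norm c; have := normr_ge0 c; nra.
Qed.

Lemma ellip_gt0 c : -1 < c -> 0 < 1 + Num.min c 0.
Proof. by move=> hc; rewrite minEle; case: ifP => _; lra. Qed.

(** * The constrained problem in terms of coefficients *)

Section Sobolev.
Context (alpha c : R) (a0 : 0 < alpha) (hc : -1 < c).

Let a2 : 0 < alpha / 2.
Proof. by rewrite divr_gt0. Qed.

Let hterm u (z : int) : R := (1 + `|z%:~R : R| ^+ 2) `^ (alpha / 2) *
  ComplexField.Normc.normc (fourier_coef u z) ^+ 2.

Let hterm_ge0 u z : 0 <= hterm u z.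
Proof. by rewrite mulr_ge0 ?powR_ge0 ?sqr_ge0. Qed.

Let wgt_ge n : (n.+1%:R : R) `^ alpha <= (1 + n.+1%:R ^+ 2) `^ (alpha / 2).
Proof.
have -> : (n.+1%:R : R) `^ alpha = (n.+1%:R ^+ 2) `^ (alpha / 2).
  by rewrite -powR_mulrn// -powRrM mulrC divfK.
by apply: powR_le; rewrite ?sqr_ge0 ?lerDr//; exact: ltW.
Qed.

Let wgt_le n : (1 + n.+1%:R ^+ 2 : R) `^ (alpha / 2) <= 2 `^ (alpha / 2) * n.+1%:R `^ alpha.
Proof.
have -> : (n.+1%:R : R) `^ alpha = (n.+1%:R ^+ 2) `^ (alpha / 2).
  by rewrite -powR_mulrn// -powRrM mulrC divfK.
rewrite -powRM ?sqr_ge0//.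
apply: powR_le; rewrite ?addr_ge0 ?sqr_ge0//; first exact: ltW.
have : 1 <= n.+1%:R ^+ 2 :> R by rewrite exprn_ege1// ler1n.
lra.
Qed.

Lemma En_term_ge0 u k : 0 <= lam alpha c k * coef u k ^+ 2.
Proof. by rewrite mulr_ge0 ?sqr_ge0// ltW// lam_gt0. Qed.
Hint Resolve En_term_ge0 : core.

Let pair_eq u n : L2 u ->
  lam alpha c n.*2.+1 * coef u n.*2.+1 ^+ 2 +
  lam alpha c n.*2.+2 * coef u n.*2.+2 ^+ 2 =
  (4 * pi) * ((n.+1%:R `^ alpha + c) *
     ComplexField.Normc.normc (fourier_coef u n.+1%:Z) ^+ 2).
Proof.
move=> hu; rewrite normc_fourier// /lam /fr /= doubleK uphalf_double.
have := @pi_gt0 R; set A := n.+1%:R `^ alpha => p0.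
by field; lra.
Qed.

(** For [m >= 1] the weights [(1 + m^2)^(alpha/2)], [m^alpha] and [m^alpha + c] are comparable, the
    last one because [c > -1]. A sine-cosine pair accounts for the two frequencies [m] and [- m] of
    the complex series. *)
Lemma H_perP u : H_per (alpha / 2) u <-> L2_per u /\ (En alpha c u < +oo)%E.
Proof.
split=> [[hu fin]|[hu fin]]; have [pu L2u] := (L2_perP u).1 hu; split => //.
  have : (\esum_(m in [set: int]) (hterm u m)%:E < +oo)%E by exact: fin.
  rewrite esum_int// => fin2.
  have : (sumE (fun n => hterm u (Posz n)) < +oo)%E.
    by apply: le_lt_trans fin2; rewrite leeDl// sumE_ge0.
  move/sumE_ltyP => /(_ (fun n => hterm_ge0 u (Posz n)))[B hB].
  apply/sumE_ltyP => //; exists (coef u 0 ^+ 2 + 4 * pi * ((1 + `|c|) * B)) => n.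
  apply: le_trans (sum_le_widen (En_term_ge0 u) (_ : n <= n.*2.+1)%N) _; first by lia.
  rewrite (sum_pairs (fun k => lam alpha c k * coef u k ^+ 2)) {1}/lam eqxx mul1r lerD2l.
  under eq_bigr do rewrite pair_eq//.
  rewrite -mulr_sumr ler_wpM2l//; first by have := @pi_gt0 R; lra.
  have B0 : 0 <= 1 + `|c| by rewrite addr_ge0.
  apply: le_trans (ler_wpM2l B0 (hB n.+1)).
  rewrite (sum_recl (fun k => hterm u k%:Z)) mulrDr -[leLHS]add0r; apply: lerD.
    by rewrite mulr_ge0 ?hterm_ge0.
  rewrite mulr_sumr; apply: ler_sum => i _; rewrite /hterm [leRHS]mulrA.
  apply: ler_wpM2r; first exact: sqr_ge0.
  have := @lam_le alpha c i.+1.*2 a0; rewrite /lam /fr /= uphalf_double => /(_ isT).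
  move=> /le_trans; apply; apply: ler_wpM2l => //.
  by rewrite ger0_norm// wgt_ge.
have [B hB] := (sumE_ltyP (En_term_ge0 u)).1 fin.
change (\esum_(m in [set: int]) (hterm u m)%:E < +oo)%E.
rewrite esum_int//.
pose K : R := 2 `^ (alpha / 2) / (1 + Num.min c 0).
have K0 : 0 <= K by rewrite divr_ge0 ?powR_ge0// ltW// ellip_gt0.
have hle n : hterm u n.+1%:Z <= (4 * pi)^-1 * K *
    (lam alpha c n.*2.+1 * coef u n.*2.+1 ^+ 2 +
     lam alpha c n.*2.+2 * coef u n.*2.+2 ^+ 2).
  have E (q X : R) : q != 0 -> q^-1 * K * (q * X) = K * X by move=> q0; field.
  rewrite pair_eq// /hterm E; last by have := @pi_gt0 R; lra.
  rewrite mulrA ler_wpM2r ?sqr_ge0// ger0_norm//.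
  apply: le_trans (wgt_le n) _.
  have := @lam_ge alpha c n.+1.*2 a0 hc isT; rewrite /lam /fr /= uphalf_double => h1.
  by rewrite /K -mulrA ler_wpM2l ?powR_ge0// ler_pdivlMl ?ellip_gt0.
have hs n : \sum_(k < n) hterm u k.+1%:Z <= (4 * pi)^-1 * K * B.
  apply: (@le_trans _ _ (\sum_(k < n) ((4 * pi)^-1 * K *
    (lam alpha c k.*2.+1 * coef u k.*2.+1 ^+ 2 +
     lam alpha c k.*2.+2 * coef u k.*2.+2 ^+ 2)))).
    by apply: ler_sum => k _; exact: hle.
  rewrite -mulr_sumr; apply: ler_wpM2l.
    by rewrite mulr_ge0// invr_ge0; have := @pi_gt0 R; lra.
  apply: le_trans (hB n.*2.+1).
  by rewrite (sum_pairs (fun k => lam alpha c k * coef u k ^+ 2)) lerDr.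
have hneg n : hterm u (Negz n) = hterm u n.+1%:Z.
  rewrite /hterm normc_fourierN// NegzE mulrNz normrN//.
apply: lte_add_pinfty.
  apply/sumE_ltyP => //; exists (hterm u 0 + (4 * pi)^-1 * K * B) => n.
  apply: le_trans (sum_le_widen (fun k => hterm_ge0 u (Posz k)) (leqnSn n)) _.
  by rewrite (sum_recl (fun k => hterm u k%:Z)) lerD2l; exact: hs.
apply/sumE_ltyP => //; exists ((4 * pi)^-1 * K * B) => n.
by under eq_bigr do rewrite hneg; exact: hs.
Qed.

Lemma kcase k : [\/ k = 0%N, exists n, k = n.*2.+1 | exists n, k = n.*2.+2].
Proof.
case: k => [|k]; first by constructor 1.
have := odd_double_half k; case: (odd k) => /= hk.
  by constructor 3; exists k./2; lia.
by constructor 2; exists k./2; lia.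
Qed.

Lemma is_Dpow_coef s u g : s != 0 -> L2 u -> is_Dpow s u g ->
  forall k, coef g k = fr k `^ s * coef u k.
Proof.
move=> s0 hu [/L2_perP[_ hg] hD] k.
have n0 j : nrm j != 0 :> R by rewrite gt_eqF ?nrm_gt0.
have p2 : (pi *+ 2)^-1 != 0 :> R.
  by rewrite invr_eq0; have := @pi_gt0 R; lra.
have fin (q n w a b : R) : q != 0 -> n != 0 -> q * (a / n) = w * (q * (b / n)) -> a = w * b.
  move=> q0 nn0 hh; have /eqP : (q / n) * (a - w * b) = 0.
    rewrite mulrBr; apply/eqP; rewrite subr_eq0; apply/eqP.
    by move: hh; rewrite ![_ / n]mulrC; set t := n^-1 => hh; nra.
  rewrite mulf_eq0 mulf_eq0 invr_eq0 (negbTE q0) (negbTE nn0)/= subr_eq0.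
  by move/eqP.
case: (kcase k) => [->|[n ->]|[n ->]].
- have := hD 0; rewrite !fourier_coefE//= => /eqP; rewrite eq_complex/= => /andP[/eqP hh _].
  apply: (fin _ _ _ _ _ p2 (n0 0%N)).
  by move: hh; rewrite normr0 mul0r subr0 /fr.
- have := hD n.+1%:Z; rewrite !fourier_coefE//= => /eqP; rewrite eq_complex/= => /andP[_ /eqP hh].
  apply: (fin _ _ _ _ _ p2 (n0 n.*2.+1)).
  move: hh; rewrite gtr0_sg// !mul1r mul0r addr0 mulrN => /oppr_inj ->.
  by rewrite normr_nat /fr /= doubleK.
- have := hD n.+1%:Z; rewrite !fourier_coefE//= => /eqP; rewrite eq_complex/= => /andP[/eqP hh _].
  apply: (fin _ _ _ _ _ p2 (n0 n.*2.+2)).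
  by move: hh; rewrite mul0r subr0 doubleS normr_nat /fr /= uphalf_double.
Qed.

Lemma is_Dpow_build s u g : L2 u -> L2_per g ->
  (forall k, coef g k = fr k `^ s * coef u k) -> is_Dpow s u g.
Proof.
move=> hu hg hcf; have [_ L2g] := (L2_perP g).1 hg; split => // z.
rewrite !fourier_coefE// !hcf.
have f1 : fr (absz z).*2 = `|z%:~R| :> R by rewrite /fr uphalf_double natr_absz intr_norm.
have f2 : z != 0 -> fr (absz z).*2.-1 = `|z%:~R| :> R.
  move=> z0; rewrite /fr -intr_norm -natr_absz.
  have : (0 < absz z)%N by rewrite absz_gt0.
  by case: (absz z) => // n _; rewrite /= doubleK.
apply/eqP; rewrite eq_complex/= f1; apply/andP; split; apply/eqP; first by ring.
have [->|z0] := eqVneq z 0; first by rewrite sgr0; ring.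
by rewrite f2//; ring.
Qed.

Lemma Dpow_spec s u : s != 0 -> L2 u ->
  (sumE (fun k => ((fr k `^ s * coef u k) ^+ 2)%R) < +oo)%E ->
  L2 (Dpow s u) /\ (forall k, coef (Dpow s u) k = fr k `^ s * coef u k).
Proof.
move=> s0 hu /(sumE_ltyP (fun k => sqr_ge0 _))[B hB].
have [v [pv hv cv _]] := @riesz_fischer _ (fun k => fr k `^ s * coef u k) B hB.
have hD : is_Dpow s u (Dpow s u).
  rewrite /Dpow; apply: (@xgetPex _ (fun=> 0) [set g | is_Dpow s u g]).
  by exists v; apply: is_Dpow_build => // [|k]; [exact/L2_perP|rewrite cv].
split; first by case: hD => /L2_perP[].
exact: is_Dpow_coef.
Qed.

Lemma L2_perL2 u : L2_per u -> L2 u.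
Proof. by move/L2_perP => []. Qed.

Lemma Dpow_sum_fin u : (En alpha c u < +oo)%E ->
  (sumE (fun k => ((fr k `^ (alpha / 2) * coef u k) ^+ 2)%R) < +oo)%E.
Proof.
move=> /(sumE_ltyP (En_term_ge0 u))[B hB].
apply/sumE_ltyP => [k|]; first exact: sqr_ge0.
exists (B / (1 + Num.min c 0)) => n.
rewrite ler_pdivlMr ?ellip_gt0// mulrC mulr_sumr.
apply: le_trans (hB n); apply: ler_sum => -[k _] _ /=.
rewrite exprMn mulrA ler_wpM2r ?sqr_ge0//.
have -> : (fr k `^ (alpha / 2)) ^+ 2 = fr k `^ alpha :> R.
  by rewrite -powR_mulrn ?powR_ge0// -powRrM divfK.
case: k => [|k]; last exact: lam_ge.
by rewrite /fr /= powR0 ?gt_eqF// mulr0 /lam.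
Qed.

Lemma Bfun_eq u : L2 u -> coef u 0 = 0 -> (En alpha c u < +oo)%E ->
  En alpha c u = (2 * Bfun alpha c u)%:E.
Proof.
move=> hu u0 fin.
have s0 : alpha / 2 != 0 by rewrite gt_eqF.
have [hD cD] := Dpow_spec s0 hu (Dpow_sum_fin fin).
apply: sumE_cvg => //.
rewrite /Bfun mulrA divff// mul1r.
have -> : \int[mu]_(x in circle R) (Dpow (alpha / 2) u x ^+ 2 + c * u x ^+ 2) =
   I (fun x => Dpow (alpha / 2) u x ^+ 2) + c * I (fun x => u x ^+ 2).
  rewrite -IZ; last exact: (proj2 hu).
  by rewrite -ID//; [exact: (proj2 hD)|apply: itgZ; exact: (proj2 hu)].
have h1 := cvg_sumE (fun k => sqr_ge0 _) (parseval hD).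
have h2 := cvg_sumE (fun k => sqr_ge0 _) (parseval hu).
rewrite (_ : (fun n => _) = fun n => \sum_(k < n) coef (Dpow (alpha / 2) u) k ^+ 2 +
   c * \sum_(k < n) coef u k ^+ 2).
  by apply: cvgD => //; apply: cvgM => //; exact: cvg_cst.
apply/funext => n; rewrite mulr_sumr -big_split/=; apply: eq_bigr => -[k _] _ /=.
rewrite cD exprMn -mulrDl.
have -> : (fr k `^ (alpha / 2)) ^+ 2 = fr k `^ alpha :> R.
  by rewrite -powR_mulrn ?powR_ge0// -powRrM divfK.
by case: k => [|k]; [rewrite u0 expr0n/= !mulr0|rewrite /lam].
Qed.

Lemma coef0_I u : L2 u -> (I u = 0 <-> coef u 0 = 0).
Proof.
move=> hu; rewrite coef_tr//.
have -> : I (fun x => u x * tr 0 x) = I u.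
  by congr I; apply/funext => x; rewrite /tr /fr /= mul0r cos0 mulr1.
split=> [->|/eqP]; first by rewrite mulr0.
by rewrite mulf_eq0 gt_eqF ?nrm_gt0//= => /eqP.
Qed.

Lemma Y0P u : Y0 alpha u <-> [/\ L2_per u, (En alpha c u < +oo)%E,
  I (fun x => u x ^+ 3) = 1 & coef u 0 = 0].
Proof.
split=> [[/H_perP[hu fin] h1 h0]|[hu fin h1 h0]].
  by split => //; apply/(coef0_I (L2_perL2 hu)).
split => //; first exact/H_perP.
by apply/(coef0_I (L2_perL2 hu)).
Qed.

(** Energies on [Y0] are finite and [En] is twice [Bfun] there, so attaining the infimum is a
    comparison with each competitor. The rest of the proof works with this form. *)
Lemma ground_stateP phi : ground_state alpha c phi <->
  Y0 alpha phi /\ forall u, Y0 alpha u -> (En alpha c phi <= En alpha c u)%E.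
Proof.
have BE u : Y0 alpha u -> En alpha c u = (2 * Bfun alpha c u)%:E.
  by move=> /Y0P[hu fin _ h0]; apply: Bfun_eq => //; exact: L2_perL2.
split=> [[Yp hh]|[Yp hh]]; split => //.
  move=> u Yu; rewrite !BE// lee_fin ler_pM2l// -lee_fin hh.
  by apply: ereal_inf_lbound; exists u.
apply/eqP; rewrite eq_le; apply/andP; split; last first.
  by apply: ereal_inf_lbound; exists phi.
apply: le_ereal_inf_tmp => _ [u Yu <-].
by have := hh u Yu; rewrite !BE// !lee_fin; lra.
Qed.

End Sobolev.

End Energy.

(** * Embedding into [L^3] *)

Section Embedding.
Context {R : realType}.
Implicit Types (u v f : R -> R) (a : nat -> R) (k n m j : nat) (x y : R).
Local Notation mu := (@lebesgue_measure R).

Lemma itg_of_bound f p K : measurable_fun setT f ->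
  (\int[mu]_(x in circle R) (`|f x| ^+ p)%:E <= K%:E)%E ->
  itg (fun x => `|f x| ^+ p) /\ I (fun x => `|f x| ^+ p) <= K.
Proof.
move=> mf hK.
have mfp : measurable_fun setT (fun x => `|f x| ^+ p).
  by apply: measurable_funX; exact: measurableT_comp.
have ii : itg (fun x => `|f x| ^+ p).
  apply/integrableP; split; first by apply/measurable_EFinP; exact: measurable_funTS.
  rewrite (_ : (\int[_]_(_ in _) _ = \int[mu]_(x in circle R) (`|f x| ^+ p)%:E)%E).
    exact: le_lt_trans hK (ltry _).
  by apply: eq_integral => x _ /=; rewrite ger0_norm ?exprn_ge0.
by split => //; rewrite -lee_fin (I_EFin ii).
Qed.

Lemma sum_CS n (x y : nat -> R) :
  (\sum_(i < n) x i * y i) ^+ 2 <= (\sum_(i < n) x i ^+ 2) * (\sum_(i < n) y i ^+ 2).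
Proof.
set X := \sum_(i < n) x i ^+ 2; set Y := \sum_(i < n) y i ^+ 2.
set P := \sum_(i < n) _.
have X0 : 0 <= X by apply: sumr_ge0 => i _; exact: sqr_ge0.
have Y0 : 0 <= Y by apply: sumr_ge0 => i _; exact: sqr_ge0.
have quad t s : 0 <= t ^+ 2 * X + 2 * t * s * P + s ^+ 2 * Y.
  have : 0 <= \sum_(i < n) (t * x i + s * y i) ^+ 2.
    by apply: sumr_ge0 => i _; exact: sqr_ge0.
  rewrite /X /Y /P !mulr_sumr -!big_split/=.
  by congr (_ <= _); apply: eq_bigr => i _; ring.
have [Y1|Y1] := eqVneq Y 0.
  have [->|P0] := eqVneq P 0; first by rewrite expr0n/= mulr_ge0.
  have := quad P (- (X + 1)); rewrite Y1.
  have : 0 < P ^+ 2 by rewrite exprn_even_gt0.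
  nra.
have Yp : 0 < Y by rewrite lt_def Y1.
have := quad Y (- P); nra.
Qed.

Lemma sum_sq_le n (x : nat -> R) :
  (\sum_(i < n) x i) ^+ 2 <= n%:R * \sum_(i < n) x i ^+ 2.
Proof.
have := @sum_CS n x (fun=> 1).
under eq_bigr do rewrite mulr1.
under [X in _ <= _ * X]eq_bigr do rewrite expr1n.
by rewrite sumr_const card_ord mulrC.
Qed.

Lemma pow2_lt1 (s : R) : s < 0 -> 2 `^ s < 1.
Proof.
move=> s0; rewrite /powR pnatr_eq0/= expR_lt1 nmulr_rlt0// ln_gt0//.
by rewrite ltr1n.
Qed.

Definition wt (beta : R) k : R := if k == 0%N then 1 else fr k `^ beta.

Lemma wt_ge0 beta k : 0 <= wt beta k.
Proof. by rewrite /wt; case: ifP => _; rewrite ?powR_ge0. Qed.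

Section Block.
Context (beta : R) (hb : 1 / 3 < beta).

Let b0 : 0 < beta. Proof. by apply: lt_trans hb; rewrite divr_gt0. Qed.
(** The shift by 1 makes the blocks start at index 0; frequencies in block [j >= 1] are at least
    [2^(j-1)], which costs the factor [A]. Per block, [rho] is the decay ratio of the [L^2] norms
    and [sg] the growth ratio of the sup norm relative to [L^2]; then [r^3 = sg rho^3] governs the
    [L^3] norms, and [r < 1] means [beta > 1/3]. *)
Let N j := (2 ^ j - 1)%N.
Let NS j : N j.+1 = (N j + 2 ^ j)%N.
Proof. by rewrite /N expnS; have := expn_gt0 2 j; lia. Qed.
Let sg : R := 2 `^ (1 / 2).
Let rho : R := 2 `^ (- (beta / 2)).
Let r : R := 2 `^ (1 / 6 - beta / 2).
Let A : R := 2 `^ (beta / 2).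

Let rhojE j : A ^+ 2 * (rho ^+ j) ^+ 2 * (2 ^+ j) `^ beta = 2 `^ beta.
Proof.
rewrite /A /rho -!powR_mulrn ?powR_ge0// ?exprn_ge0//.
rewrite -!powRrM -!powRD; last 2 first.
- by apply/implyP => _; rewrite pnatr_eq0.
- by apply/implyP => _; rewrite pnatr_eq0.
by congr powR; field.
Qed.

Let wt_block j i : (1 : R) <= A ^+ 2 * (rho ^+ j) ^+ 2 * wt beta (N j + i).
Proof.
have P0 : 0 < A ^+ 2 * (rho ^+ j) ^+ 2.
  by rewrite mulr_gt0// !exprn_gt0// powR_gt0.
rewrite /wt; case: ifPn => [|k0].
  rewrite addn_eq0 => /andP[/eqP Nj _].
  have -> : j = 0%N.
    by case: j Nj {P0} => // j; rewrite /N expnS; have := expn_gt0 2 j; lia.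
  rewrite expr0 expr1n !mulr1 /A -powR_mulrn ?powR_ge0// -powRrM divfK//.
  by rewrite -[leLHS](powRr0 2) ler_powR ?ler1n// ltW.
rewrite -(ler_pM2r (_ : 0 < (2 : R) `^ beta)) ?powR_gt0// mul1r.
apply: (@le_trans _ _ (A ^+ 2 * (rho ^+ j) ^+ 2 * (2 ^+ j) `^ beta)); first by rewrite rhojE.
rewrite -(mulrA _ (fr _ `^ _)) ler_pM2l// -powRM//.
apply: powR_le; [exact: ltW|by rewrite exprn_ge0|].
rewrite /fr -natrX -natrM ler_nat.
have q0 : (0 < 2 ^ j)%N by rewrite expn_gt0.
have qo : odd (2 ^ j) = (j == 0%N) by rewrite oddX orbF.
have q1 : (j == 0%N) -> (2 ^ j = 1)%N by move/eqP ->.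
move: k0; rewrite /N uphalf_half.
have := odd_double_half (2 ^ j - 1 + i); have := odd_double_half (2 ^ j).
rewrite qo; case: (j == 0%N) q1 {qo} => q1.
  by rewrite q1//; lia.
by move: (2 ^ j)%N q0 => q q0 /=; case: (odd _) => /=; lia.
Qed.

(* If [u_j] is the part of [u] in the dyadic block of indices [2^j, 2^(j+1)),
   then [|u_j|_oo <= 2^(j/2) |u_j|_2], so that [|u_j|_3^3 <= 2^(j/2) |u_j|_2^3]
   is bounded by [2^(j (1 - 3 beta) / 2)], which is summable for [1/3 < beta]. *)
Lemma L3_embed : exists K, 0 < K /\ forall u M, L2 u -> 0 <= M ->
  (forall n, \sum_(k < n) wt beta k * coef u k ^+ 2 <= M ^+ 2) ->
  itg (fun x => `|u x| ^+ 3) /\ I (fun x => `|u x| ^+ 3) <= K * M ^+ 3.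
Proof.
have hb' := hb; have b0' := b0.
have r01 : 0 < r < 1.
  by rewrite /r powR_gt0//= pow2_lt1//; lra.
have rho01 : 0 < rho < 1.
  by rewrite /rho powR_gt0//= pow2_lt1//; lra.
exists (A ^+ 3 / (1 - r) ^+ 3); split.
  by rewrite divr_gt0// exprn_gt0// ?powR_gt0//; have /andP[] := r01; rewrite subr_gt0.
move=> u M hu M0 hM; pose a := coef u.
pose w j x := psum a (N j.+1) x - psum a (N j) x.
pose D j := M * A * rho ^+ j.
have D0 j : 0 <= D j by rewrite !mulr_ge0 ?exprn_ge0 ?powR_ge0.
have NleS j : (N j <= N j.+1)%N by rewrite NS leq_addr.
have wE j x : w j x = \sum_(i < 2 ^ j) a (N j + i)%N * e (N j + i)%N x.
  by rewrite /w /psum NS big_split_ord/= addrAC subrr add0r.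
have aD j : \sum_(i < 2 ^ j) a (N j + i)%N ^+ 2 <= D j ^+ 2.
  apply: (@le_trans _ _ (\sum_(i < 2 ^ j) A ^+ 2 * (rho ^+ j) ^+ 2 *
      (wt beta (N j + i) * a (N j + i)%N ^+ 2))).
    apply: ler_sum => i _; rewrite mulrA ler_peMl ?sqr_ge0//; exact: wt_block.
  rewrite -mulr_sumr (_ : D j ^+ 2 = A ^+ 2 * (rho ^+ j) ^+ 2 * M ^+ 2); last first.
    by rewrite /D; ring.
  apply: ler_wpM2l; first by apply: mulr_ge0; exact: sqr_ge0.
  apply: le_trans (hM (N j.+1)); rewrite NS big_split_ord/= lerDr.
  by apply: sumr_ge0 => i _; rewrite mulr_ge0 ?wt_ge0 ?sqr_ge0.
have Iw j : I (fun x => w j x ^+ 2) <= D j ^+ 2.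
  rewrite (_ : I _ = \sum_(i < 2 ^ j) a (N j + i)%N ^+ 2)//.
  rewrite (_ : (fun x => _) =
    fun x => psum (fun k => if (k < N j)%N then 0 else a k) (N j.+1) x ^+ 2).
    rewrite I_psum2 sum2_drop// NS big_split_ord/= addrAC subrr add0r//.
  by apply/funext => x; rewrite /w psumB.
have mw j : measurable_fun setT (w j) by apply: measurable_funB; exact: measurable_psum.
have L2w j : L2 (w j) by apply: L2B; exact: L2_psum.
have supw j x : `|w j x| <= sg ^+ j * D j.
  rewrite -(ler_pXn2r (n := 2))// ?nnegrE ?mulr_ge0 ?exprn_ge0 ?powR_ge0//.
  apply: (@le_trans _ _ ((\sum_(i < 2 ^ j) `|a (N j + i)%N|) ^+ 2)).
    rewrite lerXn2r ?nnegrE ?sumr_ge0// wE; apply: le_trans (ler_norm_sum _ _ _) _.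
    by apply: ler_sum => i _; rewrite normrM ler_piMr// e_le1.
  apply: le_trans (sum_sq_le _ (fun i => `|a (N j + i)%N|)) _.
  rewrite exprMn (_ : (2 ^ j)%N%:R = (sg ^+ j) ^+ 2 :> R); last first.
    have sg2 : sg ^+ 2 = 2.
      by rewrite /sg -powR_mulrn ?powR_ge0// -powRrM mul1r mulVf// powRr1.
    by rewrite -exprM mulnC exprM sg2 natrX.
  rewrite ler_wpM2l ?sqr_ge0//; apply: le_trans (aD j).
  by apply: ler_sum => i _; rewrite real_normK ?num_real.
have K2 j : (\int[mu]_(x in circle R) (`|w j x| ^+ 2)%:E <= ((M * A) ^+ 2 * rho ^+ (j * 2))%:E)%E.
  rewrite (_ : (fun x => _) = fun x => (w j x ^+ 2)%:E); last first.
    by apply/funext => x; rewrite real_normK ?num_real.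
  by rewrite -(I_EFin (proj2 (L2w j))) lee_fin exprM -exprMn; exact: Iw.
have K3 j : (\int[mu]_(x in circle R) (`|w j x| ^+ 3)%:E <= ((M * A) ^+ 3 * r ^+ (j * 3))%:E)%E.
  have i3 : itg (fun x => `|w j x| ^+ 3).
    apply: (itg_le _ _ (itgZ (sg ^+ j * D j) (proj2 (L2w j)))) => [|x].
      by apply: measurable_funX; exact: measurableT_comp.
    rewrite ger0_norm ?exprn_ge0// exprS real_normK ?num_real//.
    by rewrite ler_wpM2r ?sqr_ge0.
  rewrite -(I_EFin i3) lee_fin.
  apply: (@le_trans _ _ (I (fun x => sg ^+ j * D j * w j x ^+ 2))).
    apply: I_le => //; first exact: itgZ (proj2 (L2w j)).
    by move=> x _; rewrite exprS real_normK ?num_real// ler_wpM2r ?sqr_ge0.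
  rewrite IZ; last exact: (proj2 (L2w j)).
  apply: (@le_trans _ _ (sg ^+ j * D j * D j ^+ 2)).
    by rewrite ler_wpM2l// mulr_ge0// exprn_ge0// powR_ge0.
  rewrite -mulrA -exprS /D exprMn mulrCA ler_wpM2l ?exprn_ge0 ?mulr_ge0 ?powR_ge0//.
  rewrite (mulnC j 3) (exprM r 3 j) (_ : r ^+ 3 = sg * rho ^+ 3).
    by rewrite exprMn -!exprM (mulnC j 3).
  rewrite /r /sg /rho -!powR_mulrn ?powR_ge0// -!powRrM -powRD; last first.
    by apply/implyP => _; rewrite pnatr_eq0.
  by congr powR; field.
have MA0 n : 0 <= (M * A) ^+ n by rewrite exprn_ge0// mulr_ge0// powR_ge0.
have S3 := slim_Lp r01 (MA0 3%N) mw K3 0.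
have S2 := slim_Lp rho01 (MA0 2%N) mw K2.
have ms : measurable_fun setT (slim w) by exact: measurable_slim.
have psw n x : \sum_(j < n) w j x = psum a (N n) x.
  elim: n => [|n IH]; first by rewrite big_ord0 /psum big_ord0.
  by rewrite big_ord_recr/= IH /w addrC subrK.
have [i3 I3] : itg (fun x => `|slim w x| ^+ 3) /\
    I (fun x => `|slim w x| ^+ 3) <= A ^+ 3 / (1 - r) ^+ 3 * M ^+ 3.
  apply: itg_of_bound => //.
  rewrite (_ : A ^+ 3 / (1 - r) ^+ 3 * M ^+ 3 = (M * A) ^+ 3 * r ^+ (0 * 3) / (1 - r) ^+ 3).
    apply: le_trans S3; rewrite le_eqVlt; apply/orP; left; apply/eqP.
    by apply: eq_integral => x _; rewrite big_ord0 subr0.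
  by rewrite mul0n expr0 mulr1 exprMn mulrAC [A ^+ 3 * _]mulrC.
(* The series of blocks also converges in [L^2]. There the partial sums up to [N n] tend both to
   [slim w] and to [u], which identifies the two. *)
have uS : {ae mu, forall x, circle R x -> slim w x = u x}.
  pose q n : R := (M * A) ^+ 2 * rho ^+ (n * 2) / (1 - rho) ^+ 2.
  have Sn n : L2 (fun x => slim w x - psum a (N n) x) /\
      I (fun x => (slim w x - psum a (N n) x) ^+ 2) <= q n.
    have mm : measurable_fun setT (fun x => slim w x - psum a (N n) x).
      by apply: measurable_funB => //; exact: measurable_psum.
    have := S2 n; under eq_integral do rewrite psw.
    move=> /(itg_of_bound mm); under eq_fun do rewrite real_normK ?num_real//.
    by case.
  have L2s : L2 (slim w).
    have := L2D (Sn 0%N).1 (L2_psum a (N 0%N)).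
    by under [X in L2 X]eq_fun do rewrite subrK.
  have hd := L2B L2s hu.
  suff : I (fun x => (slim w x - u x) ^+ 2) <= 0.
    move=> h; have h0 : I (fun x => (slim w x - u x) ^+ 2) = 0.
      by apply/eqP; rewrite eq_le h/= I_ge0// => x _; exact: sqr_ge0.
    have := I0_ae _ (fun x => sqr_ge0 _) (proj2 hd) h0.
    move=> /(_ (measurable_funX _ (proj1 hd))); apply: aeS => x hx Cx.
    by have /eqP := hx Cx; rewrite sqrf_eq0 subr_eq0 => /eqP.
  apply/ler_addgt0Pl => eps eps0; rewrite addr0.
  have e4 : 0 < eps / 4 by lra.
  have [n1 hn1] := parseval_approx hu e4.
  have [n2 hn2] : exists n0, forall n, (n0 <= n)%N -> q n < eps / 4.
    have : q n @[n --> \oo] --> 0.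
      rewrite (_ : q = geometric ((M * A) ^+ 2 / (1 - rho) ^+ 2) (rho ^+ 2)).
        have /andP[h1 h2] := rho01.
        apply: cvg_geometric; rewrite ger0_norm ?exprn_ge0 ?ltW// expr2; nra.
      by apply/funext => n; rewrite /q /geometric/= mulrAC mulnC exprM.
    move/cvgrPdist_lt => /(_ _ e4)[n0 _ h]; exists n0 => n n0n.
    have := h n n0n; rewrite /= sub0r normrN; apply: le_lt_trans; exact: ler_norm.
  pose n := maxn n1 n2.
  have Nn : (n <= N n)%N by rewrite /N subn1 -ltnS prednK ?expn_gt0// ltn_expl.
  have h1 := hn1 (N n) (leq_trans (leq_maxl _ _) Nn).
  have h2 := hn2 n (leq_maxr _ _).
  have hd1 := L2B hu (L2_psum a (N n)).
  apply: (@le_trans _ _ (I (fun x => 2 * (slim w x - psum a (N n) x) ^+ 2 +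
     2 * (u x - psum a (N n) x) ^+ 2))).
    apply: I_le; first exact: (proj2 hd).
      by apply: itgD; apply: itgZ; [exact: (proj2 (Sn n).1)|exact: (proj2 hd1)].
    by move=> x _; set s := slim w x; set p := psum _ _ _; set t := u x;
      have := sqr_ge0 (s - p + (t - p)); lra.
  rewrite ID ?IZ//; first [exact: (proj2 (Sn n).1)|exact: (proj2 hd1)|exact: itgZ (proj2 (Sn
    n).1)|exact: itgZ (proj2 hd1)|idtac].
  have := (Sn n).2; rewrite -/a in h1; lra.
have mu3 : measurable_fun setT (fun x => `|u x| ^+ 3).
  by apply: measurable_funX; apply: measurableT_comp => //; exact: (proj1 hu).
have [j1 j2] := I_ae i3 mu3 (aeS (fun x h Cx => congr1 (fun t => `|t| ^+ 3) (h Cx)) uS).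
by split => //; rewrite -j2.
Qed.

End Block.

End Embedding.

(** * Existence of a ground state *)

Section Existence.
Context {R : realType}.
Implicit Types (u v f : R -> R) (a : nat -> R) (k n m j : nat) (x y : R).
Local Notation mu := (@lebesgue_measure R).

Lemma cvg_finsum (F : nat -> nat -> R) (l : nat -> R) n :
  (forall k, (F j k) @[j --> \oo] --> l k) ->
  (\sum_(k < n) F j k) @[j --> \oo] --> \sum_(k < n) l k.
Proof.
move=> h; elim: n => [|n IH].
  rewrite big_ord0 (_ : (fun j => _) = fun=> 0); first exact: cvg_cst.
  by apply/funext => j; rewrite big_ord0.
rewrite big_ord_recr/= (_ : (fun j => _) = fun j => \sum_(k < n) F j k + F j n).
  exact: cvgD.
by apply/funext => j; rewrite big_ord_recr.
Qed.

(** Compactness of a product of segments replaces the nested extractions: near a cluster point there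
    is an [s j >= j] matching its first [j] coordinates up to [1 / (j + 1)]. Monotonicity of [s] is
    not asked for; [s j >= j] is enough for the energy bounds. *)
Lemma diagonal_extraction (X : nat -> nat -> R) (r : nat -> R) :
  (forall n k, `|X n k| <= r k) ->
  exists (s : nat -> nat) (p : nat -> R), (forall j, (j <= s j)%N) /\
    forall k, (X (s j) k) @[j --> \oo] --> p k.
Proof.
move=> Xr.
pose A (k : nat) : set R := `[- r k, r k]%classic.
have co : @compact (prod_topology (fun _ : nat => R)) [set f | forall k, A k (f k)].
  by apply: tychonoff => k; exact: segment_compact.
have := co (X @ \oo) _ _; case.
  by exists 0%N => // n _ k /=; rewrite /A /= in_itv/= -ler_norml.
move=> p [_ /= pcl].
have H (j : nat) : {n | (j <= n)%N /\ forall k, (k < j)%N -> `|X n k - p k| < j.+1%:R^-1}.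
  apply: cid.
  have e0 : 0 < j.+1%:R^-1 :> R by [].
  have nb (M : nat) : @nbhs _ (prod_topology (fun _ : nat => R)) p
      [set f | forall k, (k < M)%N -> `|f k - p k| < j.+1%:R^-1].
    have F := @nbhs_filter (prod_topology (fun _ : nat => R)) p.
    elim: M => [|M IH].
      by apply: (@filterS _ _ F setT) => //; exact: (@filterT _ _ F).
    have hM : @nbhs _ (prod_topology (fun _ : nat => R)) p
       [set f | `|f M - p M| < j.+1%:R^-1].
      have := @proj_continuous nat (fun _ => R) M p _ (nbhsx_ballx (p M) _ e0).
      apply: (@filterS _ _ F) => f; rewrite /= /ball/= distrC; exact.
    apply: (@filterS _ _ F) (@filterI _ _ F _ _ IH hM) => f [h1 h2] k.
    by rewrite ltnS leq_eqVlt => /orP[/eqP -> //|]; exact: h1.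
  have FA : (X @ \oo) [set f | exists2 n, (j <= n)%N & f = X n].
    by exists j => // n /= jn; exists n.
  have [f [[n jn ->] h]] := pcl _ _ FA (nb j).
  by exists n.
exists (fun j => sval (H j)), p; split=> [j|k]; first by case: (svalP (H j)).
apply/cvgrPdist_lt => eps eps0.
have : (j.+1%:R^-1 : R) @[j --> \oo] --> 0 by exact: cvg_harmonic.
move=> /cvgrPdist_lt/(_ _ eps0)[N _ hN].
exists (maxn N k.+1) => // j /=; rewrite geq_max => /andP[Nj kj].
have [_ /(_ k kj)] := svalP (H j); rewrite distrC => /lt_trans; apply.
by have := hN j Nj; rewrite /= sub0r normrN; apply: le_lt_trans; exact: ler_norm.
Qed.

(** The cases are [|x - y| <= t |y|] and its converse. Integrated, this gives continuity of the
    cubic constraint in [L^3] without Hölder's inequality: [t] is fixed first, then [x - y] is made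
    small. *)
Lemma cube_diff_le (x y t : R) : 0 < t <= 1 ->
  `|x ^+ 3 - y ^+ 3| <= 6 * t * `|y| ^+ 3 + 7 / t ^+ 2 * `|x - y| ^+ 3.
Proof.
move=> /andP[t0 t1]; set d := `|x - y|; set Y := `|y|.
have d0 : 0 <= d by exact: normr_ge0.
have Y0 : 0 <= Y by exact: normr_ge0.
have h1 : `|x ^+ 3 - y ^+ 3| <= 3 * Y ^+ 2 * d + 3 * Y * d ^+ 2 + d ^+ 3.
  have -> : x ^+ 3 - y ^+ 3 = 3 * y ^+ 2 * (x - y) + 3 * y * (x - y) ^+ 2 + (x - y) ^+ 3 by ring.
  apply: le_trans (ler_normD _ _) _; apply: lerD; last by rewrite normrX.
  apply: le_trans (ler_normD _ _) _; apply: lerD.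
    by rewrite normrM normrM (ger0_norm (_ : 0 <= 3))// normrX.
  by rewrite normrM normrM (ger0_norm (_ : 0 <= 3))// normrX.
apply: le_trans h1 _.
have ti : 1 <= t^-1 by rewrite invf_ge1.
have tt : t^-1 <= t^-1 ^+ 2 by rewrite expr2; nra.
have [le|/ltW ge] := leP d (t * Y).
  have a1 : Y ^+ 2 * d <= t * Y ^+ 3 by have := sqr_ge0 Y; nra.
  have dY : d <= Y by nra.
  have a2 : Y * d ^+ 2 <= Y ^+ 2 * d by rewrite !expr2; have := mulr_ge0 Y0 d0; nra.
  have a3 : d ^+ 3 <= 7 / t ^+ 2 * d ^+ 3.
    rewrite ler_peMl ?exprn_ge0//; rewrite -exprVn; nra.
  lra.
have Yd : Y <= t^-1 * d by rewrite mulrC ler_pdivlMr// mulrC.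
have a1 : Y ^+ 2 * d <= t^-1 ^+ 2 * d ^+ 3.
  rewrite (_ : t^-1 ^+ 2 * d ^+ 3 = (t^-1 * d) ^+ 2 * d); last by ring.
  by rewrite ler_wpM2r// lerXn2r// nnegrE// mulr_ge0// invr_ge0 ltW.
have a2 : Y * d ^+ 2 <= t^-1 ^+ 2 * d ^+ 3.
  have : Y * d ^+ 2 <= t^-1 * d ^+ 3.
    by rewrite (_ : t^-1 * d ^+ 3 = t^-1 * d * d ^+ 2); [rewrite ler_wpM2r ?sqr_ge0|ring].
  have : t^-1 * d ^+ 3 <= t^-1 ^+ 2 * d ^+ 3 by rewrite ler_wpM2r// exprn_ge0.
  lra.
have a3 : d ^+ 3 <= t^-1 ^+ 2 * d ^+ 3 by rewrite ler_peMl ?exprn_ge0//; nra.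
have a4 : 0 <= 6 * t * Y ^+ 3 by rewrite !mulr_ge0 ?exprn_ge0// ltW.
by rewrite -exprVn -mulrA; lra.
Qed.

Lemma itg_cube u : measurable_fun setT u -> itg (fun x => `|u x| ^+ 3) ->
  itg (fun x => u x ^+ 3).
Proof.
move=> m1; apply: itg_le; first exact: measurable_funX.
by move=> x; rewrite normrX.
Qed.

Section Minimizer.
Context (alpha c : R) (ha : 1 / 3 < alpha) (hc : -1 < c).

Let a0 : 0 < alpha. Proof. by apply: lt_trans ha; rewrite divr_gt0. Qed.
Let kap : R := 1 + Num.min c 0.
Let kap0 : 0 < kap. Proof. exact: ellip_gt0. Qed.

Lemma wt_le beta k : beta <= alpha -> wt beta k <= lam alpha c k / (1 + Num.min c 0).
Proof.
move=> ba; rewrite ler_pdivlMr// mulrC; case: k => [|k].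
  rewrite /wt /lam /= mulr1 /kap; have : Num.min c 0 <= 0 by rewrite ge_min lexx orbT.
  lra.
apply: le_trans (lam_ge a0 hc (ltn0Sn k)); rewrite ler_wpM2l ?(ltW kap0)//.
by rewrite /wt /= ler_powR// fr_ge1.
Qed.

Lemma wt_sum_le beta (x : nat -> R) n B : beta <= alpha ->
  \sum_(k < n) lam alpha c k * x k ^+ 2 <= B ->
  \sum_(k < n) wt beta k * x k ^+ 2 <= B / (1 + Num.min c 0).
Proof.
move=> ba h; rewrite ler_pdivlMr// mulrC mulr_sumr; apply: le_trans h.
apply: ler_sum => k _; rewrite mulrA ler_wpM2r ?sqr_ge0// mulrC -ler_pdivlMr//.
exact: wt_le.
Qed.

Lemma En_L3 u B : L2 u -> (forall n, \sum_(k < n) lam alpha c k * coef u k ^+ 2 <= B) ->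
  itg (fun x => `|u x| ^+ 3).
Proof.
move=> hu hB; have [K [K0 hK]] := L3_embed ha.
have B0 : 0 <= B / kap.
  by rewrite divr_ge0 ?(ltW kap0)//; apply: le_trans (hB 0%N); rewrite big_ord0.
have := hK u (Num.sqrt (B / kap)) hu (sqrtr_ge0 _); case=> // n.
by rewrite sqr_sqrtr//; apply: wt_sum_le.
Qed.

Lemma sum_supp (F : nat -> R) N n : (forall k, 0 <= F k) ->
  (forall k, (N <= k)%N -> F k = 0) -> \sum_(k < n) F k <= \sum_(k < N) F k.
Proof.
move=> F0 FN; have [nN|Nn] := leqP n N; first exact: sum_le_widen.
rewrite -(subnKC (ltnW Nn)) big_split_ord/= [X in _ + X]big1 ?addr0// => i _.
by rewrite FN// leq_addr.
Qed.

(* [cos x + cos 2x] has mean zero and a positive third moment. *)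
Lemma Y0_nonempty : exists u, Y0 alpha u.
Proof.
pose b k : R := if (k == 2)%N || (k == 4)%N then Num.sqrt pi else 0.
pose f x : R := psum b 5 x.
have s0 : Num.sqrt pi != 0 :> R by rewrite sqrtr_eq0 -ltNge pi_gt0.
have fE x : f x = tr 2 x + tr 4 x.
  rewrite /f /psum !big_ord_recr big_ord0/= /b /= !mul0r !add0r !addr0 /e /nrm /=.
  by rewrite !mulrA divff// !mul1r.
have hf : L2 f by exact: L2_psum.
(* The cube is written as a combination of products of two trigonometric functions, so that
   orthogonality leaves only the term [tr 4 x * tr 4 x]. *)
pose g x : R := 2^-1 * (tr 0 x * tr 2 x + tr 2 x * tr 4 x) +
  2^-1 * 3 * (tr 0 x * tr 4 x + tr 4 x * tr 4 x) +
  2^-1 * 3 * (tr 0 x * tr 2 x + tr 2 x * tr 8 x) +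
  2^-1 * (tr 0 x * tr 4 x + tr 4 x * tr 8 x).
have fg : (fun x => f x ^+ 3) = g.
  apply/funext => x; rewrite fE /g.
  have t0 : tr 0 x = 1 :> R by rewrite /tr /= /fr /= mul0r cos0.
  have t2 : tr 2 x = cos x by rewrite /tr /= /fr /= mul1r.
  have t4 : tr 4 x = 2 * cos x ^+ 2 - 1.
    by rewrite /tr /= /fr /= mulr_natl cos_mulr2n mulr_natl.
  have t8 : tr 8 x = 2 * tr 4 x ^+ 2 - 1.
    rewrite /tr /= /fr /= (_ : 4%:R * x = (2%:R * x) *+ 2); last by ring.
    by rewrite cos_mulr2n; ring.
  by rewrite t8 t0 t4 t2; field.
have Ig : I g = 2^-1 * 3 * pi.
  have it j k : itg (fun x : R => tr j x * tr k x) := itg_tr_mul j k.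
  by rewrite /g !ID ?IZ ?ID ?I_tr_mul//=;
    first [ring | by repeat (first [exact: it|apply: itgD|apply: itgZ])].
pose J := I (fun x => f x ^+ 3).
have J0 : 0 < J by rewrite /J fg Ig; have := @pi_gt0 R; lra.
pose t := J `^ (- (3^-1)).
have t3 : t ^+ 3 = J^-1.
  rewrite /t -powR_mulrn ?powR_ge0// -powRrM mulNr mulVf// powRN powRr1// ltW//.
exists (fun x => t * f x); apply/(Y0P a0 hc).
have L2tf := L2Z t hf.
have cfE k : coef (fun x => t * f x) k = if (k < 5)%N then t * b k else 0.
  by rewrite fcoefZ// coef_psum; case: ifP; rewrite ?mulr0.
split.
- by apply/L2_perP; split => // x; rewrite /f periodic_psum.
- apply/(sumE_ltyP (En_term_ge0 a0 hc _)).
  exists (\sum_(k < 5) lam alpha c k * coef (fun x => t * f x) k ^+ 2) => n.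
  apply: (sum_supp _ (En_term_ge0 a0 hc _)) => k k5.
  by rewrite cfE ltnNge k5/= expr0n/= mulr0.
- rewrite (_ : (fun x => _) = fun x => t ^+ 3 * f x ^+ 3); last first.
    by apply/funext => x; rewrite exprMn.
  rewrite IZ ?t3 -/J ?mulVf ?gt_eqF//.
  apply: (@itg_bounded _ _ ((\sum_(k < 5) `|b k|) ^+ 3)).
    by apply: measurable_funX; exact: (proj1 hf).
  by move=> x; rewrite normrX lerXn2r ?nnegrE ?sumr_ge0// psum_le.
- by rewrite cfE/= /b mulr0.
Qed.

(** Beyond [N] the ratio of the weights, [fr k ^ (alpha - beta)], is at least [C], while the sums
    with weight [wt alpha] are at most [B / kap <= C eps]. The same [N] serves for all sequences of
    energy at most [B]. *)
Lemma wt_tail beta eps B : beta < alpha -> 0 < eps -> 0 <= B -> exists N, forall (x : nat -> R) n,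
  (forall m, \sum_(k < m) lam alpha c k * x k ^+ 2 <= B) ->
  \sum_(k < n) wt beta k * (if (k < N)%N then 0 else x k) ^+ 2 <= eps.
Proof.
move=> ba eps0 B0; pose d := alpha - beta.
have d0 : 0 < d by rewrite subr_gt0.
pose C := B / kap / eps + 1.
have C1 : 0 < C.
  by rewrite ltr_wpDl// !divr_ge0// ltW.
pose T := C `^ d^-1.
have [N hN] : exists N, (0 < N)%N /\ T <= (uphalf N)%:R.
  exists (Num.bound T).*2.+2; split => //.
  rewrite /= uphalf_double; apply: le_trans (ltW (archi_boundP _)) _; first exact: powR_ge0.
  by rewrite ler_nat.
exists N => x n hx; have hc' := hc; have ha' := ha.
apply: (@le_trans _ _ (\sum_(k < n) C^-1 * (wt alpha k * x k ^+ 2))).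
  apply: ler_sum => -[k _] _ /=; case: ltnP => kN.
    rewrite expr0n/= mulr0; apply: mulr_ge0; first by rewrite invr_ge0 ltW.
    by rewrite mulr_ge0 ?wt_ge0 ?sqr_ge0.
  rewrite (mulrA C^-1); apply: ler_wpM2r; first exact: sqr_ge0.
  have k0 : (0 < k)%N by apply: leq_trans kN; case: hN.
  have f1 := @fr_ge1 R k k0.
  have fk0 : 0 < fr k :> R by lra.
  rewrite /wt gtn_eqF// ler_pdivlMl//.
  rewrite -(subrK beta alpha) -/d addrC powRD; last by apply/implyP => _; rewrite gt_eqF.
  rewrite mulrC ler_wpM2l ?powR_ge0//.
  apply: (@le_trans _ _ (T `^ d)).
    by rewrite /T -powRrM mulVf ?gt_eqF// powRr1// ltW.
  apply: powR_le; [exact: ltW|exact: powR_ge0|].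
  by apply: le_trans (proj2 hN) _; rewrite /fr ler_nat uphalf_leq.
rewrite -mulr_sumr ler_pdivrMl//.
apply: le_trans (wt_sum_le (lexx alpha) (hx n)) _.
rewrite /C mulrDl mul1r divfK ?gt_eqF// -/kap; lra.
Qed.

Lemma exists_ground_state : exists phi, ground_state alpha c phi.
Proof.
have hc' := hc; have ha' := ha; have a0' := a0.
pose X : set R := [set x | exists2 u, Y0 alpha u & En alpha c u = x%:E].
have En0 u k : 0 <= lam alpha c k * coef u k ^+ 2 by exact: En_term_ge0.
have X0 x : X x -> 0 <= x.
  by move=> [u _ hu]; rewrite -lee_fin -hu; exact: sumE_ge0.
have YX u : Y0 alpha u -> exists2 x, X x & En alpha c u = x%:E.
  move=> Yu; have /(Y0P a0 hc)[_ fin _ _] := Yu.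
  by have [x _ hx] := sumE_fin (En0 u) fin; exists x => //; exists u.
have infX : has_inf X.
  split; last by exists 0 => x; exact: X0.
  by have [u /YX[x Xx _]] := Y0_nonempty; exists x.
pose m := inf X.
have m0 : 0 <= m by apply: lb_le_inf; [case: infX|move=> x; exact: X0].
have H n : {u | Y0 alpha u /\ forall M, \sum_(k < M) lam alpha c k * coef u k ^+ 2 <= m +
  n.+1%:R^-1}.
  apply: cid; have e0 : 0 < n.+1%:R^-1 :> R by [].
  have [x [u Yu hu] xm] := inf_adherent e0 infX.
  exists u; split=> // M; apply: le_trans (ltW xm).
  exact: (sumE_real (En0 u) hu).
pose U n := sval (H n).
have YU n : Y0 alpha (U n) by case: (svalP (H n)).
have EU n M : \sum_(k < M) lam alpha c k * coef (U n) k ^+ 2 <= m + n.+1%:R^-1.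
  by case: (svalP (H n)) => _; exact.
have L2U n : L2 (U n) by have /(Y0P a0 hc)[/L2_perL2] := YU n.
have i1 n : n.+1%:R^-1 <= 1 :> R by rewrite invf_le1// ler1n.
have lam0 k : 0 < lam alpha c k by exact: lam_gt0.
(* From [lam a^2 <= m + 1]; the crude bound [|a| <= a^2 + 1] avoids a square root. *)
have bU n k : `|coef (U n) k| <= (m + 1) / lam alpha c k + 1.
  have h1 : lam alpha c k * coef (U n) k ^+ 2 <= m + 1.
    apply: le_trans (_ : m + n.+1%:R^-1 <= _); last by rewrite lerD2l.
    apply: le_trans (EU n k.+1); rewrite big_ord_recr/= lerDr.
    by apply: sumr_ge0 => i _; exact: En0.
  have h2 : coef (U n) k ^+ 2 <= (m + 1) / lam alpha c k by rewrite ler_pdivlMr// mulrC.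
  have h3 := normr_ge0 (coef (U n) k).
  rewrite -(real_normK (num_real _)) in h2; nra.
have [s [p [sj cp]]] := diagonal_extraction bU.
pose V j := U (s j).
have EV j M : \sum_(k < M) lam alpha c k * coef (V j) k ^+ 2 <= m + j.+1%:R^-1.
  apply: le_trans (EU _ _) _; rewrite lerD2l lef_pV2 ?posrE// ler_nat ltnS.
  exact: sj.
(* Lower semicontinuity of the energy: finite partial sums pass to the limit, where the excess
   [1 / (j + 1)] disappears. *)
have pE M : \sum_(k < M) lam alpha c k * p k ^+ 2 <= m.
  have h1 : (\sum_(k < M) lam alpha c k * coef (V j) k ^+ 2) @[j --> \oo] -->
      \sum_(k < M) lam alpha c k * p k ^+ 2.
    apply: (@cvg_finsum (fun j k => lam alpha c k * coef (V j) k ^+ 2)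
      (fun k => lam alpha c k * p k ^+ 2) M) => k.
    apply: cvgM; first exact: cvg_cst.
    apply: (cvg_comp (fun j => coef (V j) k) (fun t => t ^+ 2)); first exact: cp.
    exact: exprn_continuous.
  have h2 : (m + (j.+1%:R^-1 : R)) @[j --> \oo] --> m.
    rewrite -[X in _ --> X]addr0; apply: cvgD; [exact: cvg_cst|exact: cvg_harmonic].
  by apply: (ler_cvg_to h1 h2); apply: nearW => j; exact: EV.
have p2 M : \sum_(k < M) p k ^+ 2 <= m / kap.
  have := pE M; move=> /(wt_sum_le (lexx alpha)); apply: le_trans.
  apply: ler_sum => -[k _] _ /=; rewrite ler_peMl ?sqr_ge0// /wt.
  by case: ifPn => // k0; rewrite fr_pow_ge1// lt0n.
have [v [pv L2v cv _]] := riesz_fischer p2.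
have pE' M : \sum_(k < M) lam alpha c k * coef v k ^+ 2 <= m by rewrite cv.
have v0 : coef v 0 = 0.
  rewrite cv; have h := cp 0%N.
  have h' : (0 : R) @[j --> \oo] --> p 0%N.
    apply: cvg_trans h; apply: near_eq_cvg; apply: nearW => j.
    by have /(Y0P a0 hc)[] := YU (s j).
  exact: (cvg_unique (@Rhausdorff R) h' (cvg_cst _)).
have iv : itg (fun x => `|v x| ^+ 3) := En_L3 L2v pE'.
have iV j : itg (fun x => `|V j x| ^+ 3) := En_L3 (L2U _) (EV j).
pose beta := (1 / 3 + alpha) / 2.
have b1 : 1 / 3 < beta by rewrite /beta; lra.
have ba : beta < alpha by rewrite /beta; lra.
have [K [K0 hK]] := L3_embed b1.
(* Closeness in [L^3] for a suitable [j]: below [N] finitely many coefficients converge, above [N]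
   the estimate [wt_tail] is uniform in [j]. *)
have W eps : 0 < eps -> exists j, I (fun x => `|V j x - v x| ^+ 3) <= K * eps ^+ 3.
  move=> eps0; have e2 : 0 < eps ^+ 2 / 2 by rewrite divr_gt0 ?exprn_gt0.
  (* [4 m + 4] bounds the energy of [V j - v], by [(a - p)^2 <= 2 a^2 + 2 p^2] and the energy bounds
     [m + 1] and [m]. *)
  have [N hN] := @wt_tail beta (eps ^+ 2 / 2) (4 * m + 4) ba e2 ltac:(lra).
  have hd j : L2 (fun x => V j x - v x) by apply: L2B => //; exact: L2U.
  have cd j k : coef (fun x => V j x - v x) k = coef (V j) k - p k.
    by rewrite fcoefB ?cv//; exact: L2U.
  have h1 : (\sum_(k < N) wt beta k * (coef (V j) k - p k) ^+ 2) @[j --> \oo] --> (0 : R).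
    rewrite -[X in _ --> X](_ : \sum_(k < N) wt beta k * (p k - p k) ^+ 2 = 0); last first.
      by apply: big1 => k _; rewrite subrr expr0n/= mulr0.
    apply: (@cvg_finsum (fun j k => wt beta k * (coef (V j) k - p k) ^+ 2)
      (fun k => wt beta k * (p k - p k) ^+ 2) N) => k.
    apply: cvgM; first exact: cvg_cst.
    apply: (cvg_comp (fun j => coef (V j) k - p k) (fun t => t ^+ 2)).
      by apply: cvgB; [exact: cp|exact: cvg_cst].
    exact: exprn_continuous.
  have /cvgrPdist_lt/(_ _ e2) [j _ /(_ j (leqnn j))] := h1.
  rewrite /= sub0r normrN => h2; exists j.
  apply: (proj2 (hK _ eps (hd j) (ltW eps0) _)) => n.
  have split2 : \sum_(k < n) wt beta k * coef (fun x => V j x - v x) k ^+ 2 <=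
      \sum_(k < n) (if (k < N)%N then wt beta k * (coef (V j) k - p k) ^+ 2 else 0) +
      \sum_(k < n) wt beta k * (if (k < N)%N then 0 else coef (V j) k - p k) ^+ 2.
    rewrite -big_split/=; apply: ler_sum => -[k _] _ /=; rewrite cd.
    by case: ifP; rewrite ?expr0n/= ?mulr0 ?addr0 ?add0r.
  apply: le_trans split2 _.
  have -> : eps ^+ 2 = eps ^+ 2 / 2 + eps ^+ 2 / 2 by field.
  apply: lerD.
    apply: le_trans (ltW (le_lt_trans (ler_norm _) h2)).
    apply: le_trans (@sum_supp (fun k => if (k < N)%N then
      wt beta k * (coef (V j) k - p k) ^+ 2 else 0) N n _ _) _.
    - by move=> k; case: ifP => // _; rewrite mulr_ge0 ?wt_ge0 ?sqr_ge0.
    - by move=> k Nk; rewrite ltnNge Nk.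
    - by apply: ler_sum => -[k kN] _ /=; rewrite kN.
  apply: (hN (fun k => coef (V j) k - p k)) => M.
  apply: (@le_trans _ _ (\sum_(k < M) (2 * (lam alpha c k * coef (V j) k ^+ 2) +
     2 * (lam alpha c k * p k ^+ 2)))).
    apply: ler_sum => k _; have := lam0 k; set l := lam _ _ _; set a := coef _ _ => l0.
    have := mulr_ge0 (ltW l0) (sqr_ge0 (a + p k)); lra.
  rewrite big_split/= -2!mulr_sumr; have := EV j M; have := pE M; have := i1 j.
  set A1 := bigop.body _ _ _; set A2 := bigop.body _ _ _; set A3 := _^-1; lra.
have Iv3 : I (fun x => v x ^+ 3) = 1.
  apply/eqP; rewrite -subr_eq0 -normr_le0; apply/ler_addgt0Pl => eps eps0; rewrite addr0.
  pose Q := I (fun x => `|v x| ^+ 3).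
  have Q0 : 0 <= Q by apply: I_ge0 => x _; rewrite exprn_ge0.
  (* First [t] makes the term with the fixed mass [Q] at most [eps / 2]; only then is [z] chosen,
     against the possibly large factor [7 / t^2]. *)
  pose t := Num.min 1 (eps / (12 * (Q + 1))).
  have t0 : 0 < t by rewrite lt_min ltr01 divr_gt0//; lra.
  have t01 : 0 < t <= 1 by rewrite t0 ge_min lexx.
  have tQ : 6 * t * Q <= eps / 2.
    have : t <= eps / (12 * (Q + 1)) by rewrite ge_min lexx orbT.
    rewrite ler_pdivlMr; last by lra.
    have := ltW t0; nra.
  pose B := 7 / t ^+ 2 * K.
  have B0 : 0 < B by rewrite mulr_gt0// divr_gt0// exprn_gt0.
  pose z := Num.min 1 (eps / (2 * B)).
  have z0 : 0 < z by rewrite lt_min ltr01 divr_gt0//; lra.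
  have [j hj] := W z z0.
  have zB : B * z ^+ 3 <= eps / 2.
    have z1 : z <= 1 by rewrite ge_min lexx.
    have : z <= eps / (2 * B) by rewrite ge_min lexx orbT.
    rewrite ler_pdivlMr; last by lra.
    have : z ^+ 3 <= z by rewrite -[leRHS]expr1 ler_wiXn2l// ltW.
    nra.
  have hV1 : I (fun x => V j x ^+ 3) = 1 by have /(Y0P a0 hc)[] := YU (s j).
  have m1 := proj1 (L2U (s j)); have m2 := proj1 L2v.
  have hd : L2 (fun x => V j x - v x) by apply: L2B => //; exact: L2U.
  have iw : itg (fun x => `|V j x - v x| ^+ 3).
    apply: (En_L3 (B := 4 * m + 4) hd) => M.
    apply: (@le_trans _ _ (\sum_(k < M) (2 * (lam alpha c k * coef (V j) k ^+ 2) +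
       2 * (lam alpha c k * p k ^+ 2)))).
      apply: ler_sum => k _; rewrite fcoefB ?cv//; last exact: L2U.
      have := lam0 k; set l := lam _ _ _; set a := coef _ _ => l0.
      have := mulr_ge0 (ltW l0) (sqr_ge0 (a + p k)); lra.
    rewrite big_split/= -2!mulr_sumr; have := EV j M; have := pE M; have := i1 j.
    set A1 := bigop.body _ _ _; set A2 := bigop.body _ _ _; set A3 := _^-1; lra.
  have c1 := itg_cube m1 (iV j); have c2 := itg_cube m2 iv.
  rewrite distrC -hV1 -IB//; apply: le_trans (I_norm (itgB c1 c2)) _.
  apply: (@le_trans _ _ (I (fun x => 6 * t * `|v x| ^+ 3 + 7 / t ^+ 2 * `|V j x - v x| ^+ 3))).
    apply: I_le; first exact/itg_norm/itgB.
      by apply: itgD; exact: itgZ.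
    by move=> x _; exact: cube_diff_le.
  rewrite ID ?IZ//; [|exact: itgZ|exact: itgZ].
  have k7 : 0 <= 7 / t ^+ 2 by rewrite divr_ge0// exprn_ge0// ltW.
  have := ler_wpM2l k7 hj; rewrite mulrA -/B -/Q; lra.
exists v; apply/(ground_stateP a0 hc); split.
  apply/(Y0P a0 hc); split => //; first exact/L2_perP.
  by apply/(sumE_ltyP (En0 v)); exists m.
move=> u Yu; have [x Xx ->] := YX u Yu.
apply: le_trans (sumE_le (En0 v) pE') _; rewrite lee_fin.
by apply: ge_inf => //; case: infX.
Qed.

End Minimizer.

End Existence.

(** * Bootstrap for convolution inequalities *)

Section Bootstrap.
Context {R : realType}.
Implicit Types (f X Y A B : nat -> R) (m n k N M : nat).

(** Cauchy condensation, with ratio [2^(1 - p)]. The term of index 0 vanishes by the convention for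
    powers of 0. *)
Lemma p_series (p : R) : 1 < p ->
  exists Z, 0 <= Z /\ forall N, \sum_(n < N) n%:R `^ (- p) <= Z.
Proof.
move=> p1; pose q : R := 2 `^ (1 - p).
have q01 : 0 < q < 1 by rewrite /q powR_gt0//= pow2_lt1//; lra.
have /andP[q0 q1] := q01.
have Z0 : 0 <= (1 - q)^-1 by rewrite invr_ge0; lra.
have np (n : nat) : 0 <= (n%:R : R) `^ (- p) by exact: powR_ge0.
have H J : \sum_(n < (2 ^ J)) n%:R `^ (- p) <= \sum_(j < J) q ^+ j.
  elim: J => [|J IH].
    by rewrite big_ord0 expn0 big_ord1 powR0// oppr_eq0; apply/eqP; lra.
  rewrite expnS mul2n -addnn big_split_ord/= big_ord_recr/=; apply: lerD => //.
  have -> : q ^+ J = \sum_(i < 2 ^ J) (2 ^+ J) `^ (- p).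
    rewrite big_const_ord iter_addr_0 -[RHS]mulr_natl natrX /q -powR_mulrn ?powR_ge0//.
    rewrite -powRrM -[(2 ^+ J) `^ _](_ : 2 `^ (J%:R * - p) = _); last first.
      by rewrite powRrM powR_mulrn.
    rewrite -powR_mulrn// -powRD; last by rewrite pnatr_eq0 implybT.
    by congr powR; ring.
  apply: ler_sum => i _.
  rewrite !powRN lef_pV2 ?posrE ?powR_gt0 ?exprn_gt0//.
  by apply: powR_le; [lra|exact: exprn_ge0|rewrite -natrX ler_nat leq_addr].
exists (1 - q)^-1; split => // N; apply: le_trans (geometric_sum_le N q01).
apply: le_trans (H N); apply: (@sum_le_widen _ (fun n => n%:R `^ (- p))) => //.
by rewrite ltnW// ltn_expl.
Qed.

Lemma shift_sum_le f S m N : (forall k, 0 <= f k) ->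
  (forall n, \sum_(k < n) f k <= S) -> \sum_(n < N) f (m + n)%N <= S.
Proof.
move=> f0 fS; apply: le_trans (fS (m + N)%N); rewrite big_split_ord/= lerDr.
by apply: sumr_ge0.
Qed.

(** With truncated subtraction [(m - n) + (n - m)] is the distance of [m] and [n], and each distance
    occurs at most twice. *)
Lemma dist_sum_le f S m N : (forall k, 0 <= f k) ->
  (forall n, \sum_(k < n) f k <= S) ->
  \sum_(n < N) f ((m - n) + (n - m))%N <= 2 * S.
Proof.
move=> f0 fS; apply: (@le_trans _ _ (\sum_(n < m + N) f ((m - n) + (n - m))%N)).
  by apply: (@sum_le_widen _ (fun n => f ((m - n) + (n - m))%N)) => //; rewrite leq_addl.
rewrite big_split_ord/= mulrDl !mul1r; apply: lerD; last first.
  rewrite (eq_bigr (fun i : 'I_N => f i)); first exact: fS.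
  by move=> i _; congr f; lia.
apply: le_trans (fS m.+1); rewrite sum_recl -[leLHS]add0r; apply: lerD => //.
rewrite (reindex_inj rev_ord_inj)/=; apply: ler_sum => i _.
by rewrite le_eqVlt; apply/orP; left; apply/eqP; congr f; have := ltn_ord i; lia.
Qed.

Section Convolution.
Context (alpha sigma Z : R) (a0 : 0 < alpha) (s0 : 0 < sigma) (Z0 : 0 <= Z).
Context (hZ : forall N, \sum_(n < N) n%:R `^ (- (sigma + 2 * alpha)) <= Z).
Local Notation p := (sigma + 2 * alpha).
Local Notation pw s n := ((n%:R : R) `^ s).

(** The smaller of [n] and [k] can carry the whole exponent [p]; at index 0 the powers vanish. *)
Lemma young_pow n k : pw (- (sigma + alpha)) n * pw (- alpha) k <= pw (- p) n + pw (- p) k.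
Proof.
have a0' := a0; have s0' := s0.
have pz (s : R) : 0 < s -> (0 : R) `^ (- s) = 0.
  by move=> h; rewrite powR0// oppr_eq0 gt_eqF.
case: n => [|n]; first by rewrite pz ?mul0r ?addr_ge0 ?powR_ge0//; lra.
case: k => [|k]; first by rewrite (pz alpha)// mulr0 addr_ge0 ?powR_ge0.
have np (j : nat) (s t : R) : pw s j.+1 * pw t j.+1 = pw (s + t) j.+1.
  by rewrite powRD// pnatr_eq0 implybT.
have mono (i j : nat) (s : R) : 0 < s -> (i <= j)%N -> pw (- s) j.+1 <= pw (- s) i.+1.
  move=> hs ij; rewrite !powRN lef_pV2 ?posrE ?powR_gt0//.
  by apply: powR_le; [exact: ltW| |rewrite ler_nat ltnS].
have [nk|/ltnW kn] := leqP n k.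
  apply: (@le_trans _ _ (pw (- p) n.+1)); last by rewrite lerDl powR_ge0.
  rewrite (_ : - p = - (sigma + alpha) + - alpha); last by ring.
  by rewrite -np ler_wpM2l ?powR_ge0//; exact: mono.
apply: (@le_trans _ _ (pw (- p) k.+1)); last by rewrite lerDr powR_ge0.
rewrite (_ : - p = - (sigma + alpha) + - alpha); last by ring.
by rewrite -np ler_wpM2r ?powR_ge0//; apply: mono => //; lra.
Qed.

Lemma kernel_le n m k : (n <= m)%N ->
  pw (- sigma) m * (pw (- alpha) n * pw (- alpha) k) <= pw (- p) n + pw (- p) k.
Proof.
move=> nm; apply: le_trans (young_pow n k); rewrite mulrA ler_wpM2r ?powR_ge0//.
case: n nm => [|n] nm.
  by rewrite (powR0 (x := - alpha)) ?mulr0 ?powR_ge0// oppr_eq0 gt_eqF.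
case: m nm => [//|m]; rewrite ltnS => nm.
rewrite (_ : - (sigma + alpha) = - sigma + - alpha); last by ring.
rewrite powRD; last by rewrite pnatr_eq0 implybT.
rewrite ler_wpM2r ?powR_ge0// !powRN lef_pV2 ?posrE ?powR_gt0//.
by apply: powR_le; [exact: ltW| |rewrite ler_nat ltnS].
Qed.

(** [k m n] stands for [m + n] or for the distance of [m] and [n]. The two hypotheses encode that
    each value is taken at most twice when one argument is fixed. *)
Context (k : nat -> nat -> nat).
Context (hk1 : forall f S m N, (forall i, 0 <= f i) ->
  (forall n, \sum_(i < n) f i <= S) -> \sum_(n < N) f (k m n) <= 2 * S).
Context (hk2 : forall f S n N, (forall i, 0 <= f i) ->
  (forall m, \sum_(i < m) f i <= S) -> \sum_(m < N) f (k m n) <= 2 * S).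

Lemma weight_sqr X n : X 0%N = 0 ->
  exists x, X n = pw (- (alpha / 2)) n * x /\ x ^+ 2 = pw alpha n * X n ^+ 2.
Proof.
move=> X0; exists (pw (alpha / 2) n * X n).
have sq : pw (alpha / 2) n ^+ 2 = pw alpha n.
  by rewrite -powR_mulrn ?powR_ge0// -powRrM divfK.
split; last by rewrite exprMn sq.
case: n sq => [|n] sq; first by rewrite X0 !mulr0.
by rewrite mulrA -powRD ?pnatr_eq0 ?implybT// addrC subrr powRr0 mul1r.
Qed.

(* Cauchy-Schwarz is used with different groupings for [n <= m] and for [m < n];
   in each case the kernel [m^-sigma n^-alpha k^-alpha] is summed over the
   smaller of [m], [n], where it is at most [min (m, n)^-p + k^-p]. *)
Lemma conv_bound X Y Sx Sy M N : X 0%N = 0 -> Y 0%N = 0 ->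
  (forall n, \sum_(i < n) pw alpha i * X i ^+ 2 <= Sx) ->
  (forall n, \sum_(i < n) pw alpha i * Y i ^+ 2 <= Sy) ->
  \sum_(m < M) pw (- sigma) m * (\sum_(n < N) X n * Y (k m n)) ^+ 2 <= 24 * Z * Sx * Sy.
Proof.
move=> X0 Y0 hX hY; have Z0' := Z0.
have [x hx] := choice (fun n => weight_sqr n X0).
have [y hy] := choice (fun n => weight_sqr n Y0).
have hX' n : \sum_(i < n) x i ^+ 2 <= Sx.
  by apply: le_trans (hX n); apply: ler_sum => i _; rewrite (proj2 (hx i)).
have hY' n : \sum_(i < n) y i ^+ 2 <= Sy.
  by apply: le_trans (hY n); apply: ler_sum => i _; rewrite (proj2 (hy i)).
have Sx0 : 0 <= Sx by have := hX' 0%N; rewrite big_ord0.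
have Sy0 : 0 <= Sy by have := hY' 0%N; rewrite big_ord0.
pose a n := pw (- (alpha / 2)) n.
have a2 n : a n ^+ 2 = pw (- alpha) n.
  by rewrite /a -powR_mulrn ?powR_ge0// -powRrM mulNr divfK.
pose U m := \sum_(n < N) (if (n <= m)%N then a n * a (k m n) else 0) * (x n * y (k m n)).
pose V m := \sum_(n < N) (if (n <= m)%N then 0 else a n * a (k m n) * x n) * y (k m n).
have UV m : \sum_(n < N) X n * Y (k m n) = U m + V m.
  rewrite /U /V -big_split/=; apply: eq_bigr => n _.
  rewrite (proj1 (hx n)) (proj1 (hy (k m n))) -/(a n) -/(a (k m n)).
  by case: ifP => _; ring.
have sq0 (g : nat -> R) i : 0 <= g i ^+ 2 by exact: sqr_ge0.
have hU : \sum_(m < M) pw (- sigma) m * U m ^+ 2 <= 6 * Z * Sx * Sy.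
  apply: (@le_trans _ _ (\sum_(m < M) 3 * Z * (\sum_(n < N) x n ^+ 2 * y (k m n) ^+ 2))).
    apply: ler_sum => -[m _] _ /=.
    have := @sum_CS R N (fun n => if (n <= m)%N then a n * a (k m n) else 0)
      (fun n => x n * y (k m n)); rewrite -/(U m) => cs.
    apply: le_trans (ler_wpM2l (powR_ge0 _ _) cs) _.
    rewrite mulrA; set T := \sum_(i < N) (x i * _) ^+ 2.
    have -> : \sum_(n < N) x n ^+ 2 * y (k m n) ^+ 2 = T.
      by apply: eq_bigr => n _; rewrite exprMn.
    apply: ler_wpM2r; first by apply: sumr_ge0 => i _; exact: sqr_ge0.
    rewrite mulr_sumr.
    apply: (@le_trans _ _ (\sum_(n < N) (pw (- p) n + pw (- p) (k m n)))).
      apply: ler_sum => -[n _] _ /=; case: ifP => nm.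
        by rewrite exprMn !a2; exact: kernel_le.
      by rewrite expr0n/= mulr0 addr_ge0// powR_ge0.
    rewrite big_split/= (_ : 3 * Z = Z + 2 * Z); last by ring.
    apply: lerD; first exact: hZ.
    by apply: (@hk1 (fun i => i%:R `^ (- p))) => // i; exact: powR_ge0.
  rewrite -mulr_sumr exchange_big/=.
  rewrite (_ : 6 * Z * Sx * Sy = 3 * Z * (Sx * (2 * Sy))); last by ring.
  apply: ler_wpM2l; first by rewrite mulr_ge0.
  apply: (@le_trans _ _ (\sum_(n < N) x n ^+ 2 * (2 * Sy))).
    apply: ler_sum => n _; rewrite -mulr_sumr ler_wpM2l ?sqr_ge0//.
    exact: (@hk2 (fun i => y i ^+ 2)).
  by rewrite -mulr_suml ler_wpM2r// mulr_ge0.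
have hV : \sum_(m < M) pw (- sigma) m * V m ^+ 2 <= 6 * Z * Sx * Sy.
  apply: (@le_trans _ _ (\sum_(m < M) (\sum_(n < N) (pw (- p) m +
    pw (- p) (k m n)) * x n ^+ 2) * (2 * Sy))).
    apply: ler_sum => -[m _] _ /=.
    have := @sum_CS R N (fun n => if (n <= m)%N then 0 else a n * a (k m n) * x n)
      (fun n => y (k m n)); rewrite -/(V m) => cs.
    apply: le_trans (ler_wpM2l (powR_ge0 _ _) cs) _.
    rewrite mulrA; apply: ler_pM.
    - by rewrite mulr_ge0 ?powR_ge0// sumr_ge0// => i _; exact: sqr_ge0.
    - by apply: sumr_ge0 => i _; exact: sqr_ge0.
    - rewrite mulr_sumr; apply: ler_sum => -[n _] _ /=; case: leqP => nm.
        by rewrite expr0n/= mulr0 mulr_ge0 ?sqr_ge0// addr_ge0 ?powR_ge0.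
      rewrite exprMn mulrA ler_wpM2r ?sqr_ge0// exprMn !a2.
      case: m nm {cs} => [|m] nm.
        rewrite (powR0 (x := - sigma)) ?mul0r ?addr_ge0 ?powR_ge0//.
        by rewrite oppr_eq0 gt_eqF.
      apply: le_trans (kernel_le (k m.+1 n) (leqnn m.+1)).
      rewrite ler_wpM2l ?powR_ge0// ler_wpM2r ?powR_ge0//.
      rewrite !powRN lef_pV2 ?posrE ?powR_gt0 ?ltr0n//; last by apply: leq_trans nm.
      by apply: powR_le; [exact: ltW| |rewrite ler_nat ltnW].
    - exact: (@hk1 (fun i => y i ^+ 2)).
  rewrite -mulr_suml exchange_big/=.
  rewrite (_ : 6 * Z * Sx * Sy = 3 * Z * Sx * (2 * Sy)); last by ring.
  apply: ler_wpM2r; first by rewrite mulr_ge0.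
  apply: (@le_trans _ _ (\sum_(n < N) (3 * Z) * x n ^+ 2)).
    apply: ler_sum => n _; rewrite -mulr_suml ler_wpM2r ?sqr_ge0//.
    rewrite big_split/= (_ : 3 * Z = Z + 2 * Z); last by ring.
    apply: lerD; first exact: hZ.
    by apply: (@hk2 (fun i => i%:R `^ (- p))) => // i; exact: powR_ge0.
  by rewrite -mulr_sumr ler_wpM2l// mulr_ge0.
apply: (@le_trans _ _ (\sum_(m < M) (2 * (pw (- sigma) m * U m ^+ 2) +
  2 * (pw (- sigma) m * V m ^+ 2)))).
  apply: ler_sum => m _; rewrite UV.
  have := powR_ge0 (m%:R : R) (- sigma); have := sqr_ge0 (U m - V m).
  set w := _ `^ _; nra.
rewrite big_split/= -2!mulr_sumr; lra.
Qed.

End Convolution.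

Lemma conv_bound2 (alpha sigma : R) : 0 < alpha -> 0 < sigma -> 1 < sigma + 2 * alpha ->
  exists C, 0 <= C /\ forall X Y Sx Sy M N, X 0%N = 0 -> Y 0%N = 0 ->
  (forall n, \sum_(i < n) i%:R `^ alpha * X i ^+ 2 <= Sx) ->
  (forall n, \sum_(i < n) i%:R `^ alpha * Y i ^+ 2 <= Sy) ->
  \sum_(m < M) m%:R `^ (- sigma) *
    (\sum_(n < N) X n * (Y (m + n)%N + Y ((m - n) + (n - m))%N)) ^+ 2 <= C * Sx * Sy.
Proof.
move=> a0 s0 p1; have [Z [Z0 hZ]] := p_series p1.
exists (96 * Z); split; first by rewrite mulr_ge0.
move=> X Y Sx Sy M N X0 Y0 hX hY.
have S20 (f : nat -> R) S : (forall i, 0 <= f i) -> (forall m, \sum_(i < m) f i <= S) -> S <= 2 * S.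
  by move=> f0 /(_ 0%N); rewrite big_ord0; lra.
have h1 := @conv_bound alpha sigma Z a0 s0 Z0 hZ (fun m n => m + n)%N _ _ X Y Sx Sy M N X0 Y0 hX hY.
have h2 := @conv_bound alpha sigma Z a0 s0 Z0 hZ (fun m n => (m - n) +
  (n - m))%N _ _ X Y Sx Sy M N X0 Y0 hX hY.
have {}h1 : \sum_(m < M) m%:R `^ (- sigma) * (\sum_(n < N) X n * Y (m +
  n)%N) ^+ 2 <= 24 * Z * Sx * Sy.
  apply: h1 => f S j K f0 fS; apply: le_trans (S20 _ _ f0 fS).
    exact: shift_sum_le.
  rewrite (eq_bigr (fun i : 'I_K => f (j + i)%N)); last by move=> i _; rewrite addnC.
  exact: shift_sum_le.
have {}h2 : \sum_(m < M) m%:R `^ (- sigma) * (\sum_(n < N) X n * Y ((m - n) +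
  (n - m))%N) ^+ 2 <= 24 * Z * Sx * Sy.
  apply: h2 => f S j K f0 fS; first exact: dist_sum_le.
  rewrite (eq_bigr (fun i : 'I_K => f ((j - i) + (i - j))%N)); last by move=> i _; rewrite addnC.
  exact: dist_sum_le.
set U := fun m => \sum_(n < N) X n * Y (m + n)%N.
set V := fun m => \sum_(n < N) X n * Y ((m - n) + (n - m))%N.
apply: (@le_trans _ _ (\sum_(m < M) (2 * (m%:R `^ (- sigma) * U m ^+ 2) +
  2 * (m%:R `^ (- sigma) * V m ^+ 2)))).
  apply: ler_sum => m _.
  have -> : \sum_(n < N) X n * (Y (m + n)%N + Y ((m - n) + (n - m))%N) = U m + V m.
    by rewrite -big_split/=; apply: eq_bigr => n _; rewrite mulrDr.
  have := powR_ge0 (m%:R : R) (- sigma); have := sqr_ge0 (U m - V m).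
  set w := _ `^ _; nra.
rewrite big_split/= -2!mulr_sumr; rewrite /U /V; lra.
Qed.

(** The larger of [n] and [k] is at least [m / 2]. This plays the part of a product rule: a weight
    on the output of a convolution moves to one of its factors. *)
Lemma trunc_pow_le (s : R) M m n k : 0 <= s -> (m <= n + k)%N ->
  ((minn m M)%:R : R) `^ s <= 2 `^ s * ((minn n M)%:R `^ s + (minn k M)%:R `^ s).
Proof.
move=> s0 mnk.
have H (i j : nat) : (j <= i)%N -> (m <= i + j)%N ->
    ((minn m M)%:R : R) `^ s <= 2 `^ s * (minn i M)%:R `^ s.
  move=> ji mij; rewrite -powRM//; apply: powR_le => //.
  by rewrite -natrM ler_nat; lia.
have [nk|/ltnW kn] := leqP n k.
  apply: le_trans (H k n nk _) _; first lia.
  by rewrite ler_wpM2l ?powR_ge0// lerDr powR_ge0.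
apply: le_trans (H n k kn _) _; first lia.
by rewrite ler_wpM2l ?powR_ge0// lerDl powR_ge0.
Qed.

(* The weights are truncated at [M] so that the weighted sum is finite a
   priori and can be absorbed; the bound obtained is uniform in [M]. *)
Lemma bootstrap (alpha : R) A B (D E s : R) : 1 / 3 < alpha -> 0 <= D -> 0 <= s ->
  A 0%N = 0 -> (forall m, 0 <= A m) ->
  (forall n, \sum_(i < n) i%:R `^ alpha * A i ^+ 2 <= E) ->
  (forall m, (\sum_(n < N) A n * (A (m + n)%N + A ((m - n) + (n - m))%N)) @[N --> \oo] --> B m) ->
  (forall m, A m <= D * m%:R `^ (- alpha) * B m) ->
  exists E', forall n, \sum_(i < n) i%:R `^ (alpha + 2 * s) * A i ^+ 2 <= E'.
Proof.
move=> a13 D0 s0 A0 Age hE hB hA.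
have nat1 (i j : nat) : (i <= j + (i + j))%N by lia.
have nat2 (i j : nat) : (i <= j + (i - j + (j - i)))%N by lia.
(* [sigma = alpha - delta] must be positive and [sigma + 2 alpha = 3 alpha - delta] must exceed 1;
   half of each margin is spent. *)
pose delta := Num.min ((3 * alpha - 1) / 2) (alpha / 2).
have [d0 d1 d2] : [/\ 0 < delta, delta <= (3 * alpha - 1) / 2 & delta <= alpha / 2].
  by rewrite /delta lt_min !ge_min !lexx orbT; split => //; apply/andP; split; lra.
pose sigma := alpha - delta.
have sg0 : 0 < sigma by rewrite /sigma; lra.
have p1 : 1 < sigma + 2 * alpha by rewrite /sigma; lra.
have al0 : 0 < alpha by lra.
have [C [C0 hC]] := conv_bound2 al0 sg0 p1.
have E0 : 0 <= E by have := hE 0%N; rewrite big_ord0.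
pose G := D ^+ 2 * ((2 `^ s) ^+ 2 * (4 * C * E)).
have G0 : 0 <= G by rewrite !mulr_ge0 ?sqr_ge0.
(* From [M0] on, the decay [m^(-delta)] left over by the convolution estimate brings the constant
   below 1/2, so that the high indices can be absorbed; the low ones are bounded by the energy
   [E]. *)
have [M0 [M00 hM0]] : exists M0 : nat, (0 < M0)%N /\ G * M0%:R `^ (- delta) <= 2^-1.
  pose T := (2 * G + 1) `^ delta^-1.
  exists (Num.bound T).+1; split => //.
  have T0 : 0 < T by rewrite powR_gt0//; lra.
  have h1 : 2 * G + 1 <= (Num.bound T).+1%:R `^ delta.
    have -> : 2 * G + 1 = T `^ delta by rewrite /T -powRrM mulVf ?gt_eqF// powRr1//; lra.
    apply: powR_le; [exact: ltW|exact: ltW|].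
    by apply: le_trans (ltW (archi_boundP (ltW T0))) _; rewrite ler_nat.
  rewrite powRN ler_pdivrMr ?powR_gt0//; lra.
exists (2 * ((M0%:R `^ s) ^+ 2 * E)) => N.
pose v m : R := (minn m N)%:R `^ s.
have v0 m : 0 <= v m by exact: powR_ge0.
have vle m n k : (m <= n + k)%N -> v m <= 2 `^ s * (v n + v k) by exact: trunc_pow_le.
pose F m := m%:R `^ alpha * (v m * A m) ^+ 2.
have F0 m : 0 <= F m by rewrite mulr_ge0 ?powR_ge0 ?sqr_ge0.
pose X : set R := [set x | exists K, x = \sum_(m < K) F m].
have X1 : has_sup X.
  split; first by exists (\sum_(m < 0) F m); exists 0%N.
  exists ((N%:R `^ s) ^+ 2 * E) => _ [K ->].
  apply: le_trans (_ : \sum_(m < K) (N%:R `^ s) ^+ 2 * (m%:R `^ alpha * A m ^+ 2) <= _).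
    apply: ler_sum => m _; rewrite /F exprMn mulrCA ler_wpM2r ?mulr_ge0 ?powR_ge0 ?sqr_ge0//.
    rewrite lerXn2r ?nnegrE ?powR_ge0//; apply: powR_le => //.
    by rewrite ler_nat geq_minr.
  by rewrite -mulr_sumr ler_wpM2l ?sqr_ge0.
pose S := sup X.
have FS K : \sum_(m < K) F m <= S by apply: (ub_le_sup (proj2 X1)); exists K.
have S0 : 0 <= S by have := FS 0%N; rewrite big_ord0.
(* The weight [v m] is moved onto one factor of the convolution, and [conv_bound2] is applied twice,
   with the weighted sequence in either place. *)
have vB K : \sum_(m < K) m%:R `^ (- sigma) * (v m * B m) ^+ 2 <=
    (2 `^ s) ^+ 2 * (4 * C * E * S).
  have cv : (\sum_(m < K) m%:R `^ (- sigma) * (v m *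
      \sum_(n < L) A n * (A (m + n)%N + A ((m - n) + (n - m))%N)) ^+ 2) @[L --> \oo] -->
      \sum_(m < K) m%:R `^ (- sigma) * (v m * B m) ^+ 2.
    apply: (@cvg_finsum _ (fun L m => m%:R `^ (- sigma) * (v m *
      \sum_(n < L) A n * (A (m + n)%N + A ((m - n) + (n - m))%N)) ^+ 2)
      (fun m => m%:R `^ (- sigma) * (v m * B m) ^+ 2) K) => m.
    apply: cvgM; first exact: cvg_cst.
    apply: (cvg_comp (fun L => v m * \sum_(n < L) A n * (A (m + n)%N + A ((m - n) + (n - m))%N))
      (fun t => t ^+ 2)); last exact: exprn_continuous.
    by apply: cvgM; [exact: cvg_cst|exact: hB].
  apply: (ler_cvg_to cv (cvg_cst _)); apply: nearW => L.
  pose vA n := v n * A n.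
  have vA0 : vA 0%N = 0 by rewrite /vA A0 mulr0.
  have h1 := hC vA A S E K L vA0 A0 FS hE.
  have h2 := hC A vA E S K L A0 vA0 hE FS.
  set U := fun m => \sum_(n < L) vA n * (A (m + n)%N + A ((m - n) + (n - m))%N) in h1.
  set V := fun m => \sum_(n < L) A n * (vA (m + n)%N + vA ((m - n) + (n - m))%N) in h2.
  have {}h1 : \sum_(m < K) m%:R `^ (- sigma) * U m ^+ 2 <= C * S * E by [].
  have {}h2 : \sum_(m < K) m%:R `^ (- sigma) * V m ^+ 2 <= C * E * S by [].
  apply: (@le_trans _ _ (\sum_(m < K) (2 `^ s) ^+ 2 * (2 * (m%:R `^ (- sigma) * U m ^+ 2) +
      2 * (m%:R `^ (- sigma) * V m ^+ 2)))); last first.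
    rewrite -mulr_sumr big_split/= -2!mulr_sumr ler_wpM2l ?sqr_ge0//; lra.
  apply: ler_sum => m _; set W := \sum_(n < L) _.
  have hW : v m * W <= 2 `^ s * (U m + V m).
    rewrite /W /U /V -big_split/= !mulr_sumr; apply: ler_sum => n _; rewrite /vA.
    have k1 : v m <= 2 `^ s * (v n + v (m + n)%N) by exact: vle.
    have k2 : v m <= 2 `^ s * (v n + v ((m - n) + (n - m))%N) by exact: vle.
    have n1 := mulr_ge0 (Age n) (Age (m + n)%N).
    have n2 := mulr_ge0 (Age n) (Age ((m - n) + (n - m))%N).
    have := ler_wpM2r n1 k1; have := ler_wpM2r n2 k2; lra.
  have W0 : 0 <= W by apply: sumr_ge0 => n _; rewrite mulr_ge0// addr_ge0.
  have : (v m * W) ^+ 2 <= (2 `^ s * (U m + V m)) ^+ 2.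
    have vW0 : 0 <= v m * W by rewrite mulr_ge0.
    by rewrite lerXn2r ?nnegrE//; exact: le_trans hW.
  move=> hW2; apply: le_trans (ler_wpM2l (powR_ge0 _ _) hW2) _.
  rewrite exprMn mulrCA ler_wpM2l ?sqr_ge0//.
  have := mulr_ge0 (powR_ge0 (m%:R : R) (- sigma)) (sqr_ge0 (U m - V m)).
  set w := _ `^ _; lra.
have key K : \sum_(m < K) F m <= (M0%:R `^ s) ^+ 2 * E + 2^-1 * S.
  apply: (@le_trans _ _ (\sum_(m < K) ((M0%:R `^ s) ^+ 2 * (m%:R `^ alpha * A m ^+ 2) +
     D ^+ 2 * M0%:R `^ (- delta) * (m%:R `^ (- sigma) * (v m * B m) ^+ 2)))).
    apply: ler_sum => -[m _] _ /=; have [mM|Mm] := ltnP m M0.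
      rewrite -[leLHS]addr0; apply: lerD; last first.
        exact: (mulr_ge0 (mulr_ge0 (sqr_ge0 _) (powR_ge0 _ _)) (mulr_ge0 (powR_ge0 _ _)
          (sqr_ge0 _))).
      rewrite /F exprMn mulrCA ler_wpM2r ?mulr_ge0 ?powR_ge0 ?sqr_ge0//.
      rewrite lerXn2r ?nnegrE ?powR_ge0//; apply: powR_le => //.
      by rewrite ler_nat; apply: leq_trans (geq_minl _ _) (ltnW mM).
    rewrite -[leLHS]add0r; apply: lerD; first by rewrite !mulr_ge0 ?powR_ge0 ?sqr_ge0.
    have m0 : (0 < m)%N by apply: leq_trans Mm.
    have hm : (v m * A m) ^+ 2 <= (v m * (D * m%:R `^ (- alpha) * B m)) ^+ 2.
      have h0 : 0 <= D * m%:R `^ (- alpha) * B m := le_trans (Age m) (hA m).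
      rewrite lerXn2r ?nnegrE//; last by rewrite ler_wpM2l.
        exact: mulr_ge0.
      exact: mulr_ge0.
    rewrite /F; apply: le_trans (ler_wpM2l (powR_ge0 _ _) hm) _.
    have -> : m%:R `^ alpha * (v m * (D * m%:R `^ (- alpha) * B m)) ^+ 2 =
       D ^+ 2 * m%:R `^ (- delta) * (m%:R `^ (- sigma) * (v m * B m) ^+ 2).
      have e1 : m%:R `^ (- delta) * m%:R `^ (- sigma) = m%:R `^ (- alpha) :> R.
        rewrite -powRD; last by rewrite pnatr_eq0 gtn_eqF// implybT.
        by congr powR; rewrite /sigma; ring.
      have e2 : m%:R `^ alpha * m%:R `^ (- alpha) = 1 :> R.
        rewrite -powRD; last by rewrite pnatr_eq0 gtn_eqF// implybT.
        by rewrite subrr powRr0.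
      transitivity (D ^+ 2 * (m%:R `^ (- delta) * m%:R `^ (- sigma)) * (v m * B m) ^+ 2);
        last by ring.
      rewrite e1; transitivity (m%:R `^ alpha * m%:R `^ (- alpha) * (D ^+ 2 * m%:R `^ (- alpha)
        * (v m * B m) ^+ 2)); first by ring.
      by rewrite e2 mul1r.
    apply: ler_wpM2r; first by apply: mulr_ge0; [exact: powR_ge0|exact: sqr_ge0].
    rewrite ler_wpM2l ?sqr_ge0//.
    rewrite !powRN lef_pV2 ?posrE ?powR_gt0 ?ltr0n//.
    by apply: powR_le; [exact: ltW| |rewrite ler_nat].
  rewrite big_split/= -2!mulr_sumr; apply: lerD.
    exact: (ler_wpM2l (sqr_ge0 _) (hE K)).
  have h := ler_wpM2l (mulr_ge0 (sqr_ge0 D) (powR_ge0 (M0%:R : R) (- delta))) (vB K).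
  apply: le_trans h _; have := ler_wpM2r S0 hM0; rewrite /G; lra.
have SS : S <= (M0%:R `^ s) ^+ 2 * E + 2^-1 * S.
  by apply: ge_sup; [case: X1|move=> _ [K ->]].
have -> : \sum_(i < N) i%:R `^ (alpha + 2 * s) * A i ^+ 2 = \sum_(i < N) F i.
  apply: eq_bigr => -[i iN] _ /=; rewrite /F /v (minn_idPl (ltnW iN)) exprMn (mulrA (_ `^ alpha)).
  case: i iN => [|i] iN; first by rewrite A0 expr0n/= !mulr0.
  congr (_ * _); rewrite powRD ?pnatr_eq0 ?implybT//; congr (_ * _).
  by rewrite -powR_mulrn ?powR_ge0// -powRrM mulrC.
apply: le_trans (FS N) _; lra.
Qed.

End Bootstrap.

(** * The Euler-Lagrange equation and regularity *)

Section EulerLagrange.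
Context {R : realType}.
Implicit Types (u : R -> R) (m n k N M : nat).

Lemma quad_touch (x C t0 : R) : 0 < t0 ->
  (forall t, `|t| <= t0 -> 0 <= t * x + C * t ^+ 2) -> x = 0.
Proof.
move=> t00 h; apply/eqP; apply: contraT => x0; exfalso.
pose z := `|x|; have z0 : 0 < z by rewrite normr_gt0.
pose K := `|C| + 1; have K0 : 0 < K by rewrite ltr_wpDl.
pose d := Num.min t0 (z / (2 * K)).
have d0 : 0 < d by rewrite lt_min t00 divr_gt0// mulr_gt0.
have dt : d <= t0 by rewrite ge_min lexx.
have dz : d * (2 * K) <= z by rewrite -ler_pdivlMr ?mulr_gt0// ge_min lexx orbT.
pose t := - Num.sg x * d.
have tx : t * x = - (d * z).
  by rewrite /t /z normrEsg; ring.
have sg2 : Num.sg x ^+ 2 = 1 by rewrite sqr_sg x0.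
have t2 : t ^+ 2 = d ^+ 2 by rewrite /t exprMn sqrrN sg2 mul1r.
have tn : `|t| <= t0 by rewrite /t normrM normrN normr_sg x0 mul1r ger0_norm ?(ltW d0).
have := h t tn; rewrite tx t2.
have CK : C <= K - 1 by rewrite /K addrK ler_norm.
have := mulr_gt0 d0 z0; have := ler_wpM2l (ltW d0) dz.
have := ler_wpM2r (sqr_ge0 d) CK; have := sqr_ge0 d; rewrite !expr2; lra.
Qed.

Lemma En_shift_scale alpha c (hc : -1 < c) (a0 : 0 < alpha) u k (L s t : R) : L2 u ->
  En alpha c u = L%:E ->
  En alpha c (fun x => s * (u x + t * e k x)) =
  (s ^+ 2 * (L + lam alpha c k * (2 * t * coef u k + t ^+ 2)))%:E.
Proof.
move=> hu hL; have hv : L2 (fun x => u x + t * e k x) by apply: L2D => //; exact/L2Z/L2_e.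
have cf j : coef (fun x => s * (u x + t * e k x)) j = s * (coef u j + t * (k == j)%:R).
  rewrite fcoefZ// fcoefD//; last exact/L2Z/L2_e.
  by rewrite fcoefZ ?coef_e//; exact: L2_e.
apply: (@sumE_cvg _ _ _ (En_term_ge0 a0 hc _)).
set D := lam alpha c k * _.
have h1 := cvg_sumE (En_term_ge0 a0 hc u) hL.
have h2 : (\sum_(j < n) (if j == k :> nat then D else 0)) @[n --> \oo] --> D.
  have h3 : (fun=> D) @ \oo --> D by exact: cvg_cst.
  apply: cvg_trans h3; apply: near_eq_cvg; exists k.+1 => // n /= kn.
  rewrite (bigD1 (Ordinal kn))//= eqxx big1 ?addr0// => i.
  by rewrite -val_eqE /= => /negPf ->.
have h4 : (s ^+ 2 * (\sum_(k < n) lam alpha c k * coef u k ^+ 2 +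
    \sum_(j < n) (if j == k :> nat then D else 0))) @[n --> \oo] --> s ^+ 2 * (L + D).
  by apply: cvgM; [exact: cvg_cst|exact: cvgD].
apply: cvg_trans h4; apply: near_eq_cvg; apply: nearW => n /=.
rewrite -big_split/= mulr_sumr; apply: eq_bigr => j _; rewrite cf /D eq_sym.
by case: eqP => [->|_]; rewrite ?mulr1n ?mulr0n; ring.
Qed.

(** [j] will be the cube root of the third moment of a perturbation. Bounding [j^2 - 1] below by
    [2/3 (j^3 - 1)] minus a square expresses the rescaling through that moment, a polynomial in the
    perturbation parameter, so that no root has to be differentiated. *)
Lemma cube_root_ineq (j L D : R) : 0 < j -> 0 <= L ->
  L <= (j^-1) ^+ 2 * (L + D) -> 0 <= D - L * (2 / 3 * (j ^+ 3 - 1) - (j ^+ 3 - 1) ^+ 2).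
Proof.
move=> j0 L0; rewrite exprVn mulrC ler_pdivlMr ?exprn_gt0// => h.
have : 2 / 3 * (j ^+ 3 - 1) - (j ^+ 3 - 1) ^+ 2 <= j ^+ 2 - 1.
  rewrite -subr_ge0 (_ : _ - _ = (j - 1) ^+ 2 * ((j ^+ 2 + j + 1) ^+ 2 - (2 * j + 1) / 3));
    last first.
    by field.
  rewrite mulr_ge0 ?sqr_ge0//.
  have : 1 <= j ^+ 2 + j + 1 by have := sqr_ge0 j; lra.
  have := sqr_ge0 j; set w := j ^+ 2 + j + 1 => hj w1.
  have : w <= w ^+ 2 by rewrite expr2 ler_peMl//; lra.
  rewrite /w; lra.
move=> /(ler_wpM2l L0); lra.
Qed.

Context (alpha c : R) (ha : 1 / 3 < alpha) (hc : -1 < c).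
Let a0 : 0 < alpha. Proof. by apply: lt_trans ha; rewrite divr_gt0. Qed.

Lemma Y0_facts u : Y0 alpha u -> [/\ periodic u (pi *+ 2), L2 u,
  itg (fun x => u x ^+ 3), I (fun x => u x ^+ 3) = 1 & coef u 0 = 0].
Proof.
move=> Yu; have /(Y0P a0 hc)[/L2_perP[pu hu] fin I3 c0] := Yu.
have [B hB] := (proj1 (sumE_ltyP (En_term_ge0 a0 hc u)) fin).
by split => //; apply: itg_cube (proj1 hu) (En_L3 ha hc hu hB).
Qed.

Lemma Y0_En_real u : Y0 alpha u -> exists2 L, 0 <= L & En alpha c u = L%:E.
Proof.
move=> Yu; have /(Y0P a0 hc)[_ fin _ _] := Yu.
by have [L L0 hL] := sumE_fin (En_term_ge0 a0 hc u) fin; exists L.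
Qed.

(** The competitor is [phi + t e_k], rescaled to third moment 1; [k > 0] keeps the mean zero. The
    multiplier is the energy [L] itself, as pairing the equation with [phi] confirms. *)
Lemma euler_lagrange phi L k : ground_state alpha c phi -> En alpha c phi = L%:E ->
  (0 < k)%N -> lam alpha c k * coef phi k = L * coef (fun x => phi x ^+ 2) k.
Proof.
move=> /(ground_stateP a0 hc)[Yphi hmin] hL k0.
have [pphi hphi i3 I3 c0] := Y0_facts Yphi.
have L0 : 0 <= L by rewrite -lee_fin -hL; exact/sumE_ge0/En_term_ge0.
pose P := I (fun x => phi x ^+ 2 * e k x).
pose Q := I (fun x => phi x * e k x ^+ 2).
pose S := I (fun x : R => e k x ^+ 3).
have me := @measurable_e R k.
have e1 := @e_le1 R k.
have iP : itg (fun x => phi x ^+ 2 * e k x).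
  apply: (itg_le _ _ (proj2 hphi)).
    by apply: measurable_funM => //; apply: measurable_funX; exact: (proj1 hphi).
  by move=> x; rewrite normrM ger0_norm ?sqr_ge0// ler_piMr ?sqr_ge0.
have iQ : itg (fun x => phi x * e k x ^+ 2).
  apply: (itg_le _ _ (itg_norm (L2_itg hphi))).
    by apply: measurable_funM; [exact: (proj1 hphi)|exact: measurable_funX].
  by move=> x; rewrite normrM ler_piMr// normrX exprn_ile1.
have iS : itg (fun x : R => e k x ^+ 3).
  apply: (@itg_bounded _ _ 1); first exact: measurable_funX.
  by move=> x; rewrite normrX exprn_ile1.
pose J t := 1 + 3 * t * P + 3 * t ^+ 2 * Q + t ^+ 3 * S.
have JE t : I (fun x => (phi x + t * e k x) ^+ 3) = J t.
  rewrite (_ : (fun x => _) = fun x => phi x ^+ 3 + (3 * t) * (phi x ^+ 2 * e k x) +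
     (3 * t ^+ 2) * (phi x * e k x ^+ 2) + t ^+ 3 * e k x ^+ 3); last by apply/funext => x; ring.
  have j1 := itgZ (3 * t) iP; have j2 := itgZ (3 * t ^+ 2) iQ; have j3 := itgZ (t ^+ 3) iS.
  by rewrite ID ?ID ?ID ?IZ ?I3//; repeat apply: itgD.
(* For [|t| <= 1] one has [|J t - 1| <= |t| C1], so [|t| <= 1 / (2 C1)] keeps the third moment [J t]
   positive and the rescaling possible. *)
pose C1 := 3 * `|P| + 3 * `|Q| + `|S| + 1.
have C10 : 1 <= C1 by rewrite /C1 lerDr !addr_ge0// mulr_ge0.
pose a := coef phi k; pose l := lam alpha c k.
suff : 2 * (l * a - L * P) = 0 by move=> h; rewrite -/a -/l; apply/eqP; rewrite -subr_eq0;
  apply/eqP; rewrite -[X in _ - L * X]/P; lra.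
apply: (@quad_touch _ (l + L * (2 * `|Q| + `|S| + C1 ^+ 2)) (2 * C1)^-1).
  by rewrite invr_gt0 mulr_gt0//; lra.
move=> t ht.
have tC : `|t| * C1 <= 2^-1.
  have : `|t| * (2 * C1) <= 1 by rewrite -ler_pdivlMr ?mul1r//; lra.
  lra.
have t1 : `|t| <= 1 by have := normr_ge0 t; nra.
have J1 : `|J t - 1| <= `|t| * C1.
  rewrite (_ : J t - 1 = t * (3 * P + 3 * t * Q + t ^+ 2 * S)); last by rewrite /J; ring.
  rewrite normrM ler_wpM2l//; apply: le_trans (ler_normD _ _) _.
  rewrite /C1 -[leLHS]addr0; apply: lerD => //; apply: lerD.
    apply: le_trans (ler_normD _ _) _; rewrite !normrM (ger0_norm (_ : 0 <= 3))//.
    by apply: lerD => //; rewrite ler_wpM2r// ler_piMr.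
  by rewrite normrM ler_piMl// normrX exprn_ile1.
have Jp : 0 < J t.
  have := le_trans J1 tC; rewrite ler_norml => /andP[]; lra.
pose j := J t `^ (3^-1).
have j0 : 0 < j by rewrite powR_gt0.
have j3 : j ^+ 3 = J t by rewrite /j -powR_mulrn ?powR_ge0// -powRrM mulVf// powRr1// ltW.
pose v x := j^-1 * (phi x + t * e k x).
have L2w : L2 (fun x => phi x + t * e k x) by apply: L2D => //; exact/L2Z/L2_e.
have EnV := @En_shift_scale alpha c hc a0 phi k L j^-1 t hphi hL.
have Yv : Y0 alpha v.
  apply/(Y0P a0 hc); split.
  - apply/L2_perP; split; last exact: L2Z.
    by move=> x; rewrite /v pphi periodic_e.
  - by rewrite EnV ltry.
  - rewrite (_ : (fun x => _) = fun x => j^-1 ^+ 3 * (phi x + t * e k x) ^+ 3); last first.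
      by apply/funext => x; rewrite /v exprMn.
    rewrite IZ ?JE; last first.
      apply: eq_itg (itgD (itgD (itgD i3 (itgZ (3 * t) iP)) (itgZ (3 * t ^+ 2) iQ)) (itgZ (t ^+
        3) iS)) => x.
      by ring.
    by rewrite exprVn j3 mulVf// gt_eqF.
  - rewrite /v fcoefZ// fcoefD//; last exact/L2Z/L2_e.
    rewrite fcoefZ ?coef_e ?c0//; last exact: L2_e.
    by rewrite gtn_eqF// mulr0 addr0 mulr0.
have := hmin v Yv; rewrite hL EnV lee_fin => /(cube_root_ineq j0 L0).
rewrite j3 -/a -/l.
have Jsq : (J t - 1) ^+ 2 <= t ^+ 2 * C1 ^+ 2.
  rewrite -exprMn -(real_normK (num_real (J t - 1))) -(real_normK (num_real (t * C1))).
  by rewrite lerXn2r ?nnegrE// normrM (ger0_norm (x := C1))//; lra.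
have h1 : - (t ^+ 2 * (2 * `|Q| + `|S|)) <= 2 / 3 * (J t - 1) - 2 * t * P.
  rewrite (_ : _ - _ = t ^+ 2 * (2 * Q + 2 / 3 * t * S)); last by rewrite /J; field.
  rewrite -mulrN ler_wpM2l ?sqr_ge0//.
  have : `|2 * Q + 2 / 3 * t * S| <= 2 * `|Q| + `|S|.
    apply: le_trans (ler_normD _ _) _; rewrite !normrM (ger0_norm (_ : 0 <= 2))//.
    rewrite lerD2l ler_piMl// (ger0_norm (_ : 0 <= 3^-1)) ?invr_ge0//; have := normr_ge0 t; lra.
  by rewrite ler_norml => /andP[].
have := ler_wpM2l L0 Jsq; have := ler_wpM2l L0 h1; lra.
Qed.

(* Frequency 0 is discarded: the functions considered have mean zero. *)
Definition amp (a : nat -> R) (j : nat) : R :=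
  if j is i.+1 then `|a i.*2.+1| + `|a i.*2.+2| else 0.

Lemma amp_ge0 a j : 0 <= amp a j.
Proof. by case: j => //= j; exact: addr_ge0. Qed.

Lemma cos_moment_le u j : L2 u -> coef u 0 = 0 ->
  `|I (fun x => u x * cos (j%:R * x))| <= Num.sqrt pi * amp (coef u) j.
Proof.
move=> hu u0; case: j => [|j].
  rewrite mulr0 (_ : I _ = 0) ?normr0// -[RHS](proj2 (coef0_I hu) u0).
  by congr I; apply/funext => x; rewrite mul0r cos0 mulr1.
have s0 : 0 < Num.sqrt pi :> R by rewrite sqrtr_gt0 pi_gt0.
have := coef_tr j.*2.+2 hu; rewrite nrm_even /tr /= odd_double /= /fr /= uphalf_double.
move=> /(congr1 (fun z => Num.sqrt pi * z)); rewrite mulrA divff ?gt_eqF// mul1r => <-.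
by rewrite normrM (ger0_norm (ltW s0)) ler_wpM2l ?(ltW s0)//= lerDr.
Qed.

Lemma sin_moment_le u j : L2 u ->
  `|I (fun x => u x * sin (j%:R * x))| <= Num.sqrt pi * amp (coef u) j.
Proof.
move=> hu; case: j => [|j].
  rewrite mulr0 (_ : (fun x => _) = fun=> 0) ?I_cst ?mul0r ?normr0//.
  by apply/funext => x; rewrite mul0r sin0 mulr0.
have s0 : 0 < Num.sqrt pi :> R by rewrite sqrtr_gt0 pi_gt0.
have := coef_tr j.*2.+1 hu; rewrite nrm_odd /tr /= odd_double /= /fr /= doubleK.
move=> /(congr1 (fun z => Num.sqrt pi * z)); rewrite mulrA divff ?gt_eqF// mul1r => <-.
by rewrite normrM (ger0_norm (ltW s0)) ler_wpM2l ?(ltW s0)//= lerDl.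
Qed.

(** Product-to-sum formulas reduce the integral of [u e_k e_i] to two moments of [u], at the sum and
    at the distance of the two frequencies. *)
Lemma coef_prod_le u k i : L2 u -> coef u 0 = 0 ->
  `|coef (fun x => u x * e k x) i| <= Num.sqrt pi *
   (amp (coef u) (uphalf k + uphalf i) +
    amp (coef u) ((uphalf k - uphalf i) + (uphalf i - uphalf k))%N).
Proof.
move=> hu u0; set m := uphalf k; set n := uphalf i; set d := ((m - n) + (n - m))%N.
have C1 := cos_moment_le (m + n) hu u0; have C2 := cos_moment_le d hu u0.
have S1 := sin_moment_le (m + n) hu; have S2 := sin_moment_le d hu.
have mE : (m + n)%:R = fr k + fr i :> R by rewrite natrD.
have dE : exists b : bool, fr k - fr i = (-1) ^+ b * d%:R :> R.
  rewrite /fr -/m -/n /d; have [mn|nm] := leqP m n.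
    by exists true; rewrite expr1 (eqP mn) add0n natrB// mulN1r opprB.
  by exists false; rewrite expr0 mul1r (eqP (ltnW nm)) addn0 natrB// ltnW.
have [b db] := dE.
have it (f : R -> R) : measurable_fun setT f -> (forall x, `|f x| <= 1) ->
  itg (fun x => u x * f x).
  by move=> mf f1; apply/L2_itg/(L2_mul_bounded hu mf f1).
have ic t : itg (fun x => u x * cos (t * x)).
  by apply: it => [|x]; [exact: measurable_cosZ|rewrite ler_norml cos_geN1 cos_le1].
have is_ t : itg (fun x => u x * sin (t * x)).
  by apply: it => [|x]; [exact: measurable_sinZ|rewrite ler_norml sin_geN1 sin_le1].
have cd (x : R) : cos ((fr k - fr i) * x) = cos (d%:R * x).
  by rewrite db; case: b {db}; rewrite ?expr1 ?expr0 ?mulN1r ?mul1r ?mulNr ?cosN.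
have sd (x : R) : sin ((fr k - fr i) * x) = (-1) ^+ b * sin (d%:R * x).
  by rewrite db; case: b {db}; rewrite ?expr1 ?expr0 ?mulN1r ?mul1r ?mulNr ?sinN.
have main : `|I (fun x => u x * (tr k x * tr i x))| <= Num.sqrt pi *
   (amp (coef u) (m + n) + amp (coef u) d).
  have fin (p q : R) : `|p| <= Num.sqrt pi * amp (coef u) (m + n) ->
     `|q| <= Num.sqrt pi * amp (coef u) d ->
     forall f : R -> R, I f = 2^-1 * p + 2^-1 * q \/ I f = 2^-1 * p - 2^-1 * q ->
     `|I f| <= Num.sqrt pi * (amp (coef u) (m + n) + amp (coef u) d).
    move=> hp hq f hf.
    have : `|I f| <= 2^-1 * `|p| + 2^-1 * `|q|.
      case: hf => ->; [apply: le_trans (ler_normD _ _) _|apply: le_trans (ler_normB _ _) _];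
      by rewrite !normrM (ger0_norm (_ : 0 <= 2^-1)) ?invr_ge0.
    have := normr_ge0 p; have := normr_ge0 q; lra.
  have sum_c (x : R) : cos ((fr k + fr i) * x) =
    cos (fr k * x) * cos (fr i * x) - sin (fr k * x) * sin (fr i * x).
    by rewrite mulrDl cosD.
  have dif_c (x : R) : cos (d%:R * x) =
    cos (fr k * x) * cos (fr i * x) + sin (fr k * x) * sin (fr i * x).
    by rewrite -cd mulrBl cosB.
  have sum_s (x : R) : sin ((fr k + fr i) * x) =
    sin (fr k * x) * cos (fr i * x) + cos (fr k * x) * sin (fr i * x).
    by rewrite mulrDl sinD.
  have dif_s (x : R) : (-1) ^+ b * sin (d%:R * x) =
    sin (fr k * x) * cos (fr i * x) - cos (fr k * x) * sin (fr i * x).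
    by rewrite -sd mulrBl sinB.
  have b1 (t : R) : `|(-1) ^+ b * t| = `|t| by rewrite normrM normrX normrN1 expr1n mul1r.
  rewrite mE in C1 S1; rewrite /tr; case: (odd k); case: (odd i).
  - apply: (fin (- I (fun x => u x * cos ((fr k + fr i) * x))) _ _ C2); rewrite ?normrN//; left.
    rewrite mulrN addrC -!IZ// -IB; [|exact: itgZ|exact: itgZ].
    by congr I; apply/funext => x; rewrite sum_c dif_c; field.
  - apply: (fin _ ((-1) ^+ b * I (fun x => u x * sin (d%:R * x))) S1); rewrite ?b1//; left.
    rewrite -(IZ ((-1) ^+ b) (is_ _)) -(IZ _ (itgZ _ (is_ _))) -(IZ _ (is_ _)).
    rewrite -ID; [|exact: itgZ|exact/itgZ/itgZ].
    by congr I; apply/funext => x; rewrite (mulrCA ((-1) ^+ b) (u x)) dif_s sum_s; field.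
  - apply: (fin _ ((-1) ^+ b * I (fun x => u x * sin (d%:R * x))) S1); rewrite ?b1//; right.
    rewrite -(IZ ((-1) ^+ b) (is_ _)) -(IZ _ (itgZ _ (is_ _))) -(IZ _ (is_ _)).
    rewrite -IB; [|exact: itgZ|exact/itgZ/itgZ].
    by congr I; apply/funext => x; rewrite (mulrCA ((-1) ^+ b) (u x)) dif_s sum_s; field.
  - apply: (fin _ _ C1 C2); left.
    rewrite -2!(IZ _ (ic _)) -ID; [|exact: itgZ|exact: itgZ].
    by congr I; apply/funext => x; rewrite sum_c dif_c; field.
rewrite /coef (_ : (fun x => _) = fun x => nrm k * nrm i * (u x * (tr k x * tr i x))); last first.
  by apply/funext => x; rewrite /e; ring.
rewrite IZ; last first.
  apply: it => [|x]; last by rewrite normrM mulr_ile1// tr_le1.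
  by apply: measurable_funM; apply: measurable_cont; exact: continuous_tr.
rewrite normrM; apply: le_trans main; rewrite ler_piMl// normrM.
by rewrite !(ger0_norm (ltW (nrm_gt0 _))) mulr_ile1// ?nrm_le1// ltW// nrm_gt0.
Qed.

(** The Lagrange equation bounds the amplitude [A m] by [m^(-alpha)] times the self-convolution of
    [A], which is the hypothesis of [bootstrap]. *)
Lemma ground_state_regular phi : ground_state alpha c phi ->
  exists B, forall n, \sum_(k < n) fr k `^ alpha * `|coef phi k| <= B.
Proof.
move=> gs; have a0' := a0; have ha' := ha.
have /(ground_stateP a0 hc)[Yphi _] := gs.
have [pphi hphi i3 I3 c0] := Y0_facts Yphi.
have [L L0 hL] := Y0_En_real Yphi.
pose a := coef phi; pose A := amp a.
have A0 j : 0 <= A j by exact: amp_ge0.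
have kap0 := ellip_gt0 hc; set kap := 1 + Num.min c 0 in kap0.
have pair_le n : \sum_(j < n) A j ^+ 2 * j%:R `^ alpha <= 2 * (L / kap).
  apply: (@le_trans _ _ (2 * \sum_(k < n.*2.+1) wt alpha k * a k ^+ 2)); last first.
    rewrite ler_wpM2l//; apply: (wt_sum_le ha hc (lexx alpha)).
    by apply: (sumE_real _ hL) => k; exact: En_term_ge0.
  rewrite (sum_pairs (fun k => wt alpha k * a k ^+ 2)).
  apply: (@le_trans _ _ (\sum_(j < n.+1) A j ^+ 2 * j%:R `^ alpha)).
    apply: (@sum_le_widen _ (fun j => A j ^+ 2 * j%:R `^ alpha)) => // j.
    by rewrite mulr_ge0 ?sqr_ge0 ?powR_ge0.
  rewrite (sum_recl (fun j => A j ^+ 2 * j%:R `^ alpha)) /A /= expr0n/= mul0r add0r mulrDr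
    -[leLHS]add0r; apply: lerD.
    by rewrite mulr_ge0// mulr_ge0 ?wt_ge0 ?sqr_ge0.
  rewrite mulr_sumr; apply: ler_sum => j _.
  rewrite /wt /= /fr /= uphalf_double doubleK -mulrDr mulrC (mulrCA 2).
  apply: ler_wpM2l; first exact: powR_ge0.
  rewrite -(real_normK (num_real (a j.*2.+1))) -(real_normK (num_real (a j.*2.+2))).
  have := sqr_ge0 (`|a j.*2.+1| - `|a j.*2.+2|); lra.
pose E := 2 * (L / kap).
have hE n : \sum_(j < n) j%:R `^ alpha * A j ^+ 2 <= E.
  by apply: le_trans (pair_le n); apply: ler_sum => j _; rewrite mulrC.
have hE2 n : \sum_(j < n) A j ^+ 2 <= E.
  apply: le_trans (pair_le n); apply: ler_sum => -[[|j] _] _ /=.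
    by rewrite expr0n/= mul0r.
  rewrite ler_peMr ?sqr_ge0//.
  by have := @fr_pow_ge1 R alpha j.*2.+1 a0 isT; rewrite /fr /= doubleK.
have E0 : 0 <= E by have := hE 0%N; rewrite big_ord0.
pose S m N := \sum_(n < N) A n * (A (m + n)%N + A ((m - n) + (n - m))%N).
have A20 j : 0 <= A j ^+ 2 by exact: sqr_ge0.
have Sb m N : S m N <= 3 * E.
  have h1 := @shift_sum_le _ (fun j => A j ^+ 2) E m N A20 hE2.
  have h2 := @dist_sum_le _ (fun j => A j ^+ 2) E m N A20 hE2.
  apply: (@le_trans _ _ (\sum_(n < N) (A n ^+ 2 + 2^-1 * A (m + n)%N ^+ 2 +
     2^-1 * A ((m - n) + (n - m))%N ^+ 2))).
    apply: ler_sum => n _; have := sqr_ge0 (A n - A (m + n)%N).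
    have := sqr_ge0 (A n - A ((m - n) + (n - m))%N); lra.
  rewrite !big_split/= -2!mulr_sumr; have := hE2 N; lra.
have St m N : 0 <= A N * (A (m + N)%N + A ((m - N) + (N - m))%N).
  by rewrite mulr_ge0// addr_ge0.
have Sm m : nondecreasing_seq (S m).
  by apply/nondecreasing_seqP => N; rewrite /S big_ord_recr/= lerDl.
have Sc m : cvgn (S m).
  by apply: nondecreasing_is_cvgn => //; exists (3 * E) => _ [N _ <-].
pose B m := limn (S m).
have SB m N : S m N <= B m by exact: nondecreasing_cvgn_le.
have sp0 : 0 <= Num.sqrt pi :> R by exact: sqrtr_ge0.
(* Parseval's identity for the product of [phi] and [phi e_k]. *)
have coefP k : `|coef (fun x => phi x ^+ 2) k| <= Num.sqrt pi * B (uphalf k).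
  have hpe : L2 (fun x => phi x * e k x).
    by apply: (L2_mul_bounded hphi (@measurable_e R k) (@e_le1 R k)).
  have := parseval_mul hphi hpe.
  rewrite (_ : I _ = coef (fun x => phi x ^+ 2) k); last first.
    by congr I; apply/funext => x; rewrite expr2 mulrA.
  move=> cv; apply: (@limn_norm_le _ _ _ _ 0%N); first exact: cv.
  move=> n _; apply: le_trans (ler_norm_sum _ _ _) _.
  apply: (@le_trans _ _ (\sum_(i < n.*2.+1) `|a i * coef (fun x => phi x * e k x) i|)).
    apply: (@sum_le_widen _ (fun i => `|a i * coef (fun x => phi x * e k x) i|)) => //.
    by apply: leq_trans (leqnSn _); rewrite -addnn leq_addr.
  rewrite (sum_pairs (fun i => `|a i * coef (fun x => phi x * e k x) i|)).
  rewrite /a c0 mul0r normr0 add0r.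
  apply: le_trans (ler_wpM2l sp0 (SB (uphalf k) n.+1)).
  rewrite /S (sum_recl (fun j => A j * (A (uphalf k + j)%N + A ((uphalf k - j) +
    (j - uphalf k))%N))) mul0r add0r mulr_sumr; apply: ler_sum => i _.
  have h1 := coef_prod_le k i.*2.+1 hphi c0.
  have h2 := coef_prod_le k i.*2.+2 hphi c0.
  rewrite /= doubleK in h1; rewrite /= uphalf_double in h2.
  rewrite /A /= mulrCA mulrDl; apply: lerD; rewrite normrM ler_wpM2l//.
pose D := 2 * (L * Num.sqrt pi / kap).
have D0 : 0 <= D by rewrite /D mulr_ge0// divr_ge0 ?mulr_ge0// ltW.
have B0 m : 0 <= B m by apply: le_trans (SB m 0%N); rewrite /S big_ord0.
have hak k : (0 < k)%N -> `|a k| <= L * Num.sqrt pi / kap * fr k `^ (- alpha) * B (uphalf k).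
  move=> k0; have f0 : 0 < fr k :> R by apply: lt_le_trans ltr01 _; exact: fr_ge1.
  have EL := euler_lagrange gs hL k0.
  have l0 : 0 < kap * fr k `^ alpha by rewrite mulr_gt0// powR_gt0.
  have h1 : kap * fr k `^ alpha * `|a k| <= L * (Num.sqrt pi * B (uphalf k)).
    apply: (@le_trans _ _ (lam alpha c k * `|a k|)).
      by rewrite ler_wpM2r//; exact: lam_ge.
    rewrite -(ger0_norm (ltW (lam_gt0 k a0 hc))) -normrM EL normrM (ger0_norm L0).
    by rewrite ler_wpM2l.
  rewrite powRN.
  rewrite (_ : _ * _ = L * (Num.sqrt pi * B (uphalf k)) / (kap * fr k `^ alpha)); last first.
    by field; rewrite !gt_eqF ?powR_gt0.
  by rewrite ler_pdivlMr// mulrC.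
have hA m : A m <= D * m%:R `^ (- alpha) * B m.
  case: m => [|m]; first exact: (mulr_ge0 (mulr_ge0 D0 (powR_ge0 _ _)) (B0 _)).
  have := @hak m.*2.+1 isT; have := @hak m.*2.+2 isT.
  rewrite /fr /= uphalf_double doubleK /A /= /D -/a; lra.
(* This gain yields the weight [j^(2 alpha + 2)], so that Cauchy-Schwarz against the square-summable
   [1 / j] bounds the sum of [j^alpha A j]. *)
have [E' hE'] := @bootstrap R alpha A B D E ((alpha + 2) / 2) ha D0 ltac:(by rewrite divr_ge0; lra)
   (erefl _) A0 hE Sc hA.
have E'0 : 0 <= E' by have := hE' 0%N; rewrite big_ord0.
have [Z [Z0 hZ]] := @p_series R 2 ltac:(lra).
have sumA n : \sum_(j < n) j%:R `^ alpha * A j <= Num.sqrt (E' * Z).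
  have s0 : 0 <= \sum_(j < n) j%:R `^ alpha * A j.
    by apply: sumr_ge0 => j _; rewrite mulr_ge0 ?powR_ge0.
  rewrite -(ger0_norm s0) -sqrtr_sqr ler_wsqrtr//.
  have := @sum_CS R n (fun j => j%:R `^ (alpha + 1) * A j) (fun j => j%:R `^ (- 1)).
  rewrite (_ : \sum_(i < n) _ * _ = \sum_(j < n) j%:R `^ alpha * A j); last first.
    apply: eq_bigr => -[[|j] _] _ /=; first by rewrite /A /= !(mulr0, mul0r).
    rewrite mulrAC -powRD; last by rewrite pnatr_eq0 implybT.
    by rewrite addrK.
  move=> /le_trans; apply; apply: ler_pM.
  - by apply: sumr_ge0 => j _; exact: sqr_ge0.
  - by apply: sumr_ge0 => j _; exact: sqr_ge0.
  - apply: le_trans (hE' n); apply: ler_sum => j _; rewrite exprMn ler_wpM2r ?sqr_ge0//.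
    by rewrite -powR_mulrn ?powR_ge0// -powRrM; rewrite le_eqVlt; apply/orP; left; apply/eqP;
      congr powR; field.
  - apply: le_trans (hZ n); apply: ler_sum => j _.
    by rewrite -powR_mulrn ?powR_ge0// -powRrM; rewrite le_eqVlt; apply/orP; left; apply/eqP;
      congr powR; ring.
exists (Num.sqrt (E' * Z)) => n.
apply: (@le_trans _ _ (\sum_(k < n.*2.+1) fr k `^ alpha * `|a k|)).
  apply: (@sum_le_widen _ (fun k => fr k `^ alpha * `|a k|)); last first.
    by apply: leq_trans (leqnSn _); rewrite -addnn leq_addr.
  by move=> k; rewrite mulr_ge0 ?powR_ge0.
rewrite (sum_pairs (fun k => fr k `^ alpha * `|a k|)) /a c0 normr0 mulr0 add0r.
apply: le_trans (sumA n.+1); rewrite (sum_recl (fun j => j%:R `^ alpha * A j)) /A /= mulr0 add0r.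
by apply: ler_sum => j _; rewrite /fr /= uphalf_double doubleK mulrDr.
Qed.

End EulerLagrange.

(** * The Green kernel of [s - d^2/dx^2] on the circle *)

Section GreenKernel.
Context {R : realType}.
Implicit Types (x y z : R) (m n k : nat).
Local Notation mu := (@lebesgue_measure R).

Lemma L2_continuous (u : R -> R) : continuous u -> L2 u.
Proof.
move=> cu; split; first exact: measurable_cont.
have cu2 : {within circle R, continuous (fun x => u x ^+ 2)}.
  apply: continuous_subspaceT => x.
  by apply: (@continuous_comp _ _ _ u (fun t => t ^+ 2)); [exact: cu|exact: exprn_continuous].
by rewrite /itg; apply: continuous_compact_integrable => //; exact: segment_compact.
Qed.

Lemma inv_fr2_sum (s : R) : 0 < s ->
  exists Z, forall n, \sum_(k < n) (fr k ^+ 2 + s)^-1 <= Z.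
Proof.
move=> s0; have [Z [Z0 hZ]] := @p_series R 2 ltac:(lra).
have t0 k : 0 < fr k ^+ 2 + s by rewrite ltr_wpDl ?sqr_ge0.
exists (s^-1 + 2 * Z) => n.
apply: (@le_trans _ _ (\sum_(k < n.*2.+1) (fr k ^+ 2 + s)^-1)).
  apply: (@sum_le_widen _ (fun k => (fr k ^+ 2 + s)^-1)) => [k|].
    by rewrite invr_ge0 ltW.
  by apply: leq_trans (leqnSn _); rewrite -addnn leq_addr.
rewrite (sum_pairs (fun k => (fr k ^+ 2 + s)^-1)).
apply: lerD; first by rewrite /fr /= expr0n/= add0r.
apply: le_trans (ler_wpM2l _ (hZ n.+1)) => //.
rewrite (sum_recl (fun j => j%:R `^ (-2))) (powR0 (x := -2)); last by rewrite oppr_eq0 pnatr_eq0.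
rewrite add0r mulr_sumr; apply: ler_sum => j _.
rewrite /fr /= uphalf_double doubleK -mulr2n -[_ *+ 2]mulr_natl ler_wpM2l//.
rewrite powRN powR_mulrn// lef_pV2 ?posrE ?exprn_gt0 ?ltr_wpDl ?sqr_ge0//.
by rewrite lerDl ltW.
Qed.

Lemma sin_npi m : sin (m%:R * pi) = 0 :> R.
Proof.
elim: m => [|m IH]; first by rewrite mul0r sin0.
by rewrite -natr1 mulrDl mul1r sinDpi IH oppr0.
Qed.

Lemma cos_npi_sqr m : cos (m%:R * pi) ^+ 2 = 1 :> R.
Proof. by have := cos2Dsin2 (m%:R * pi : R); rewrite sin_npi expr0n/= addr0. Qed.

Section Hyperbolic.
Context (kp : R) (kp0 : 0 < kp).
(** [u] is [2 cosh (kp y)], and [D = 2 u'(pi)] is the size of the jump that the derivative of its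
    periodic extension has at [pi]. *)
Let u y : R := expR (kp * y) + expR (- kp * y).
Let D : R := 2 * kp * (expR (kp * pi) - expR (- kp * pi)).

Let D0 : 0 < D.
Proof.
rewrite /D mulr_gt0// ?mulr_gt0// subr_gt0 ltr_expR.
by have := mulr_gt0 kp0 (@pi_gt0 R); lra.
Qed.

Lemma is_derive_lin (a x : R) : is_derive x 1 (fun y : R => a * y) a.
Proof.
by apply: is_derive_eq; rewrite /GRing.scale /= ?(scaler0, add0r, mulr1, mulr0, addr0).
Qed.

Lemma is_derive_continuous (f df : R -> R) : (forall x, is_derive x 1 f (df x)) -> continuous f.
Proof.
move=> h x; apply: differentiable_continuous; apply/derivable1_diffP.
exact: (@ex_derive _ _ _ _ _ _ _ (h x)).
Qed.

Lemma is_derive_expZ (a x : R) : is_derive x 1 (fun y : R => expR (a * y)) (a * expR (a * x)).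
Proof.
have := @is_derive1_comp R (@expR R) (fun y => a * y) x _ _ (is_derive_expR _) (is_derive_lin a x).
by rewrite mulrC.
Qed.

Lemma is_derive_sinZ (a x : R) : is_derive x 1 (fun y : R => sin (a * y)) (a * cos (a * x)).
Proof.
have := @is_derive1_comp R (@sin R) (fun y => a * y) x _ _ (is_derive_sin _) (is_derive_lin a x).
by rewrite mulrC.
Qed.

Lemma is_derive_cosZ (a x : R) : is_derive x 1 (fun y : R => cos (a * y)) (- (a * sin (a * x))).
Proof.
have := @is_derive1_comp R (@cos R) (fun y => a * y) x _ _ (is_derive_cos _) (is_derive_lin a x).
by rewrite mulNr mulrC.
Qed.

Let cu : continuous u.
Proof.
move=> x; apply: cvgD; exact: is_derive_continuous (is_derive_expZ _) _.
Qed.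

Let I_ucos m : I (fun y => u y * cos (m%:R * y)) = D * cos (m%:R * pi) / (m%:R ^+ 2 + kp ^+ 2).
Proof.
set t : R := m%:R; set w : R := t ^+ 2 + kp ^+ 2.
have w0 : 0 < w by rewrite ltr_wpDl ?sqr_ge0 ?exprn_gt0.
(* The primitive that two integrations by parts produce. *)
pose F x : R := w^-1 * (kp * (expR (kp * x) - expR (- kp * x)) * cos (t * x) +
  t * u x * sin (t * x)).
have dF x : is_derive x 1 F (u x * cos (t * x)).
  have e1 := is_derive_expZ kp x; have e2 := is_derive_expZ (- kp) x.
  have s1 := is_derive_sinZ t x; have c1 := is_derive_cosZ t x.
  apply: is_derive_eq; rewrite /= /GRing.scale /= /u.
  by rewrite /w; field; rewrite -/w gt_eqF.
have cF : continuous F.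
  exact: is_derive_continuous dF.
have cf : continuous (fun y => u y * cos (t * y)).
  move=> x; apply: cvgM; first exact: cu.
  exact: is_derive_continuous (is_derive_cosZ t) _.
have pip : - pi < pi :> R by have := @pi_gt0 R; lra.
have := @continuous_FTC2 R (fun y => u y * cos (t * y)) F (- pi) pi pip.
rewrite /I /Rintegral /circle => ->; first last.
- by move=> x _; rewrite derive1E; exact: derive_val.
- split; first by move=> x _; exact: ex_derive.
    by apply: cvg_at_right_filter; exact: cF.
  by apply: cvg_at_left_filter; exact: cF.
- exact: continuous_subspaceT.
rewrite /= /F /u !mulrN !mulNr !opprK cosN sinN.
rewrite sin_npi.
by rewrite /D mulNr /w; field; rewrite -/w gt_eqF.
Qed.

Let mes_u : measurable_fun setT u. Proof. exact: measurable_cont. Qed.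

Let uN y : u (- y) = u y. Proof. by rewrite /u !mulrN !mulNr opprK addrC. Qed.

Let u_lt x y : 0 <= x -> x < y -> u x < u y.
Proof.
move=> x0 xy; have kp0' := kp0.
have X1 : 1 <= expR (kp * x) by rewrite -expR0 ler_expR mulr_ge0// ltW.
have XY : expR (kp * x) < expR (kp * y) by rewrite ltr_expR ltr_pM2l.
rewrite /u !mulNr !expRN; set X := expR (kp * x) in X1 XY *; set Y := expR (kp * y) in XY *.
have X0 : 0 < X by lra.
have Y0 : 0 < Y by lra.
rewrite -subr_gt0 (_ : _ - _ = (Y - X) * (1 - X^-1 * Y^-1)); last by field; rewrite !gt_eqF.
have : X^-1 * Y^-1 < 1 by rewrite -invfM invf_lt1 ?mulr_gt0//; nra.
by move=> h; rewrite mulr_gt0 ?subr_gt0.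
Qed.

Let L2u : L2 u. Proof. exact: L2_continuous. Qed.

Let coef_u_even k : ~~ odd k -> coef u k = nrm k * (D * cos (fr k * pi) / (fr k ^+ 2 + kp ^+ 2)).
Proof.
by move=> ok; rewrite coef_tr// /tr (negPf ok) /fr I_ucos.
Qed.

Let coef_u_odd k : odd k -> coef u k = 0.
Proof.
move=> ok; rewrite coef_tr// I_odd ?mulr0//.
- by apply: measurable_funM => //; apply: measurable_cont; exact: continuous_tr.
- apply/L2_itg/(L2_mul_bounded L2u (M := 1)).
    by apply: measurable_cont; exact: continuous_tr.
  by move=> x; exact: tr_le1.
- by move=> x; rewrite uN /tr ok mulrN sinN mulrN.
Qed.

Let abs_u : abscv (coef u).
Proof.
have [Z hZ] := inv_fr2_sum (exprn_gt0 2 kp0).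
have D0' := D0; have t0 k : 0 < fr k ^+ 2 + kp ^+ 2 by rewrite ltr_wpDl ?sqr_ge0 ?exprn_gt0.
exists (D * Z) => n; apply: le_trans (ler_wpM2l (ltW D0) (hZ n)).
rewrite mulr_sumr; apply: ler_sum => -[k _] _ /=.
have [ok|ok] := boolP (odd k).
  by rewrite coef_u_odd// normr0 mulr_ge0 ?(ltW D0)// invr_ge0 ltW.
rewrite coef_u_even// normrM (ger0_norm (ltW (nrm_gt0 _))).
apply: le_trans (ler_piMl (normr_ge0 _) (nrm_le1 _)) _.
rewrite -mulrA (normrM D) (normrM (cos _)) (ger0_norm (ltW D0)) ler_wpM2l ?(ltW D0)//.
rewrite (@ger0_norm _ (_^-1)) ?invr_ge0 ?(ltW (t0 _))// ler_piMl ?invr_ge0 ?(ltW (t0 _))//.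
by rewrite ler_norml cos_geN1 cos_le1.
Qed.

(* The [2 pi]-periodic extension of [u] from the circle, which is [cosh] up to
   a factor. *)
Let Q := synth (coef u).

Let cQ : continuous Q. Proof. exact: continuous_synth. Qed.
Let pQ : periodic Q (pi *+ 2). Proof. exact: periodic_synth. Qed.
Let mQ : measurable_fun setT Q. Proof. exact: measurable_cont. Qed.

Let Q_u x : - pi <= x <= pi -> Q x = u x.
Proof.
move=> hx; apply: (cont_ae_eq_circle cQ cu); last by rewrite /circle /= in_itv.
by apply: fourier_inj; [exact: L2_synth|exact: L2u|exact: coef_synth].
Qed.

(** On one period centred at 0, both [cos] and [u] are monotone in the distance to 0, in opposite
    directions. *)
Let Q_lt x y : cos x < cos y -> Q y < Q x.
Proof.
have [z /andP[z1 z2]] := circle_reduce x; have [w /andP[w1 w2]] := circle_reduce y.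
rewrite -(periodicz z x pQ) -(periodicz w y pQ) -(cos_periodz z x) -(cos_periodz w y).
move: (x + _) (y + _) z1 z2 w1 w2 => {}x {}y x1 x2 y1 y2.
have uA t : u t = u `|t| by case: (ger0P t) => _; rewrite ?uN.
have cA (t : R) : cos t = cos `|t| by case: (ger0P t) => _; rewrite ?cosN.
rewrite !Q_u ?x2 ?y2 ?(ltW x1) ?(ltW y1)// (cA x) (cA y) (uA x) (uA y).
have nx : `|x| <= pi by rewrite ler_norml x2 ltW.
have ny : `|y| <= pi by rewrite ler_norml y2 ltW.
rewrite ltr_cos ?in_itv/= ?normr_ge0//; exact: u_lt.
Qed.

(** Translation by [pi] moves the kink of [Q], which is also its maximum, to 0, and division by [D]
    normalizes the jump of the derivative. *)
Lemma green_kernel : exists K : R -> R, [/\ continuous K, periodic K (pi *+ 2),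
  (forall x y, cos x < cos y -> K x < K y),
  (forall m, I (fun z => K z * cos (m%:R * z)) = (m%:R ^+ 2 + kp ^+ 2)^-1) &
  (forall m, I (fun z => K z * sin (m%:R * z)) = 0)].
Proof.
have D0' := D0; have DD : D != 0 by rewrite gt_eqF.
pose K x := D^-1 * Q (x + pi).
have IQt k : I (fun z => Q z * tr k z) = I (fun z => u z * tr k z).
  have := congr1 (fun f => f k) (coef_synth abs_u).
  rewrite !coef_tr//; last exact: L2_synth.
  by move=> /(mulfI (lt0r_neq0 (nrm_gt0 k))).
have IQc m : I (fun z => Q z * cos (m%:R * z)) = D * cos (m%:R * pi) / (m%:R ^+ 2 + kp ^+ 2).
  rewrite -I_ucos; have := IQt m.*2; rewrite /tr odd_double /fr uphalf_double; exact.
have IQs m : I (fun z => Q z * sin (m%:R * z)) = 0.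
  case: m => [|m].
    rewrite (_ : (fun z => _) = fun=> 0) ?I_cst ?mul0r//.
    by apply/funext => z; rewrite mul0r sin0 mulr0.
  have := IQt m.*2.+1; have := coef_u_odd (k := m.*2.+1); rewrite /= odd_double coef_tr//.
  move=> /(_ isT)/eqP; rewrite mulf_eq0 (gt_eqF (nrm_gt0 _))/= => /eqP ->.
  by rewrite /tr /= odd_double /fr /= doubleK; exact.
have L2Q : L2 Q by exact: L2_synth.
have itc m : itg (fun z => Q z * cos (m%:R * z)).
  apply/L2_itg/(L2_mul_bounded L2Q (M := 1)); first exact: measurable_cosZ.
  by move=> x; rewrite ler_norml cos_geN1 cos_le1.
have its m : itg (fun z => Q z * sin (m%:R * z)).
  apply/L2_itg/(L2_mul_bounded L2Q (M := 1)); first exact: measurable_sinZ.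
  by move=> x; rewrite ler_norml sin_geN1 sin_le1.
have perc m : periodic (fun z => Q z * cos (m%:R * z)) (pi *+ 2).
  by move=> z; rewrite /= pQ mulrDr -[m%:R]/(m%:Z%:~R) cos_periodz.
have pers m : periodic (fun z => Q z * sin (m%:R * z)) (pi *+ 2).
  by move=> z; rewrite /= pQ mulrDr -[m%:R]/(m%:Z%:~R) sin_periodz.
have mc m : measurable_fun setT (fun z => Q z * cos (m%:R * z)).
  by apply: measurable_funM => //; exact: measurable_cosZ.
have ms m : measurable_fun setT (fun z => Q z * sin (m%:R * z)).
  by apply: measurable_funM => //; exact: measurable_sinZ.
have cE m z : cos (m%:R * z) = cos (m%:R * pi) * cos (m%:R * (z + pi)) :> R.
  rewrite -[in LHS](addrK pi z) mulrBr cosB sin_npi mulr0 addr0 mulrC.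
  by rewrite mulrC.
have sE m z : sin (m%:R * z) = cos (m%:R * pi) * sin (m%:R * (z + pi)) :> R.
  by rewrite -[in LHS](addrK pi z) mulrBr sinB sin_npi mulr0 subr0 mulrC.
exists K; split.
- move=> x; apply: cvgM; first exact: cvg_cst.
  by apply: continuous_comp; [apply: cvgD; [exact: cvg_id|exact: cvg_cst]|exact: cQ].
- by move=> x; rewrite /K addrAC pQ.
- move=> x y xy; rewrite /K ltr_pM2l ?invr_gt0//; apply: Q_lt.
  by rewrite !cosDpi ltrN2.
- move=> m; rewrite (_ : (fun z => _) = fun z => D^-1 * cos (m%:R * pi) *
      (Q (z + pi) * cos (m%:R * (z + pi)))); last first.
    by apply/funext => z; rewrite /K cE; ring.
  rewrite IZ; last exact: (itg_shift pi (mc m) (perc m) (itc m)).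
  rewrite (I_shift pi (mc m) (perc m)) IQc.
  have w0 : m%:R ^+ 2 + kp ^+ 2 != 0 :> R by rewrite gt_eqF// ltr_wpDl ?sqr_ge0 ?exprn_gt0.
  transitivity (cos (m%:R * pi) ^+ 2 / (m%:R ^+ 2 + kp ^+ 2)); last by rewrite cos_npi_sqr mul1r.
  by field; rewrite w0.
- move=> m; rewrite (_ : (fun z => _) = fun z => D^-1 * cos (m%:R * pi) *
      (Q (z + pi) * sin (m%:R * (z + pi)))); last first.
    by apply/funext => z; rewrite /K sE; ring.
  rewrite IZ; last exact: (itg_shift pi (ms m) (pers m) (its m)).
  by rewrite (I_shift pi (ms m) (pers m)) IQs mulr0.
Qed.

End Hyperbolic.
End GreenKernel.

(** * Polarization decreases the energy *)

Section Resolvent.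
Context {R : realType}.
Implicit Types (x y z : R) (m n k : nat) (o u : R -> R).
Local Notation mu := (@lebesgue_measure R).

Lemma coef_odd0 u k : L2 u -> (forall y, u (- y) = - u y) -> ~~ odd k -> coef u k = 0.
Proof.
move=> hu uN ok; apply: I_odd.
- by apply: measurable_funM; [exact: (proj1 hu)|exact: measurable_e].
- exact: itg_ue.
- by move=> x; rewrite uN e_even// mulNr.
Qed.

Lemma synth_odd (a : nat -> R) x : abscv a -> (forall k, ~~ odd k -> a k = 0) ->
  synth a (- x) = - synth a x.
Proof.
move=> ha a0; have h1 := @synth_cvg R a (- x) ha.
have h2 : (- (psum a ^~ x)) n @[n --> \oo] --> - synth a x by apply: cvgN; exact: synth_cvg.
have E : psum a ^~ (- x) = - (psum a ^~ x).
  apply/funext => n; rewrite /psum -[RHS]/(- (\sum_(k < n) a k * e k x)) -sumrN;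
    apply: eq_bigr => k _.
  have [ok|ok] := boolP (odd k); first by rewrite e_odd// mulrN.
  by rewrite a0// !mul0r oppr0.
by rewrite E in h1; exact: (cvg_unique (@Rhausdorff R) h1 h2).
Qed.

(** The zeros of [sin] are the points that the reflection fixes modulo the period. *)
Lemma odd_periodic_zero o y : periodic o (pi *+ 2) -> (forall x, o (- x) = - o x) ->
  sin y = 0 -> o y = 0.
Proof.
move=> po oN; have [z /andP[z1 z2]] := circle_reduce y.
rewrite -(periodicz z y po) -(sin_periodz z y); move: (y + _) z1 z2 => {}y y1 y2 sy.
have oself t : o t = - o t -> o t = 0 by move=> h; lra.
have [y0|y0|->] := ltgtP y 0; last by apply: oself; rewrite -oN oppr0.
  have := @sin_gt0_pi R (- y); rewrite sinN sy oppr0 ltxx => h.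
  by have : false by apply: h; lra.
have [yp|yp] := eqVneq y pi.
  by apply: oself; rewrite -oN -(po (- y)) /=; congr o; rewrite yp; ring.
have := @sin_gt0_pi R y; rewrite sy ltxx => h.
by have : false by apply: h; rewrite y0 lt_neqAle yp.
Qed.

Context (s : R) (s0 : 0 < s) (K : R -> R) (cK : continuous K) (pK : periodic K (pi *+ 2)).
Context (Kmono : forall x y, cos x < cos y -> K x < K y).
Context (Kcos : forall m, I (fun z => K z * cos (m%:R * z)) = (m%:R ^+ 2 + s)^-1).
Context (Ksin : forall m, I (fun z => K z * sin (m%:R * z)) = 0).

Let den0 k : 0 < fr k ^+ 2 + s. Proof. by rewrite ltr_wpDl ?sqr_ge0. Qed.

Let mK : measurable_fun setT K. Proof. exact: measurable_cont. Qed.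

Let L2K : L2 K. Proof. exact: L2_continuous. Qed.

Let cKsub x : continuous (fun y => K (x - y)).
Proof.
move=> y; apply: continuous_comp; last exact: cK.
by apply: cvgB; [exact: cvg_cst|exact: cvg_id].
Qed.

Let cKadd x : continuous (fun y => K (x + y)).
Proof.
move=> y; apply: continuous_comp; last exact: cK.
by apply: cvgD; [exact: cvg_cst|exact: cvg_id].
Qed.

Lemma resolvent_coef x k : coef (fun y => K (x - y)) k = e k x / (fr k ^+ 2 + s).
Proof.
have ce t : continuous (fun y => e k (t - y)).
  move=> y; apply: (@continuous_comp _ _ _ (fun y => t - y) (e k)); last exact: continuous_e.
  by apply: cvgB; [exact: cvg_cst|exact: cvg_id].
have cz : continuous (fun y => K y * e k (x - y)).
  by move=> y; apply: cvgM; [exact: cK|exact: ce].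
pose g y := K (x + y) * e k (- y).
have cg : continuous g.
  move=> y; apply: cvgM; first exact: cKadd.
  by have := ce 0 y; rewrite /= (_ : (fun y => e k (0 - y)) = fun y => e k (- y)) ?sub0r//;
     apply/funext => t; rewrite sub0r.
have -> : coef (fun y => K (x - y)) k = I g.
  rewrite -(I_reflect (measurable_cont cg)); congr I; apply/funext => y.
  by rewrite /g opprK.
have -> : I g = I (fun y => K y * e k (x - y)).
  rewrite -(I_shift x (measurable_cont cz)); last first.
    move=> y; rewrite /= pK; congr (_ * _).
    by rewrite -[RHS](periodicz (-1) (x - y) (periodic_e k)); congr e; rewrite mulN1r; ring.
  by congr I; apply/funext => y; rewrite /g addrC; congr (_ * e k _); ring.
have itc : itg (fun y => K y * cos (fr k * y)).
  apply/L2_itg/(L2_mul_bounded L2K (M := 1)); first exact: measurable_cosZ.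
  by move=> y; rewrite ler_norml cos_geN1 cos_le1.
have its : itg (fun y => K y * sin (fr k * y)).
  apply/L2_itg/(L2_mul_bounded L2K (M := 1)); first exact: measurable_sinZ.
  by move=> y; rewrite ler_norml sin_geN1 sin_le1.
have c1 := Kcos (uphalf k); have c2 := Ksin (uphalf k); rewrite -/(fr k) in c1 c2.
rewrite /e /tr; case: (odd k).
  rewrite (_ : (fun y => _) = fun y => nrm k * sin (fr k * x) * (K y * cos (fr k * y)) -
      nrm k * cos (fr k * x) * (K y * sin (fr k * y))); last first.
    by apply/funext => y; rewrite mulrBr sinB; ring.
  by rewrite IB ?IZ ?c1 ?c2 ?mulr0 ?subr0//; exact: itgZ.
rewrite (_ : (fun y => _) = fun y => nrm k * cos (fr k * x) * (K y * cos (fr k * y)) +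
    nrm k * sin (fr k * x) * (K y * sin (fr k * y))); last first.
  by apply/funext => y; rewrite mulrBr cosB; ring.
by rewrite ID ?IZ ?c1 ?c2 ?mulr0 ?addr0//; exact: itgZ.
Qed.

(** The coefficients of the resolvent [(s - d^2/dx^2)^-1 u]. *)
Definition rcoef (u : R -> R) (k : nat) : R := coef u k / (fr k ^+ 2 + s).

Lemma abscv_rcoef u : L2 u -> abscv (rcoef u).
Proof.
move=> hu; have [Z hZ] := inv_fr2_sum s0.
exists (Num.sqrt (I (fun x => u x ^+ 2)) * Z) => n.
apply: le_trans (ler_wpM2l (sqrtr_ge0 _) (hZ n)).
rewrite mulr_sumr; apply: ler_sum => -[k _] _ /=.
have dk : 0 <= (fr k ^+ 2 + s)^-1 by rewrite invr_ge0 ltW// den0.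
rewrite /rcoef normrM (ger0_norm dk) ler_wpM2r// -sqrtr_sqr ler_wsqrtr//.
apply: le_trans (bessel k.+1 hu); rewrite big_ord_recr/= lerDr.
by apply: sumr_ge0 => i _; exact: sqr_ge0.
Qed.

Lemma resolventE u x : L2 u -> I (fun y => K (x - y) * u y) = synth (rcoef u) x.
Proof.
move=> hu; apply/esym; have h := parseval_mul (L2_continuous (@cKsub x)) hu.
have := @synth_cvg R _ x (abscv_rcoef hu).
rewrite (_ : psum (rcoef u) ^~ x = fun n => \sum_(k < n) coef (fun y => K (x - y)) k * coef u k).
  by move=> h'; exact: (cvg_unique (@Rhausdorff R) h' h).
apply/funext => n; apply: eq_bigr => k _; rewrite resolvent_coef /rcoef; ring.
Qed.

(** For odd [u] both [K (x - y)] and [- K (x + y)] represent the resolvent. Their mean is the useful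
    kernel: since [cos (x - y) - cos (x + y) = 2 sin x sin y], it has the sign of [sin x sin y]. *)
Lemma L2_odd_resolvent u x : L2 u -> (forall y, u (- y) = - u y) ->
  synth (rcoef u) x = 2^-1 * I (fun y => (K (x - y) - K (x + y)) * u y).
Proof.
move=> hu uN.
have i1 : itg (fun y => K (x - y) * u y) by apply: L2_mul => //; exact: L2_continuous.
have i2 : itg (fun y => K (x + y) * u y) by apply: L2_mul => //; exact: L2_continuous.
have E1 := resolventE x hu.
have E2 : I (fun y => K (x + y) * u y) = - synth (rcoef u) x.
  rewrite -E1 -IN// -I_reflect; last first.
    by apply: measurable_funM; [exact: (measurable_cont (@cKadd x))|exact: (proj1 hu)].
  by congr I; apply/funext => y; rewrite uN mulrN.
rewrite (_ : (fun y => _) = fun y => K (x - y) * u y - K (x + y) * u y).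
  by rewrite IB// E1 E2; field.
by apply/funext => y; rewrite mulrBl.
Qed.

Lemma kernel_sign x y : 0 < sin x ->
  (0 < sin y -> K (x + y) < K (x - y)) /\ (sin y < 0 -> K (x - y) < K (x + y)).
Proof.
move=> sx; split=> sy; apply: Kmono; rewrite (cosB x y) (cosD x y).
  by have := mulr_gt0 sx sy; lra.
have : sin x * sin y < 0 by rewrite pmulr_rlt0.
lra.
Qed.

Lemma resolvent_integrand_ge0 u x y : 0 < sin x -> periodic u (pi *+ 2) ->
  (forall z, u (- z) = - u z) -> (forall z, 0 < sin z -> 0 <= u z) ->
  0 <= (K (x - y) - K (x + y)) * u y.
Proof.
move=> sx pu uN up; have [k1 k2] := kernel_sign y sx.
have [sy|sy|/esym sy] := ltgtP 0 (sin y).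
- by apply: mulr_ge0; [rewrite subr_ge0 ltW// k1|exact: up].
- rewrite -mulrNN; apply: mulr_ge0; first by rewrite opprB subr_ge0 ltW// k2.
  by rewrite -uN; apply: up; rewrite sinN oppr_gt0.
- by rewrite (odd_periodic_zero pu uN sy) mulr0.
Qed.

(** The integrand is continuous and nonnegative, so a vanishing integral makes it vanish
    identically; its kernel factor is nonzero wherever [sin y] is. *)
Lemma resolvent_strict u x : continuous u -> periodic u (pi *+ 2) ->
  (forall z, u (- z) = - u z) -> (forall z, 0 < sin z -> 0 <= u z) ->
  0 < sin x -> 0 <= synth (rcoef u) x /\ (synth (rcoef u) x = 0 -> forall y, u y = 0).
Proof.
move=> cu pu uN up sx; have L2u := L2_continuous cu.
have F0 y := resolvent_integrand_ge0 y sx pu uN up.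
have cF : continuous (fun y => (K (x - y) - K (x + y)) * u y).
  by move=> y; apply: cvgM; [apply: cvgB; [exact: cKsub|exact: cKadd]|exact: cu].
have iF : itg (fun y => (K (x - y) - K (x + y)) * u y).
  by apply: L2_mul => //; apply: L2B; exact: L2_continuous.
rewrite L2_odd_resolvent//; split.
  by rewrite mulr_ge0// ?invr_ge0//; apply: I_ge0.
move=> h; have {}h : I (fun y => (K (x - y) - K (x + y)) * u y) = 0 by lra.
have ae := I0_ae (measurable_cont cF) F0 iF h.
have c0 : continuous (fun _ : R => 0 : R) by move=> y; exact: cvg_cst.
have z0 := cont_ae_eq_circle cF c0 ae.
move=> y; have [z /andP[z1 z2]] := circle_reduce y; rewrite -(periodicz z y pu).
move: (y + _) z1 z2 => {}y y1 y2.
have /eqP := z0 y ltac:(by rewrite /circle /= in_itv/= y2 ltW).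
rewrite mulf_eq0 => /orP[/eqP h'|/eqP //].
apply: (odd_periodic_zero pu uN); have [k1 k2] := kernel_sign y sx.
have [sy|sy|//] := ltgtP (sin y) 0.
  by have := k2 sy; lra.
by have := k1 sy; lra.
Qed.

Definition polar o y := if 0 <= sin y then `|o y| else - `|o y|.

Lemma polar_sqr o y : polar o y ^+ 2 = o y ^+ 2.
Proof. by rewrite /polar; case: ifP => _; rewrite ?sqrrN real_normK ?num_real. Qed.

Lemma polar_norm o y : `|polar o y| = `|o y|.
Proof. by rewrite /polar; case: ifP => _; rewrite ?normrN normr_id. Qed.

Lemma polar_periodic o : periodic o (pi *+ 2) -> periodic (polar o) (pi *+ 2).
Proof. by move=> po x; rewrite /polar po sinD2pi. Qed.

Lemma polar_odd o : periodic o (pi *+ 2) -> (forall x, o (- x) = - o x) ->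
  forall x, polar o (- x) = - polar o x.
Proof.
move=> po oN x; rewrite /polar sinN oppr_ge0 oN normrN.
have [sx|sx|sx] := ltgtP (sin x) 0; rewrite ?opprK//.
by rewrite (odd_periodic_zero po oN sx) normr0 oppr0.
Qed.

Lemma measurable_polar o : measurable_fun setT o -> measurable_fun setT (polar o).
Proof.
move=> mo; apply: measurable_fun_ifT.
- apply: measurable_fun_ler; first exact: measurable_cst.
  exact: (measurable_cont (@continuous_sin R)).
- exact: measurableT_comp.
- by apply: measurableT_comp => //; exact: measurableT_comp.
Qed.

Lemma L2_polar o : L2 o -> L2 (polar o).
Proof.
move=> [m1 i1]; split; first exact: measurable_polar.
by apply: eq_itg i1 => x; rewrite polar_sqr.
Qed.

(** Where [sin x > 0], the resolvent of [polar o] dominates the absolute value of that of [o],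
    because the symmetrized kernel times [polar o] is the absolute value of the kernel times [o].
    The other half circle follows by oddness. *)
Lemma resolvent_polar_le o x : L2 o -> periodic o (pi *+ 2) -> (forall y, o (- y) = - o y) ->
  o x * synth (rcoef o) x <= polar o x * synth (rcoef (polar o)) x.
Proof.
move=> ho po oN; have hO := L2_polar ho; have ON := polar_odd po oN.
have pO := polar_periodic po.
have base z : 0 < sin z -> `|synth (rcoef o) z| <= synth (rcoef (polar o)) z.
  move=> sz; rewrite !L2_odd_resolvent// normrM ger0_norm ?invr_ge0//.
  rewrite ler_wpM2l ?invr_ge0//.
  have i1 : itg (fun y => (K (z - y) - K (z + y)) * o y).
    by apply: L2_mul => //; apply: L2B; exact: L2_continuous.
  have i2 : itg (fun y => (K (z - y) - K (z + y)) * polar o y).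
    by apply: L2_mul => //; apply: L2B; exact: L2_continuous.
  apply: le_trans (I_norm i1) _; apply: I_le => //; first exact: itg_norm.
  move=> y _; rewrite normrM -(polar_norm o y) -normrM ger0_norm//.
  apply: resolvent_integrand_ge0 => // t st.
  by rewrite /polar (ltW st).
have main z : 0 < sin z -> o z * synth (rcoef o) z <= polar o z * synth (rcoef (polar o)) z.
  have pz : 0 < sin z -> polar o z = `|o z| by move=> sz; rewrite /polar (ltW sz).
  move=> sz; have := base z sz; rewrite (pz sz) => h.
  apply: le_trans (ler_norm _) _; rewrite normrM.
  by rewrite ler_wpM2l.
have TN v z : L2 v -> (forall y, v (- y) = - v y) -> synth (rcoef v) (- z) = - synth (rcoef v) z.
  move=> hv vN; apply: synth_odd; first exact: abscv_rcoef.
  by move=> k ok; rewrite /rcoef coef_odd0// mul0r.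
have [sx|sx|sx] := ltgtP 0 (sin x); first exact: main.
  have := main (- x); rewrite sinN oppr_gt0 => /(_ sx).
  by rewrite oN ON (TN o x ho oN) (TN (polar o) x hO ON) !mulrNN.
have ox := odd_periodic_zero po oN (esym sx).
have Ox := odd_periodic_zero pO ON (esym sx).
by rewrite ox Ox !mul0r.
Qed.

End Resolvent.

(** * Powers of the frequency as superpositions of resolvents *)

Section Power.
Context {R : realType}.
Implicit Types (x y : R) (m n k : nat) (o u : R -> R).
Local Notation mu := (@lebesgue_measure R).

Definition wsum (s : R) u : \bar R :=
  sumE (fun k => fr k ^+ 2 / (fr k ^+ 2 + s) * coef u k ^+ 2).

Lemma green_kernel_sqrt (s : R) : 0 < s -> exists K : R -> R, [/\ continuous K,
  periodic K (pi *+ 2), (forall x y, cos x < cos y -> K x < K y),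
  (forall m, I (fun z => K z * cos (m%:R * z)) = (m%:R ^+ 2 + s)^-1) &
  (forall m, I (fun z => K z * sin (m%:R * z)) = 0)].
Proof.
move=> s0; have q0 : 0 < Num.sqrt s by rewrite sqrtr_gt0.
have [K [h1 h2 h3 h4 h5]] := green_kernel q0; exists K; split => // m.
by rewrite h4 sqr_sqrtr// ltW.
Qed.

Lemma wsumE (s : R) u : 0 < s -> L2 u ->
  wsum s u = (I (fun x => u x ^+ 2) - s * I (fun x => u x * synth (rcoef s u) x))%:E.
Proof.
move=> s0 hu; have t0 k : 0 < fr k ^+ 2 + s by rewrite ltr_wpDl ?sqr_ge0.
have ha := abscv_rcoef s0 hu.
apply: sumE_cvg.
  by move=> k; rewrite mulr_ge0 ?sqr_ge0// divr_ge0 ?sqr_ge0// ltW.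
have h1 := cvg_sumE (fun k => sqr_ge0 (coef u k)) (parseval hu).
have h2 := parseval_mul hu (L2_synth ha); rewrite coef_synth// in h2.
have h3 : (\sum_(k < n) coef u k ^+ 2 - s * \sum_(k < n) coef u k * rcoef s u k) @[n --> \oo] -->
   I (fun x => u x ^+ 2) - s * I (fun x => u x * synth (rcoef s u) x).
  by apply: cvgB => //; apply: cvgM => //; exact: cvg_cst.
apply: cvg_trans h3; apply: near_eq_cvg; apply: nearW => n /=.
rewrite mulr_sumr -sumrB; apply: eq_bigr => k _; rewrite /rcoef.
by field; apply: lt0r_neq0; exact: t0.
Qed.

(** The multiplier [m^2 / (m^2 + s)] is [1 - s / (m^2 + s)]: polarization preserves the [L^2] norm
    and increases the resolvent form. *)
Lemma polar_wsum_le (s : R) o : 0 < s -> L2 o -> periodic o (pi *+ 2) ->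
  (forall y, o (- y) = - o y) -> (wsum s (polar o) <= wsum s o)%E.
Proof.
move=> s0 ho po oN; have hO := L2_polar ho.
have [K [k1 k2 k3 k4 k5]] := green_kernel_sqrt s0.
rewrite (wsumE s0 hO) (wsumE s0 ho) lee_fin.
rewrite (_ : I (fun x => polar o x ^+ 2) = I (fun x => o x ^+ 2)); last first.
  by congr I; apply/funext => x; rewrite polar_sqr.
have h : I (fun x => o x * synth (rcoef s o) x) <=
    I (fun x => polar o x * synth (rcoef s (polar o)) x).
  apply: I_le; first by apply: L2_mul ho (L2_synth (abscv_rcoef s0 ho)).
    by apply: L2_mul hO (L2_synth (abscv_rcoef s0 hO)).
  by move=> x _; exact: (resolvent_polar_le s0 k1 k2 k3 k4 k5).
by rewrite lerD2l lerN2; apply: ler_wpM2l h; exact: ltW.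
Qed.

(** The multipliers [s m^2 / (m^2 + s)] increase to [m^2] as [s] grows. On a fixed partial sum the
    error is at most [C / s], and [C] may depend on the length of that sum. *)
Lemma polar_power2_le o : L2 o -> periodic o (pi *+ 2) -> (forall y, o (- y) = - o y) ->
  (sumE (fun k => (fr k ^+ 2 * coef (polar o) k ^+ 2)%R) <=
   sumE (fun k => (fr k ^+ 2 * coef o k ^+ 2)%R))%E.
Proof.
move=> ho po oN; have hO := L2_polar ho.
have p0 u k : 0 <= fr k ^+ 2 * coef u k ^+ 2 by rewrite mulr_ge0 ?sqr_ge0.
have [->|/eqP fin] := eqVneq (sumE (fun k => fr k ^+ 2 * coef o k ^+ 2)) +oo%E.
  by rewrite leey.
have {}fin : (sumE (fun k => (fr k ^+ 2 * coef o k ^+ 2)%R) < +oo)%E.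
  by rewrite ltey; exact/eqP.
have [B B0 hB] := sumE_fin (p0 o) fin.
rewrite hB; apply: sumE_le => // n.
pose C := \sum_(k < n) fr k ^+ 4 * coef (polar o) k ^+ 2.
have C0 : 0 <= C by apply: sumr_ge0 => k _; rewrite mulr_ge0 ?sqr_ge0// exprn_even_ge0.
have H (s : R) : 0 < s -> \sum_(k < n) fr k ^+ 2 * coef (polar o) k ^+ 2 <= B + C / s.
  move=> s0; have t0 k : 0 < fr k ^+ 2 + s by rewrite ltr_wpDl ?sqr_ge0.
  have w0 u k : 0 <= fr k ^+ 2 / (fr k ^+ 2 + s) * coef u k ^+ 2.
    by rewrite mulr_ge0 ?sqr_ge0// divr_ge0 ?sqr_ge0// ltW.
  have h1 : (s%:E * wsum s o <= B%:E)%E.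
    rewrite -hB -sumE_Z//; last exact: ltW.
    apply: le_sumE => k; first by rewrite mulr_ge0// ltW.
    rewrite mulrA ler_wpM2r ?sqr_ge0// mulrCA ler_piMr ?sqr_ge0//.
    by rewrite ler_pdivrMr// mul1r lerDr sqr_ge0.
  have h2 : ((\sum_(k < n) s * (fr k ^+ 2 / (fr k ^+ 2 + s) * coef (polar o) k ^+ 2))%:E <= B%:E)%E.
    apply: le_trans h1; rewrite -mulr_sumr EFinM lee_pmul2l ?lte_fin//.
    by apply: le_trans (polar_wsum_le s0 ho po oN); exact: sumE_ge.
  rewrite lee_fin in h2; rewrite -lerBlDr; apply: le_trans h2.
  rewrite /C mulr_suml -sumrB; apply: ler_sum => k _.
  have := t0 k; set f := fr k => tf; rewrite -subr_ge0.
  rewrite (_ : _ - _ = f ^+ 6 / (s * (f ^+ 2 + s)) * coef (polar o) k ^+ 2); last first.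
    by field; rewrite !gt_eqF.
  rewrite mulr_ge0 ?sqr_ge0// divr_ge0 ?exprn_even_ge0//.
  by apply: mulr_ge0; exact: ltW.
apply/ler_addgt0Pl => eps eps0.
have s0 : 0 < (C + 1) / eps by rewrite divr_gt0// ltr_wpDl.
apply: le_trans (H _ s0) _; rewrite addrC lerD2r invf_div mulrCA ler_piMr ?(ltW eps0)//.
by rewrite ler_pdivrMr ?mul1r ?lerDl// ltr_wpDl.
Qed.

Section Fractional.
Context (alpha : R) (a0 : 0 < alpha) (a2 : alpha < 2).

(** With [s = expR r], [kpow] is the integrand in the formula expressing [m^alpha], up to a
    constant, as the integral of [m^2 / (m^2 + s)] against [s^(alpha/2 - 1) ds]; [bump] is the case
    [m = 1]. The exponential variable turns scaling into translation. *)
Definition bump (r : R) : R := expR (alpha / 2 * r) / (1 + expR r).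
Definition kpow k (r : R) : R := fr k ^+ 2 / (fr k ^+ 2 + expR r) * expR (alpha / 2 * r).

Let E1 (r : R) : 0 < 1 + expR r. Proof. by rewrite ltr_wpDl// expR_gt0. Qed.

Lemma continuous_bump : continuous bump.
Proof.
have cE (t : R) : continuous (fun r : R => expR (t * r)).
  exact: is_derive_continuous (is_derive_expZ t).
move=> r; apply: cvgM; first exact: cE.
apply: cvgV; first by rewrite gt_eqF.
by apply: cvgD; [exact: cvg_cst|exact: continuous_expR].
Qed.

Lemma bump_gt0 r : 0 < bump r. Proof. by rewrite divr_gt0// expR_gt0. Qed.

Definition Phi : \bar R := (\int[mu]_r (bump r)%:E)%E.

Lemma Phi_gt0 : (0 < Phi)%E.
Proof.
rewrite lt0e integral_ge0 ?andbT; last by move=> r _; rewrite lee_fin ltW// bump_gt0.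
apply/eqP => h.
have mb : measurable_fun setT (EFin \o bump).
  by apply/measurable_EFinP; apply: measurable_cont; exact: continuous_bump.
have := (ae_eq_integral_abs mu (@measurableT _ _) mb).1; rewrite /ae_eq /=.
rewrite (_ : (\int[mu]_x `|(bump x)%:E|)%E = 0%E); last first.
  rewrite -[RHS]h; apply: eq_integral => r _; rewrite gee0_abs// lee_fin.
  by rewrite ltW// bump_gt0.
move=> /(_ erefl) ae.
have [r [_ hr]] := ae_itv_exists (@ltr01 R) ae.
by have /eqP := hr Logic.I; rewrite eqe gt_eqF// bump_gt0.
Qed.

(** [bump] decays like [expR (alpha r / 2)] to the left and [expR ((alpha / 2 - 1) r)] to the right;
    the bounds [0 < alpha < 2] make both integrable. The majorant is a multiple of the exponential
    density on each half line. *)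
Lemma Phi_lty : (Phi < +oo)%E.
Proof.
have a0' := a0; have a2' := a2.
pose d := Num.min (alpha / 2) (1 - alpha / 2).
have [d0 d1 d2] : [/\ 0 < d, d <= alpha / 2 & d <= 1 - alpha / 2].
  by rewrite /d lt_min !ge_min !lexx orbT; split => //; apply/andP; split; lra.
pose g (r : R) : R := expR (- d * `|r|).
have cg : continuous g.
  move=> r; apply: (@continuous_comp _ _ _ (fun r : R => `|r|) (fun t => expR (- d * t))).
    exact: norm_continuous.
  exact: is_derive_continuous (is_derive_expZ (- d)) _.
have bg r : bump r <= g r.
  rewrite /bump /g ler_pdivrMr//; have [r0|/ltW r0] := leP 0 r.
    rewrite ger0_norm//; apply: (@le_trans _ _ (expR (- d * r) * expR r)).
      rewrite -expRD ler_expR; nra.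
    by rewrite ler_wpM2l ?expR_ge0// lerDr.
  rewrite ler0_norm//; apply: (@le_trans _ _ (expR (- d * - r) * 1)).
    rewrite mulr1 ler_expR; nra.
  by rewrite ler_wpM2l ?expR_ge0// lerDl expR_ge0.
have mE (f : R -> R) : continuous f -> measurable_fun setT (EFin \o f).
  by move=> cf; apply/measurable_EFinP; exact: measurable_cont.
apply: (@le_lt_trans _ _ (\int[mu]_r (g r)%:E)%E).
  apply: ge0_le_integral => //; try by move=> r _; rewrite lee_fin ?expR_ge0// ltW// bump_gt0.
  - by apply: mE; exact: continuous_bump.
  - exact: mE.
rewrite (ge0_symfun_integralT _ cg); first last.
- by move=> r; rewrite /g /= normrN.
- by move=> r; exact: expR_ge0.
apply: lte_mul_pinfty => //.
apply: (@le_lt_trans _ _ (\int[mu]_r (d^-1 * exponential_pdf d r)%:E)%E).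
  rewrite integral_mkcond; apply: ge0_le_integral => //.
  - by move=> r _; rewrite /= /patch; case: ifP => // _; rewrite lee_fin expR_ge0.
  - have mD : measurable ([set x | 0 <= x] : set (measurableTypeR R)).
      by rewrite -set_itvcy; exact: measurable_itv.
    by apply/(measurable_restrictT _ mD); apply: measurable_funTS; exact: mE.
  - by apply/measurable_EFinP/measurable_funM => //; exact: measurable_exponential_pdf.
  move=> r _; rewrite /= /patch; case: ifPn => [|_].
    rewrite inE /= => r0; rewrite lee_fin exponential_pdfE// /g ger0_norm//.
    by rewrite mulrA mulVf ?mul1r// gt_eqF.
  by rewrite lee_fin mulr_ge0 ?invr_ge0 ?(ltW d0)// exponential_pdf_ge0// ltW.
under eq_integral do rewrite EFinM.
rewrite ge0_integralZl//; last 3 first.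
- by apply/measurable_EFinP; exact: measurable_exponential_pdf.
- by move=> r _; rewrite lee_fin exponential_pdf_ge0// ltW.
- by rewrite lee_fin invr_ge0 ltW.
by rewrite integral_exponential_pdf// mule1 ltry.
Qed.

Lemma kpow_ge0 k r : 0 <= kpow k r.
Proof.
by rewrite mulr_ge0 ?expR_ge0// divr_ge0 ?sqr_ge0// addr_ge0 ?sqr_ge0 ?expR_ge0.
Qed.

Lemma measurable_kpow k : measurable_fun setT (kpow k).
Proof.
apply: measurable_cont => r; apply: cvgM; last first.
  exact: is_derive_continuous (is_derive_expZ (alpha / 2)) _.
apply: cvgM; first exact: cvg_cst.
apply: cvgV; first by rewrite gt_eqF// ltr_wpDl ?sqr_ge0 ?expR_gt0.
by apply: cvgD; [exact: cvg_cst|exact: continuous_expR].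
Qed.

(* The substitution [r -> r + 2 ln m] turns the kernel of frequency [m] into
   [m^alpha] times the one of frequency [1]. *)
Lemma integral_kpow k : (\int[mu]_r (kpow k r)%:E = (fr k `^ alpha)%:E * Phi)%E.
Proof.
case: k => [|k].
  rewrite /fr /= powR0 ?gt_eqF// mul0e; apply: integral0_eq => r _.
  by rewrite /kpow /fr /= expr0n/= !mul0r.
have f0 : 0 < fr k.+1 :> R by apply: lt_le_trans ltr01 _; exact: fr_ge1.
set f := fr k.+1 in f0 *.
have mk : measurable_fun setT (EFin \o kpow k.+1).
  by apply/measurable_EFinP; exact: measurable_kpow.
have k0 r : (0 <= (EFin \o kpow k.+1) r)%E by rewrite lee_fin kpow_ge0.
rewrite (ge0_integral_shift (ln f *+ 2) measurableT mk k0) preimage_setT.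
rewrite -ge0_integralZl//; last 3 first.
- by apply/measurable_EFinP; apply: measurable_cont; exact: continuous_bump.
- by move=> r _; rewrite lee_fin ltW// bump_gt0.
- by rewrite lee_fin powR_ge0.
apply: eq_integral => r _; rewrite /= -EFinM; congr EFin.
have e1 : expR (r + ln f *+ 2) = f ^+ 2 * expR r.
  by rewrite expRD mulr2n expRD !lnK ?posrE// mulrC.
have e2 : expR (alpha / 2 * (r + ln f *+ 2)) = f `^ alpha * expR (alpha / 2 * r).
  rewrite mulrDr expRD mulrC; congr (_ * _).
  by rewrite /powR gt_eqF//; congr expR; rewrite mulr2n; field.
rewrite /kpow -/f e1 e2 /bump; field.
by rewrite !gt_eqF// -[X in _ < X + _](mulr1) -mulrDr mulr_gt0// exprn_gt0.
Qed.

Lemma Phi_real : exists2 p : R, 0 < p & Phi = p%:E.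
Proof.
have := Phi_gt0; have := Phi_lty; case: Phi => // p _; rewrite lte_fin => p0.
by exists p.
Qed.

Lemma Phi_transform (c : nat -> R) : (forall k, 0 <= c k) ->
  (\int[mu]_r sumE (fun k => (kpow k r * c k)%R) = Phi * sumE (fun k => (fr k `^ alpha * c k)%R))%E.
Proof.
move=> c0; have [p p0 hp] := Phi_real; rewrite hp /sumE integral_nneseries//; last 2 first.
- move=> k; apply/measurable_EFinP; apply: measurable_funM => //; exact: measurable_kpow.
- by move=> k r _; rewrite lee_fin mulr_ge0 ?kpow_ge0.
rewrite -nneseriesZl; last by move=> k _; rewrite lee_fin mulr_ge0 ?powR_ge0.
apply: eq_eseriesr => k _.
under eq_integral do rewrite EFinM.
rewrite ge0_integralZr//; last 3 first.
- by apply/measurable_EFinP; exact: measurable_kpow.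
- by move=> r _; rewrite lee_fin kpow_ge0.
- by rewrite lee_fin.
by rewrite integral_kpow hp EFinM muleAC muleC [X in (_ * X)%E]muleC muleA.
Qed.

Lemma polar_power_lt2 o : L2 o -> periodic o (pi *+ 2) -> (forall y, o (- y) = - o y) ->
  (sumE (fun k => (fr k `^ alpha * coef (polar o) k ^+ 2)%R) <=
   sumE (fun k => (fr k `^ alpha * coef o k ^+ 2)%R))%E.
Proof.
move=> ho po oN.
have [p p0 hp] := Phi_real.
rewrite -(lee_pmul2l (x := Phi)); [|by rewrite hp|by rewrite hp lte_fin].
rewrite -!Phi_transform; [|by move=> k; exact: sqr_ge0|by move=> k; exact: sqr_ge0].
have kE u r : sumE (fun k => kpow k r * coef u k ^+ 2) =
    ((expR (alpha / 2 * r))%:E * wsum (expR r) u)%E.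
  rewrite -sumE_Z ?expR_ge0//; last first.
    move=> k; rewrite mulr_ge0 ?sqr_ge0// divr_ge0 ?sqr_ge0// addr_ge0 ?sqr_ge0 ?expR_ge0//.
  by congr sumE; apply/funext => k; rewrite /kpow; ring.
have ms u : measurable_fun setT (fun r => sumE (fun k => kpow k r * coef u k ^+ 2)).
  apply: ge0_emeasurable_sum => [k r _ _|k _].
    by rewrite lee_fin mulr_ge0 ?kpow_ge0 ?sqr_ge0.
  by apply/measurable_EFinP; apply: measurable_funM => //; exact: measurable_kpow.
have s0 u r : (0 <= sumE (fun k => (kpow k r * coef u k ^+ 2)%R))%E.
  by apply: sumE_ge0 => k; rewrite mulr_ge0 ?kpow_ge0 ?sqr_ge0.
apply: ge0_le_integral => //; [exact: ms|exact: ms|] => r _.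
rewrite !kE; apply: lee_wpmul2l; first by rewrite lee_fin expR_ge0.
by apply: polar_wsum_le => //; exact: expR_gt0.
Qed.

End Fractional.

End Power.

(** * The strong maximum principle for odd functions *)

Section StrongMax.
Context {R : realType}.
Implicit Types (x y : R) (m n k : nat) (a b : nat -> R).
Local Notation mu := (@lebesgue_measure R).

Lemma abscv_le a b t : abscv b -> (forall k, `|a k| <= t * `|b k|) -> abscv a.
Proof.
move=> [B hB] h; exists (Num.max t 0 * B) => n.
have t0 : 0 <= Num.max t 0 by rewrite le_max lexx orbT.
apply: le_trans (ler_wpM2l t0 (hB n)).
rewrite mulr_sumr; apply: ler_sum => k _; apply: le_trans (h k) _.
by rewrite ler_wpM2r// le_max lexx.
Qed.

Lemma abscv_lin (s t : R) a b : abscv a -> abscv b -> abscv (fun k => s * a k + t * b k).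
Proof.
move=> [A hA] [B hB]; exists (`|s| * A + `|t| * B) => n.
have h1 := ler_wpM2l (normr_ge0 s) (hA n); have h2 := ler_wpM2l (normr_ge0 t) (hB n).
apply: le_trans (lerD h1 h2); rewrite !mulr_sumr -big_split/=.
by apply: ler_sum => k _; rewrite -!normrM ler_normD.
Qed.

Lemma synth_lin (s t : R) a b x : abscv a -> abscv b ->
  synth (fun k => s * a k + t * b k) x = s * synth a x + t * synth b x.
Proof.
move=> ha hb; have h1 := @synth_cvg R _ x (abscv_lin s t ha hb).
have h2 : (s * psum a n x + t * psum b n x) @[n --> \oo] --> s * synth a x + t * synth b x.
  by apply: cvgD; (apply: cvgM; [exact: cvg_cst|exact: synth_cvg]).
have E : psum (fun k => s * a k + t * b k) ^~ x = (fun n => s * psum a n x + t * psum b n x).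
  apply/funext => n; rewrite /psum !mulr_sumr -big_split/=; apply: eq_bigr => k _; ring.
by rewrite E in h1; exact: (cvg_unique (@Rhausdorff R) h1 h2).
Qed.

Lemma synth_even a x : abscv a -> (forall k, odd k -> a k = 0) -> synth a (- x) = synth a x.
Proof.
move=> ha a0; have h1 := @synth_cvg R a (- x) ha; have h2 := @synth_cvg R a x ha.
have E : psum a ^~ (- x) = psum a ^~ x.
  apply/funext => n; apply: eq_bigr => k _.
  have [ok|ok] := boolP (odd k); last by rewrite e_even.
  by rewrite a0// !mul0r.
by rewrite E in h1; exact: (cvg_unique (@Rhausdorff R) h1 h2).
Qed.

Lemma fr_pow_ge1_odd (alpha : R) k : 0 < alpha -> odd k -> 1 <= fr k `^ alpha :> R.
Proof. by move=> a0; case: k => // k _; exact: fr_pow_ge1. Qed.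

Section Odd.
Context (alpha : R) (a0 : 0 < alpha) (a : nat -> R) (aodd : forall k, ~~ odd k -> a k = 0).
Context (ha : abscv (fun k => fr k `^ alpha * a k)).

Let habs : abscv a.
Proof.
apply: (@abscv_le _ _ 1 ha) => k; rewrite mul1r normrM (ger0_norm (powR_ge0 _ _)).
have [ok|ok] := boolP (odd k); last by rewrite aodd// normr0 mulr0.
by rewrite ler_peMl// fr_pow_ge1_odd.
Qed.

Context (pos : forall y, 0 < sin y -> 0 <= synth a y) (x0 : R) (sx0 : 0 < sin x0).
Context (z0 : synth a x0 = 0).

(* Since [m^alpha] is a positive superposition of the multipliers
   [1 - s / (m^2 + s)], the value of [D^alpha o] at a zero [x0] of [o] is minus a
   superposition of the resolvents of [o] at [x0], all of which are nonnegative. *)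
Lemma strong_max_lt2 : alpha < 2 -> synth (fun k => fr k `^ alpha * a k) x0 = 0 ->
  forall y, synth a y = 0.
Proof.
move=> a2 z1; pose o := synth a.
have L2o : L2 o by exact: L2_synth.
have [p p0 hp] := Phi_real a0 a2.
pose d k := a k * e k x0.
(* The terms of the series at [x0] have no sign, while [Phi_transform] exchanges sum and integral
   for nonnegative terms; positive and negative parts are therefore treated separately. *)
pose cp k := Num.max (d k) 0; pose cm k := Num.max (- d k) 0.
have cp0 k : 0 <= cp k by rewrite le_max lexx orbT.
have cm0 k : 0 <= cm k by rewrite le_max lexx orbT.
have dE k : cp k - cm k = d k.
  by rewrite /cp /cm; have [h|h] := leP (d k) 0; have [h'|h'] := leP (- d k) 0; lra.
have dle k : `|d k| <= `|a k| by rewrite normrM ler_piMr// e_le1.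
have cpl k : cp k <= `|a k|.
  by rewrite ge_max normr_ge0 andbT; apply: le_trans (ler_norm _) (dle k).
have cml k : cm k <= `|a k|.
  by rewrite ge_max normr_ge0 andbT; apply: le_trans (ler_norm _) _; rewrite normrN.
have W (w c : nat -> R) : (forall k, 0 <= w k) -> (forall k, 0 <= c k) ->
    (forall k, c k <= `|a k|) -> abscv (fun k => w k * a k) ->
    {S | sumE (fun k => w k * c k) = S%:E}.
  move=> w0 c0 ca hw; have wc k : 0 <= w k * c k by rewrite mulr_ge0.
  have [] := @sumE_fin R _ wc; last by move=> S _ hS; exists S.
  apply/(sumE_ltyP wc); have [B hB] := hw; exists B => n; apply: le_trans (hB n).
  by apply: ler_sum => k _; rewrite normrM (ger0_norm (w0 k)) ler_wpM2l.
have lim_diff (w : nat -> R) Sp Sm l : (forall k, 0 <= w k) ->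
    sumE (fun k => w k * cp k) = Sp%:E -> sumE (fun k => w k * cm k) = Sm%:E ->
    (\sum_(k < n) w k * d k) @[n --> \oo] --> l -> Sp - Sm = l.
  move=> w0 hSp hSm hl.
  have h1 := cvg_sumE (fun k => mulr_ge0 (w0 k) (cp0 k)) hSp.
  have h2 := cvg_sumE (fun k => mulr_ge0 (w0 k) (cm0 k)) hSm.
  have h3 : (\sum_(k < n) w k * d k) @[n --> \oo] --> Sp - Sm.
    have : (\sum_(k < n) w k * cp k - \sum_(k < n) w k * cm k) @[n --> \oo] --> Sp - Sm.
      exact: cvgB.
    apply: cvg_trans; apply: near_eq_cvg; apply: nearW => n.
    by rewrite /= -sumrB; apply: eq_bigr => k _; rewrite -mulrBr dE.
  exact: (cvg_unique (@Rhausdorff R) h3 hl).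
have [Xp hXp] := W _ cp (fun k => powR_ge0 (fr k) alpha) cp0 cpl ha.
have [Xm hXm] := W _ cm (fun k => powR_ge0 (fr k) alpha) cm0 cml ha.
have Xpm : Xp - Xm = 0.
  rewrite -[RHS]z1; apply: (lim_diff _ _ _ _ (fun k => powR_ge0 (fr k) alpha) hXp hXm).
  have := @synth_cvg R _ x0 ha.
  by rewrite /psum; under eq_fun do under eq_bigr do rewrite -mulrA.
pose T (r : R) := synth (rcoef (expR r) o) x0.
have Tpos r : 0 <= T r /\ (T r = 0 -> forall y, o y = 0).
  have [K [k1 k2 k3 k4 k5]] := green_kernel_sqrt (expR_gt0 r).
  apply: (resolvent_strict (expR_gt0 r) k1 k2 k3 k4 k5) => //.
  - exact: continuous_synth.
  - exact: periodic_synth.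
  - by move=> z; exact: synth_odd.
have hk r : abscv (fun k => kpow alpha k r * a k).
  apply: (@abscv_le _ _ (expR (alpha / 2 * r)) habs) => k.
  rewrite normrM (ger0_norm (kpow_ge0 alpha k r)) ler_wpM2r// /kpow ler_piMl ?expR_ge0//.
  have s0 : 0 < fr k ^+ 2 + expR r by rewrite ltr_wpDl ?sqr_ge0// expR_gt0.
  by rewrite ler_pdivrMr// mul1r lerDl expR_ge0.
have G r : exists Sp Sm, [/\ sumE (fun k => kpow alpha k r * cp k) = Sp%:E,
    sumE (fun k => kpow alpha k r * cm k) = Sm%:E &
    Sm - Sp = expR (alpha / 2 * r) * (expR r * T r)].
  have [Sp hSp] := W _ cp (fun k => kpow_ge0 alpha k r) cp0 cpl (hk r).
  have [Sm hSm] := W _ cm (fun k => kpow_ge0 alpha k r) cm0 cml (hk r).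
  exists Sp, Sm; split => //; apply: oppr_inj; rewrite opprB.
  apply: (lim_diff _ _ _ _ (fun k => kpow_ge0 alpha k r) hSp hSm).
  have hr := abscv_rcoef (expR_gt0 r) L2o.
  have h1 := @synth_cvg R _ x0 habs; have h2 := @synth_cvg R _ x0 hr.
  have : (expR (alpha / 2 * r) * (psum a n x0 - expR r * psum (rcoef (expR r) o) n x0))
     @[n --> \oo] --> expR (alpha / 2 * r) * (synth a x0 - expR r * T r).
    by apply: cvgM; [exact: cvg_cst|apply: cvgB => //; apply: cvgM => //; exact: cvg_cst].
  rewrite z0 sub0r mulrN; apply: cvg_trans; apply: near_eq_cvg; apply: nearW => n /=.
  rewrite /psum mulr_sumr -sumrB mulr_sumr; apply: eq_bigr => k _.
  rewrite /rcoef /o coef_synth// /kpow /d.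
  by field; apply: lt0r_neq0; rewrite ltr_wpDl ?sqr_ge0// expR_gt0.
(* [f r] is [Sm - Sp] of [G]. It is nonnegative with integral [Phi (Xm - Xp) = 0], so the resolvent
   [T r] vanishes for some [r], and [Tpos] concludes. *)
pose f (r : R) : \bar R := (expR (alpha / 2 * r) * (expR r * T r))%:E.
have f0 r : (0 <= f r)%E.
  by rewrite lee_fin !mulr_ge0 ?expR_ge0//; have [] := Tpos r.
have ms (c : nat -> R) : (forall k, 0 <= c k) ->
    measurable_fun setT (fun r => sumE (fun k => kpow alpha k r * c k)).
  move=> c0; apply: ge0_emeasurable_sum => [k r _ _|k _].
    by rewrite lee_fin mulr_ge0 ?kpow_ge0.
  by apply/measurable_EFinP; apply: measurable_funM => //; exact: measurable_kpow.
have mf : measurable_fun setT f.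
  rewrite (_ : f = fun r => (sumE (fun k => (kpow alpha k r * cm k)%R) -
      sumE (fun k => (kpow alpha k r * cp k)%R))%E); first by apply: emeasurable_funB; exact: ms.
  by apply/funext => r; have [Sp [Sm [-> -> h]]] := G r; rewrite -EFinB h.
have If : (\int[mu]_r f r = 0)%E.
  have h1 := Phi_transform a0 a2 cp0; have h2 := Phi_transform a0 a2 cm0.
  have : (\int[mu]_r (sumE (fun k => (kpow alpha k r * cp k)%R) + f r) =
          \int[mu]_r sumE (fun k => (kpow alpha k r * cm k)%R))%E.
    apply: eq_integral => r _; have [Sp [Sm [-> -> h]]] := G r.
    by rewrite /f -h -EFinD addrC subrK.
  rewrite ge0_integralD//; last 2 first.
  - by move=> r _; apply: sumE_ge0 => k; rewrite mulr_ge0 ?kpow_ge0.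
  - exact: ms.
  rewrite h1 h2 hXp hXm hp -!EFinM.
  rewrite (_ : Xm = Xp); last by lra.
  have : (0 <= \int[mu]_r f r)%E by exact: integral_ge0.
  case: (\int[mu]_r f r)%E => // t _ [] h; congr EFin; lra.
have := (ae_eq_integral_abs mu (@measurableT _ _) mf).1; rewrite /ae_eq /=.
rewrite (_ : (\int[mu]_x `|f x|)%E = 0%E); last first.
  by rewrite -[RHS]If; apply: eq_integral => r _; rewrite gee0_abs.
move=> /(_ erefl) ae.
have [r [_ hr]] := ae_itv_exists (@ltr01 R) ae.
have /eqP := hr Logic.I; rewrite eqe !mulf_eq0 !expR_eq0/= => /eqP h.
exact: (proj2 (Tpos r)).
Qed.

(* For [alpha = 2] the equation is inverted with a single resolvent. *)
Lemma strong_max (V : R -> R) (M : R) : alpha <= 2 -> (forall y, `|V y| <= M) ->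
  (forall y, synth (fun k => fr k `^ alpha * a k) y = V y * synth a y) ->
  forall y, synth a y = 0.
Proof.
rewrite le_eqVlt => /orP[/eqP a2|a2] VM hV; last first.
  by apply: strong_max_lt2 => //; rewrite hV z0 mulr0.
have M0 : 0 <= M by apply: le_trans (VM 0).
(* The shift makes [V + K >= 1]. Then [(D^2 + K) o = (V + K) o] is nonnegative on the half circle,
   and [o] is its resolvent at parameter [K]. *)
pose K := M + 1; have K0 : 0 < K by rewrite /K; lra.
pose h k := 1 * (fr k `^ alpha * a k) + K * a k.
have hh : abscv h by exact: abscv_lin.
have hE y : synth h y = (V y + K) * synth a y.
  by rewrite synth_lin// hV; ring.
have VK y : 1 <= V y + K by have := VM y; rewrite ler_norml /K => /andP[]; lra.
have [KK [k1 k2 k3 k4 k5]] := green_kernel_sqrt K0.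
have rE : rcoef K (synth h) = a.
  apply/funext => k; rewrite /rcoef coef_synth// /h a2 powR_mulrn// mul1r -mulrDl.
  by rewrite mulrAC divff ?mul1r// gt_eqF// ltr_wpDl ?sqr_ge0.
have [_] := resolvent_strict K0 k1 k2 k3 k4 k5 (u := synth h) (x := x0)
  (continuous_synth hh) (@periodic_synth R h)
  (fun z => synth_odd z hh (fun k ok => ltac:(by rewrite /h aodd// !mulr0 addr0)))
  (fun z sz => ltac:(by rewrite hE mulr_ge0 ?pos//; apply: le_trans (VK z))) sx0.
rewrite rE z0 => /(_ erefl) hz y.
by have /eqP := hz y; rewrite hE mulf_eq0 => /orP[/eqP|/eqP //]; have := VK y; lra.
Qed.

End Odd.

End StrongMax.

(** * Reflections of ground states *)

Section GroundStates.
Context {R : realType}.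
Implicit Types (x y : R) (m n k : nat) (a b : nat -> R) (u v phi : R -> R).
Local Notation mu := (@lebesgue_measure R).

(** Countably many translates of the circle by periods cover the line. *)
Lemma ae_circle_periodic u v : periodic u (pi *+ 2) -> periodic v (pi *+ 2) ->
  {ae mu, forall x, circle R x -> u x = v x} -> {ae mu, forall x, u x = v x}.
Proof.
move=> pu pv h.
have hp (z : int) : {ae mu, forall x, circle R (x + z%:~R * (pi *+ 2)) -> u x = v x}.
  have := ae_shift (z%:~R * (pi *+ 2)) h; apply: aeS => x.
  by rewrite (periodicz z x pu) (periodicz z x pv).
have h1 := ae_foralln (fun n => hp (Posz n)).
have h2 := ae_foralln (fun n => hp (Negz n)).
have := aeI h1 h2; apply: aeS => x [k1 k2].
have [z /andP[z1 z2]] := circle_reduce x.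
have cz : circle R (x + z%:~R * (pi *+ 2)) by rewrite /circle /= in_itv/= z2 ltW.
by case: z cz {z1 z2} => n; [exact: k1|exact: k2].
Qed.

Definition oddp a k : R := if odd k then a k else 0.
Definition evenp a k : R := if odd k then 0 else a k.

Lemma abscv_oddp a : abscv a -> abscv (oddp a).
Proof.
move=> h; apply: (@abscv_le _ _ _ 1 h) => k; rewrite mul1r /oddp.
by case: ifP => // _; rewrite normr0.
Qed.

Lemma abscv_evenp a : abscv a -> abscv (evenp a).
Proof.
move=> h; apply: (@abscv_le _ _ _ 1 h) => k; rewrite mul1r /evenp.
by case: ifP => // _; rewrite normr0.
Qed.

Lemma synth_split a x : abscv a -> synth a x = synth (evenp a) x + synth (oddp a) x.
Proof.
move=> h; have := synth_lin 1 1 x (abscv_evenp h) (abscv_oddp h).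
rewrite !mul1r => <-; congr synth; apply/funext => k; rewrite /evenp /oddp !mul1r.
by case: ifP => _; rewrite ?add0r ?addr0.
Qed.

Lemma synth_splitN a x : abscv a -> synth a (- x) = synth (evenp a) x - synth (oddp a) x.
Proof.
move=> h; rewrite synth_split// synth_even ?synth_odd//.
- exact: abscv_oddp.
- by move=> k /negPf ok; rewrite /oddp ok.
- exact: abscv_evenp.
- by move=> k ok; rewrite /evenp ok.
Qed.

(** A translation by [t] rotates the sine-cosine pair of frequency [M] by the angle [M t]. *)
Lemma coef_shift_pair u (t : R) m : periodic u (pi *+ 2) -> L2 u ->
  coef (fun x => u (x + t)) m.*2.+1 ^+ 2 + coef (fun x => u (x + t)) m.*2.+2 ^+ 2 =
  coef u m.*2.+1 ^+ 2 + coef u m.*2.+2 ^+ 2.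
Proof.
move=> pu hu; have [mu_ iu] := hu.
have hv : L2 (fun x => u (x + t)).
  split; first by apply: measurableT_comp mu_ (measurable_shift t).
  apply: (itg_shift t (f := fun x => u x ^+ 2)) => //; first exact: measurable_funX.
  by move=> x /=; rewrite pu.
rewrite !coef_tr// nrm_odd nrm_even /tr /= odd_double /= /fr /= uphalf_double doubleK.
set M : R := m.+1%:R.
have ic : itg (fun x => u x * cos (M * x)).
  apply/L2_itg/(L2_mul_bounded hu (M := 1)); first exact: measurable_cosZ.
  by move=> x; rewrite ler_norml cos_geN1 cos_le1.
have is_ : itg (fun x => u x * sin (M * x)).
  apply/L2_itg/(L2_mul_bounded hu (M := 1)); first exact: measurable_sinZ.
  by move=> x; rewrite ler_norml sin_geN1 sin_le1.
have mt (g : R -> R) : continuous g -> measurable_fun setT (fun x => u x * g (M * (x - t))).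
  move=> cg; apply: measurable_funM => //; apply: measurable_cont => x.
  apply: (@continuous_comp _ _ _ (fun x => M * (x - t)) g); last exact: cg.
  by apply: cvgM; [exact: cvg_cst|apply: cvgB; [exact: cvg_id|exact: cvg_cst]].
have pM x : M * (x + pi *+ 2 - t) = M * (x - t) + (m.+1%:Z)%:~R * (pi *+ 2).
  by rewrite -[(m.+1%:Z)%:~R]/M; ring.
have Es : I (fun x => u (x + t) * sin (M * x)) =
    cos (M * t) * I (fun x => u x * sin (M * x)) - sin (M * t) * I (fun x => u x * cos (M * x)).
  rewrite (_ : (fun x => _) = fun x => (fun y => u y * sin (M * (y - t))) (x + t)); last first.
    by apply/funext => x /=; rewrite addrK.
  rewrite (I_shift t (mt _ (@continuous_sin R))); last first.
    by move=> x; rewrite /= pu pM sin_periodz.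
  rewrite -!IZ// -IB; [|exact: itgZ|exact: itgZ].
  by congr I; apply/funext => x; rewrite mulrBr sinB; ring.
have Ec : I (fun x => u (x + t) * cos (M * x)) =
    cos (M * t) * I (fun x => u x * cos (M * x)) + sin (M * t) * I (fun x => u x * sin (M * x)).
  rewrite (_ : (fun x => _) = fun x => (fun y => u y * cos (M * (y - t))) (x + t)); last first.
    by apply/funext => x /=; rewrite addrK.
  rewrite (I_shift t (mt _ (@continuous_cos R))); last first.
    by move=> x; rewrite /= pu pM cos_periodz.
  rewrite -!IZ// -ID; [|exact: itgZ|exact: itgZ].
  by congr I; apply/funext => x; rewrite mulrBr cosB; ring.
rewrite Es Ec; have := cos2Dsin2 (M * t).
set C := cos (M * t); set S := sin (M * t); set A := I _; set B := I _ => h.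
transitivity ((Num.sqrt pi)^-1 ^+ 2 * (A ^+ 2 + B ^+ 2) * (C ^+ 2 + S ^+ 2)); first by ring.
by rewrite h; ring.
Qed.

Context (alpha c : R) (ha : 1 / 3 < alpha) (hc : -1 < c).
Let a0 : 0 < alpha. Proof. by apply: lt_trans ha; rewrite divr_gt0. Qed.

Lemma ground_state_shift phi (t : R) : ground_state alpha c phi ->
  ground_state alpha c (fun x => phi (x + t)).
Proof.
move=> /(ground_stateP a0 hc)[Yphi hmin]; apply/(ground_stateP a0 hc).
have [pphi hphi i3 I3 c0] := Y0_facts ha hc Yphi.
have [L L0 hL] := Y0_En_real ha hc Yphi.
have [mphi iphi] := hphi.
have hv : L2 (fun x => phi (x + t)).
  split; first by apply: measurableT_comp mphi (measurable_shift t).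
  apply: (itg_shift t (f := fun x => phi x ^+ 2)) => //; first exact: measurable_funX.
  by move=> x /=; rewrite pphi.
have v0 : coef (fun x => phi (x + t)) 0 = 0.
  by apply/(coef0_I hv); rewrite (I_shift t mphi pphi); apply/(coef0_I hphi).
have vE : (En alpha c (fun x => phi (x + t)%R) <= En alpha c phi)%E.
  rewrite hL; apply: sumE_le; first exact: En_term_ge0.
  move=> n; have := sumE_real (En_term_ge0 a0 hc phi) hL n.*2.+1; apply: le_trans.
  apply: (@le_trans _ _ (\sum_(k < n.*2.+1) lam alpha c k * coef (fun x => phi (x + t)) k ^+ 2)).
    apply: (@sum_le_widen _ (fun k => lam alpha c k * coef (fun x => phi (x + t)) k ^+ 2)).
      exact: En_term_ge0.
    by apply: leq_trans (leqnSn _); rewrite -addnn leq_addr.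
  rewrite (sum_pairs (fun k => lam alpha c k * coef (fun x => phi (x + t)) k ^+ 2)).
  rewrite (sum_pairs (fun k => lam alpha c k * coef phi k ^+ 2)) v0 c0 lerD2l.
  apply: ler_sum => m _; rewrite /lam /= /fr /= uphalf_double doubleK -!mulrDr.
  by rewrite coef_shift_pair.
split; last by move=> u Yu; apply: le_trans vE (hmin u Yu).
apply/(Y0P a0 hc); split => //.
- by apply/L2_perP; split => // x; rewrite addrAC pphi.
- by apply: le_lt_trans vE _; rewrite hL ltry.
- rewrite (I_shift t (f := fun x => phi x ^+ 3))//; first exact: measurable_funX.
  by move=> x /=; rewrite pphi.
Qed.

Lemma ground_state_abscv phi : ground_state alpha c phi ->
  abscv (fun k => fr k `^ alpha * coef phi k) /\ abscv (coef phi).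
Proof.
move=> gs; have /(ground_stateP a0 hc)[Yphi _] := gs.
have [_ _ _ _ c0] := Y0_facts ha hc Yphi.
have [B hB] := ground_state_regular ha hc gs.
have h : abscv (fun k => fr k `^ alpha * coef phi k).
  exists B => n; apply: le_trans (hB n); apply: ler_sum => k _.
  by rewrite normrM (ger0_norm (powR_ge0 _ _)).
split => //; apply: (@abscv_le _ _ _ 1 h) => k; rewrite mul1r normrM (ger0_norm (powR_ge0 _ _)).
case: k => [|k]; first by rewrite c0 normr0 mulr0.
by rewrite ler_peMl// fr_pow_ge1.
Qed.

Lemma ground_state_ae phi v : ground_state alpha c phi -> periodic v (pi *+ 2) ->
  measurable_fun setT v -> {ae mu, forall x, circle R x -> phi x = v x} ->
  ground_state alpha c v.
Proof.
move=> /(ground_stateP a0 hc)[Yphi hmin] pv mv ae; apply/(ground_stateP a0 hc).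
have [pphi hphi i3 I3 c0] := Y0_facts ha hc Yphi.
have hv := L2_ae hphi mv ae.
have cE : coef v = coef phi by apply/funext => k; rewrite (coef_ae k hphi mv ae).
have EE : En alpha c v = En alpha c phi by rewrite /En cE.
split; last by move=> u Yu; rewrite EE; exact: hmin.
have /(Y0P a0 hc)[_ fin _ _] := Yphi.
apply/(Y0P a0 hc); split; [by apply/L2_perP|by rewrite EE| |by rewrite cE].
have ae3 : {ae mu, forall x, circle R x -> phi x ^+ 3 = v x ^+ 3}.
  by apply: aeS ae => x h cx; rewrite h.
by have [_ <-] := I_ae i3 (measurable_funX 3 mv) ae3.
Qed.

Lemma ground_state_synth phi : ground_state alpha c phi ->
  ground_state alpha c (synth (coef phi)) /\
  {ae mu, forall x, synth (coef phi) x = phi x}.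
Proof.
move=> gs; have /(ground_stateP a0 hc)[Yphi _] := gs.
have [pphi hphi _ _ _] := Y0_facts ha hc Yphi.
have [_ habs] := ground_state_abscv gs.
have ae : {ae mu, forall x, circle R x -> phi x = synth (coef phi) x}.
  by apply: fourier_inj => //; [exact: L2_synth|rewrite coef_synth].
split; first exact: (ground_state_ae gs (@periodic_synth R _) (measurable_synth habs) ae).
apply: ae_circle_periodic => //; first exact: periodic_synth.
by apply: aeS ae => x h cx; rewrite h.
Qed.

(* The odd part of the Euler-Lagrange equation [D^alpha u + c u = L u^2 + const]. *)
Lemma odd_relation phi (L : R) x : ground_state alpha c phi -> En alpha c phi = L%:E ->
  synth (fun k => fr k `^ alpha * oddp (coef phi) k) x =
  (2 * L * synth (evenp (coef phi)) x - c) * synth (oddp (coef phi)) x.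
Proof.
move=> gs hL; have [hreg habs] := ground_state_abscv gs.
have [gf _] := ground_state_synth gs.
set a := coef phi in hreg habs gf *; pose f := synth a.
have cf : coef f = a by exact: coef_synth.
have contf : continuous f by exact: continuous_synth.
have perf : periodic f (pi *+ 2) by exact: periodic_synth.
have cont2 : continuous (fun y => L * f y ^+ 2).
  move=> y; apply: cvgM; first exact: cvg_cst.
  by apply: (@continuous_comp _ _ _ f (fun t => t ^+ 2)); [exact: contf|exact: exprn_continuous].
have per2 : periodic (fun y => L * f y ^+ 2) (pi *+ 2) by move=> y /=; rewrite perf.
have L2f2 : L2 (fun y => f y ^+ 2).
  apply: L2_continuous => y.
  by apply: (@continuous_comp _ _ _ f (fun t => t ^+ 2)); [exact: contf|exact: exprn_continuous].
pose p := coef (fun y => L * f y ^+ 2).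
have pE k : (0 < k)%N -> p k = fr k `^ alpha * a k + c * a k.
  move=> k0; rewrite /p fcoefZ// -(euler_lagrange ha hc gf _ k0); last first.
    by rewrite /En cf.
  by rewrite cf /lam gtn_eqF// mulrDl.
have hs : abscv (fun k => 1 * (fr k `^ alpha * a k) + c * a k) by exact: abscv_lin.
have hp : abscv p.
  have [B hB] := hs; exists (`|p 0%N| + B) => n.
  apply: (@le_trans _ _ (\sum_(k < n.+1) `|p k|)).
    by apply: (@sum_le_widen _ (fun k => `|p k|)).
  rewrite (sum_recl (fun k => `|p k|)) lerD2l.
  have := hB n.+1; rewrite (sum_recl (fun k => `|1 * (fr k `^ alpha * a k) + c * a k|)).
  move=> h; apply: le_trans h; rewrite -[leLHS]add0r; apply: lerD => //.
  by apply: ler_sum => k _; rewrite pE// mul1r.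
have fp y : L * f y ^+ 2 = synth p y.
  exact: (abscv_coef_eq cont2 per2 (L2_continuous cont2) hp).
(* With [E], [O] the even and odd parts of [f], subtracting the two identities leaves [4 L E O]
   against twice the odd part of [synth p]. Index 0, where the equation has its free constant,
   belongs to the even part. *)
have h1 := fp x; have h2 := fp (- x).
rewrite (synth_split x hp) in h1; rewrite (synth_splitN x hp) in h2.
rewrite /f (synth_split x habs) in h1; rewrite /f (synth_splitN x habs) in h2.
have -> : synth (fun k => fr k `^ alpha * oddp a k) x =
    synth (oddp p) x - c * synth (oddp a) x.
  have hr : abscv (fun k => fr k `^ alpha * oddp a k).
    apply: (@abscv_le _ _ _ 1 hreg) => k; rewrite mul1r /oddp.
    by case: ifP => // _; rewrite mulr0 normr0.
  have := synth_lin 1 c x hr (abscv_oddp habs); rewrite mul1r => h.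
  apply/eqP; rewrite eq_sym subr_eq -h; apply/eqP; congr synth; apply/funext => k.
  rewrite /oddp; case: ifP => ok; last by rewrite !mulr0 addr0.
  by rewrite pE ?mul1r//; case: k ok.
move: (synth (evenp a) x) (synth (oddp a) x) (synth (evenp p) x) (synth (oddp p) x) h1 h2.
by move=> E O PE PO h1 h2; lra.
Qed.

Lemma En_split u X Y : coef u 0 = 0 -> sumE (fun k => fr k `^ alpha * coef u k ^+ 2) = X%:E ->
  sumE (fun k => coef u k ^+ 2) = Y%:E -> En alpha c u = (X + c * Y)%:E.
Proof.
move=> u0 hX hY; apply: (@sumE_cvg _ _ _ (En_term_ge0 a0 hc u)).
have h1 := cvg_sumE (fun k => mulr_ge0 (powR_ge0 (fr k) alpha) (sqr_ge0 (coef u k))) hX.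
have h2 := cvg_sumE (fun k => sqr_ge0 (coef u k)) hY.
have : (\sum_(k < n) fr k `^ alpha * coef u k ^+ 2 + c * \sum_(k < n) coef u k ^+ 2)
   @[n --> \oo] --> X + c * Y.
  by apply: cvgD => //; apply: cvgM => //; exact: cvg_cst.
apply: cvg_trans; apply: near_eq_cvg; apply: nearW => n /=.
rewrite mulr_sumr -big_split/=; apply: eq_bigr => -[[|k] _] _ /=.
  by rewrite u0 expr0n/= !mulr0 addr0.
by rewrite /lam /= mulrDl.
Qed.

(** * Polarization of a ground state about the origin *)

Section Dichotomy.
Context (phi : R -> R) (gs : ground_state alpha c phi).
Local Notation a := (coef phi).
Let ev := synth (evenp a).
Let o := synth (oddp a).
Let U x := ev x + polar o x.

Let habs : abscv a. Proof. exact: (proj2 (ground_state_abscv gs)). Qed.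
Let he : abscv (evenp a). Proof. exact: abscv_evenp. Qed.
Let ho : abscv (oddp a). Proof. exact: abscv_oddp. Qed.
Let L2e' : L2 ev. Proof. exact: L2_synth. Qed.
Let L2o : L2 o. Proof. exact: L2_synth. Qed.
Let po : periodic o (pi *+ 2). Proof. exact: periodic_synth. Qed.
Let pev : periodic ev (pi *+ 2). Proof. exact: periodic_synth. Qed.
Let oN x : o (- x) = - o x.
Proof. by apply: synth_odd => // k ok; rewrite /oddp (negPf ok). Qed.
Let evN x : ev (- x) = ev x.
Proof. by apply: synth_even => // k ok; rewrite /evenp ok. Qed.
Let L2p : L2 (polar o). Proof. exact: L2_polar. Qed.
Let pp : periodic (polar o) (pi *+ 2). Proof. exact: polar_periodic. Qed.
Let pN x : polar o (- x) = - polar o x. Proof. exact: polar_odd. Qed.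
Let L2U : L2 U. Proof. exact: L2D. Qed.

Let coefU k : coef U k = evenp a k + coef (polar o) k.
Proof. by rewrite fcoefD// coef_synth. Qed.

Let coefp_even k : ~~ odd k -> coef (polar o) k = 0.
Proof. exact: coef_odd0. Qed.

Let sqU k : coef U k ^+ 2 = evenp a k ^+ 2 + coef (polar o) k ^+ 2.
Proof.
rewrite coefU /evenp; case: ifPn => ok; first by rewrite add0r expr0n/= add0r.
by rewrite coefp_even// addr0 expr0n/= addr0.
Qed.

Let sqa k : a k ^+ 2 = evenp a k ^+ 2 + oddp a k ^+ 2.
Proof. by rewrite /evenp /oddp; case: ifP => _; rewrite expr0n/= ?add0r ?addr0. Qed.

Let power_le (a2 : alpha <= 2) :
  (sumE (fun k => (fr k `^ alpha * coef (polar o) k ^+ 2)%R) <=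
   sumE (fun k => (fr k `^ alpha * oddp a k ^+ 2)%R))%E.
Proof.
have co : coef o = oddp a by exact: coef_synth.
move: a2; rewrite le_eqVlt => /orP[/eqP E|lt]; last first.
  by rewrite -co; exact: polar_power_lt2.
have := polar_power2_le L2o po oN; rewrite co.
have fE b : (fun k => fr k `^ alpha * b k ^+ 2) = (fun k => fr k ^+ 2 * b k ^+ 2).
  by apply/funext => k; rewrite E powR_mulrn.
by rewrite (fE (coef (polar o))) (fE (oddp a)).
Qed.

(** Since [polar o] and [o] have the same square, the cubes of [ev + o] and of [U] differ by the odd
    function [w]. *)
Let cubeU : I (fun x => U x ^+ 3) = 1.
Proof.
have [i3 I3] : itg (fun x => (ev x + o x) ^+ 3) /\ I (fun x => (ev x + o x) ^+ 3) = 1.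
  have [/(ground_stateP a0 hc)[Yf _] _] := ground_state_synth gs.
  have [_ _ i3 I3 _] := Y0_facts ha hc Yf.
  have fE : synth a = fun x => ev x + o x by apply/funext => x; exact: synth_split.
  by rewrite fE in i3 I3.
have [M1 hM1] := synth_bound he; have [M2 hM2] := synth_bound ho.
pose w x := 3 * ev x ^+ 2 * (o x - polar o x) + (o x ^+ 3 - polar o x ^+ 3).
have me := proj1 L2e'; have mo := proj1 L2o; have mp := proj1 L2p.
have mw : measurable_fun setT w.
  apply: measurable_funD.
    apply: measurable_funM; last exact: measurable_funB.
    by apply: measurable_funM => //; exact: measurable_funX.
  by apply: measurable_funB; exact: measurable_funX.
have iw : itg w.
  apply: (@itg_bounded _ _ (3 * M1 ^+ 2 * (M2 + M2) + (M2 ^+ 3 + M2 ^+ 3))) => // x.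
  have b1 : `|ev x| <= M1 by exact: hM1.
  have b2 : `|o x| <= M2 by exact: hM2.
  have b3 : `|polar o x| <= M2 by rewrite polar_norm.
  have n1 : 0 <= M1 by apply: le_trans b1.
  have n2 : 0 <= M2 by apply: le_trans b2.
  apply: le_trans (ler_normD _ _) _; apply: lerD.
    rewrite normrM; apply: ler_pM => //.
      by rewrite normrM normrX ger0_norm// ler_wpM2l// lerXn2r ?nnegrE.
    by apply: le_trans (ler_normB _ _) _; exact: lerD.
  by apply: le_trans (ler_normB _ _) _; rewrite !normrX; apply: lerD; rewrite lerXn2r ?nnegrE.
have Iw : I w = 0.
  by apply: I_odd => // x; rewrite /w evN oN pN; ring.
rewrite -I3 (_ : (fun x => U x ^+ 3) = fun x => (ev x + o x) ^+ 3 - w x).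
  by rewrite IB// Iw subr0.
apply/funext => x; rewrite /U /w.
have := polar_sqr o x; set p := polar o x; set q := o x; set t := ev x => h.
have -> : (t + p) ^+ 3 = t ^+ 3 + 3 * t ^+ 2 * p + 3 * t * p ^+ 2 + p ^+ 3 by ring.
by rewrite h; ring.
Qed.

(** Even and odd coefficients contribute separately to the energy. The [L^2] mass of the odd part is
    unchanged, so the term with [c] is too, and the sum with weights [m^alpha] does not grow by
    [power_le]. *)
Lemma polar_ground_state : alpha <= 2 -> ground_state alpha c U.
Proof.
move=> a2; have /(ground_stateP a0 hc)[Yphi hmin] := gs.
have [pphi hphi i3 I3 c0] := Y0_facts ha hc Yphi.
have U0 : coef U 0 = 0 by rewrite coefU /evenp /= c0 add0r coefp_even.
have [B hB] := (ground_state_abscv gs).1.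
have fa0 k : 0 <= fr k `^ alpha by exact: powR_ge0.
have habs1 k : `|a k| <= fr k `^ alpha * `|a k|.
  case: k => [|k]; first by rewrite c0 normr0 mulr0.
  by rewrite ler_peMl// fr_pow_ge1.
have hB' n : \sum_(k < n) fr k `^ alpha * `|a k| <= B.
  apply: le_trans (hB n); apply: ler_sum => k _.
  by rewrite normrM (ger0_norm (fa0 k)).
have aB k : `|a k| <= B.
  apply: le_trans (habs1 k) _; apply: le_trans (hB' k.+1); rewrite big_ord_recr/= lerDr.
  by apply: sumr_ge0 => i _; rewrite mulr_ge0.
have t0 b k : 0 <= fr k `^ alpha * b k ^+ 2 by rewrite mulr_ge0 ?sqr_ge0.
have [Xf _ hXf] : {X | 0 <= X & sumE (fun k => fr k `^ alpha * a k ^+ 2) = X%:E}.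
  apply: sumE_fin; first exact: t0.
  apply/(sumE_ltyP (t0 a)); exists (B * B) => n.
  have B0 : 0 <= B by apply: le_trans (aB 0%N).
  apply: le_trans (ler_wpM2l B0 (hB' n)); rewrite mulr_sumr; apply: ler_sum => k _.
  rewrite -real_normK ?num_real// expr2 mulrA mulrC ler_wpM2r//.
  by rewrite mulr_ge0.
have hXU : (sumE (fun k => (fr k `^ alpha * coef U k ^+ 2)%R) <= Xf%:E)%E.
  rewrite -hXf (_ : (fun k => fr k `^ alpha * coef U k ^+ 2) =
     fun k => fr k `^ alpha * evenp a k ^+ 2 + fr k `^ alpha * coef (polar o) k ^+ 2); last first.
    by apply/funext => k; rewrite sqU mulrDr.
  rewrite (_ : (fun k => fr k `^ alpha * a k ^+ 2) =
     fun k => fr k `^ alpha * evenp a k ^+ 2 + fr k `^ alpha * oddp a k ^+ 2); last first.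
    by apply/funext => k; rewrite sqa mulrDr.
  rewrite !sumE_D//; try exact: t0.
  by rewrite leeD2l// power_le.
have [XU _ hXU'] : {X | 0 <= X & sumE (fun k => fr k `^ alpha * coef U k ^+ 2) = X%:E}.
  apply: sumE_fin; first exact: t0.
  by apply: le_lt_trans hXU _; rewrite ltry.
have YE : sumE (fun k => coef U k ^+ 2) = sumE (fun k => a k ^+ 2).
  rewrite (_ : (fun k => coef U k ^+ 2) =
     fun k => evenp a k ^+ 2 + coef (polar o) k ^+ 2); last by apply/funext.
  rewrite (_ : (fun k => a k ^+ 2) = fun k => evenp a k ^+ 2 + oddp a k ^+ 2); last first.
    by apply/funext.
  rewrite !sumE_D//; try by move=> k; exact: sqr_ge0.
  rewrite (parseval L2p) (_ : sumE (fun k => oddp a k ^+ 2) = sumE (fun k => coef o k ^+ 2));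
    last first.
    by rewrite coef_synth.
  rewrite (parseval L2o); congr (_ + (I _)%:E)%E.
  by apply/funext => x; rewrite polar_sqr.
have EU := En_split U0 hXU'; have Ef := En_split c0 hXf.
have hY := parseval hphi; rewrite -YE in hY.
rewrite (parseval hphi) in YE.
have {}EU := EU _ hY; have {}Ef := Ef _ (parseval hphi).
apply/(ground_stateP a0 hc); split.
  apply/(Y0P a0 hc); split => //.
    apply/L2_perP; split => // x.
    by rewrite /U pev pp.
  by rewrite EU ltry.
move=> u Yu; apply: le_trans (hmin u Yu); rewrite EU Ef lee_fin lerD2r.
by rewrite -lee_fin -hXU'.
Qed.

(** The odd part of [U] is nonnegative on the half circle and, [U] being a ground state, solves an
    equation with bounded potential; by [strong_max] a single zero there makes it vanish
    identically. *)
Lemma odd_part_dichotomy : alpha <= 2 ->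
  (forall x, o x = 0) \/ (forall x, 0 < sin x -> o x != 0).
Proof.
move=> a2; have gU := polar_ground_state a2.
have bE : oddp (coef U) = coef (polar o).
  apply/funext => k; rewrite /oddp coefU /evenp; have [ok|ok] := boolP (odd k).
    by rewrite add0r.
  by rewrite coefp_even.
have [hregU habsU] := ground_state_abscv gU.
have hb : abscv (coef (polar o)) by rewrite -bE; exact: abscv_oddp.
(* [q] is the continuous representative of [polar o] given by its coefficients. Its square and its
   sign are recovered everywhere from almost everywhere identities between continuous functions. *)
pose q := synth (coef (polar o)).
have cq : continuous q by exact: continuous_synth.
have co : continuous o by exact: continuous_synth.
have pq : periodic q (pi *+ 2) by exact: periodic_synth.
have qp : {ae mu, forall x, circle R x -> q x = polar o x}.
  by apply: fourier_inj => //; [exact: L2_synth|exact: coef_synth].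
have csq (f : R -> R) : continuous f -> continuous (fun x => f x ^+ 2).
  move=> cf x.
  by apply: (@continuous_comp _ _ _ f (fun t => t ^+ 2)); [exact: cf|exact: exprn_continuous].
have q2 x : q x ^+ 2 = o x ^+ 2.
  apply: (cont_ae_eq (csq _ cq) (csq _ co)) => [y|y|] /=; rewrite ?pq ?po//.
  by apply: aeS qp => y h cy; rewrite h// polar_sqr.
have cs : continuous (fun x => q x * sin x).
  by move=> x; apply: cvgM; [exact: cq|exact: continuous_sin].
have qs x : 0 <= q x * sin x.
  suff -> : q x * sin x = `|q x * sin x| by [].
  apply: (cont_ae_eq cs (g := fun x => `|q x * sin x|)) => [y|y|y|].
  - by apply: (@continuous_comp _ _ _ (fun x => q x * sin x) (fun t => `|t|));
    [exact: cs|exact: norm_continuous].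
  - by rewrite /= pq sinD2pi.
  - by rewrite /= pq sinD2pi.
  apply: aeS qp => y h cy; rewrite h// ger0_norm// /polar; have [sy|sy] := leP 0 (sin y).
    by rewrite mulr_ge0.
  by rewrite mulNr -mulrN mulr_ge0// oppr_ge0 ltW.
have qpos y : 0 < sin y -> 0 <= q y by move=> sy; have := qs y; rewrite pmulr_lge0.
have /(ground_stateP a0 hc)[YU _] := gU.
have [L _ hL] := Y0_En_real ha hc YU.
have [M hM] := synth_bound (abscv_evenp habsU).
have [[x [sx qx]]|H] := pselect (exists x, 0 < sin x /\ q x = 0).
  left => y; suff : q y = 0 by move=> h; have := q2 y; rewrite h expr0n/= => /esym/eqP;
    rewrite sqrf_eq0 => /eqP.
  have hreg : abscv (fun k => fr k `^ alpha * coef (polar o) k).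
    rewrite -bE; apply: (@abscv_le _ _ _ 1 hregU) => k; rewrite mul1r /oddp.
    by case: ifP => // _; rewrite mulr0 normr0.
  apply: (strong_max a0 coefp_even hreg qpos sx qx
    (V := fun y => 2 * L * synth (evenp (coef U)) y - c) (M := `|2 * L| * M + `|c|)) => // z.
    by apply: le_trans (ler_normB _ _) _; rewrite lerD2r normrM ler_wpM2l.
  by have := odd_relation z gU hL; rewrite bE.
right=> x sx; apply: contra_not_neq H => ox; exists x; split => //.
by apply/eqP; rewrite -sqrf_eq0 q2 ox expr0n.
Qed.

End Dichotomy.

Lemma reflection_dichotomy (f : R -> R) : alpha <= 2 -> ground_state alpha c f ->
  continuous f ->
  (forall x, f (- x) = f x) \/ (forall x, 0 < sin x -> f (- x) != f x).
Proof.
move=> a2 gs cf; have /(ground_stateP a0 hc)[Yf _] := gs.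
have [pf hf _ _ _] := Y0_facts ha hc Yf.
have [_ habs] := ground_state_abscv gs.
have fE := abscv_coef_eq cf pf hf habs.
have [h|h] := odd_part_dichotomy gs a2; [left=> x|right=> x sx];
  rewrite (fE x) (fE (- x)) (synth_split x habs) (synth_splitN x habs).
  by rewrite h subr0 addr0.
by have := h x sx; apply: contra_neq => E; lra.
Qed.

End GroundStates.

(** * Monotonicity from reflections *)

Section Reflections.
Context {R : realType}.
Implicit Types (x y z t : R).

Lemma nonvanishing_pos (g : R -> R) (a b x y : R) : continuous g ->
  (forall z, a < z < b -> g z != 0) -> a < x < b -> a < y < b -> 0 < g x -> 0 < g y.
Proof.
move=> cg h xab yab gx; rewrite lt_neqAle eq_sym h//= leNgt; apply/negP => gy.
have key u v : u <= v -> a < u -> v < b -> Num.min (g u) (g v) <= 0 <= Num.max (g u) (g v) -> False.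
  move=> uv au vb m; have [c] := IVT uv (continuous_subspaceT cg) m.
  rewrite in_itv/= => /andP[uc cv] /eqP; apply/negP/h.
  by rewrite (lt_le_trans au uc) (le_lt_trans cv vb).
move/andP: xab => [x1 x2]; move/andP: yab => [y1 y2].
have [xy|/ltW yx] := leP x y.
  by apply: (key x y) => //; rewrite ge_min le_max (ltW gx) (ltW gy) orbT.
by apply: (key y x) => //; rewrite ge_min le_max (ltW gx) (ltW gy) orbT.
Qed.

Section Monotone.
Context (f : R -> R) (cf : continuous f) (pf : periodic f (pi *+ 2)).
Context (fmax : forall x, f x <= f 0) (fnc : exists x, f x != f 0).
Context (refl : forall t, (forall x, f (t - x) = f (t + x)) \/
  (forall x, 0 < sin x -> f (t - x) != f (t + x))).

Let w t x := f (t - x) - f (t + x).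

Let cw t : continuous (w t).
Proof.
move=> x; apply: cvgB.
  apply: (@continuous_comp _ _ _ (fun x => t - x) f); last exact: cf.
  by apply: cvgB; [exact: cvg_cst|exact: cvg_id].
apply: (@continuous_comp _ _ _ (fun x => t + x) f); last exact: cf.
by apply: cvgD; [exact: cvg_cst|exact: cvg_id].
Qed.

Let w_alt t : (forall x, w t x = 0) \/ (forall x, 0 < x < pi -> w t x != 0).
Proof.
case: (refl t) => h; [left=> x|right=> x xp]; first by rewrite /w h subrr.
by rewrite /w subr_eq0; apply/h/sin_gt0_pi.
Qed.

(** The constant sign of [w t] is read off at [x = t], where [w t t = f 0 - f (2 t)] and 0 is a
    maximum. *)
Let w_ge0 t x : 0 < t < pi -> 0 < x < pi -> 0 <= w t x.
Proof.
move=> tp xp; case: (w_alt t) => [->//|h].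
have wt : 0 < w t t.
  by rewrite lt_neqAle eq_sym h//= /w subrr subr_ge0.
exact: ltW (nonvanishing_pos (@cw t) h tp xp wt).
Qed.

Let w_le0 t x : - pi < t < 0 -> 0 < x < pi -> w t x <= 0.
Proof.
move=> /andP[t1 t2] xp; case: (w_alt t) => [->//|h].
have tp : 0 < - t < pi by apply/andP; split; lra.
pose v x := - w t x.
have cv : continuous v by move=> z; apply: cvgN; exact: cw.
have hv z : 0 < z < pi -> v z != 0 by move=> zp; rewrite oppr_eq0 h.
have vt : 0 < v (- t).
  by rewrite lt_neqAle eq_sym hv//= /v /w opprB subrr opprK subr_ge0.
by have := nonvanishing_pos cv hv tp xp vt; rewrite /v; lra.
Qed.

Let cwt x : continuous (w ^~ x).
Proof.
move=> t; apply: cvgB.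
  apply: (@continuous_comp _ _ _ (fun t => t - x) f); last exact: cf.
  by apply: cvgB; [exact: cvg_id|exact: cvg_cst].
apply: (@continuous_comp _ _ _ (fun t => t + x) f); last exact: cf.
by apply: cvgD; [exact: cvg_id|exact: cvg_cst].
Qed.

(** Letting [t] tend to 0 from both sides, [w_ge0] and [w_le0] give [w 0 = 0] on the half circle,
    which rules out the second alternative at [t = 0]. *)
Lemma reflection_even x : f (- x) = f x.
Proof.
have pp := @pi_gt0 R.
have w0 z : 0 < z < pi -> w 0 z = 0.
  move=> zp; apply/eqP; rewrite eq_le; apply/andP; split; rewrite leNgt; apply/negP => lt.
    have /cvgrPdist_lt/(_ _ lt)[d /= d0 hd] := @cwt z 0.
    pose t := - Num.min (d / 2) (pi / 2).
    have m0 : 0 < Num.min (d / 2) (pi / 2) by rewrite lt_min !divr_gt0.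
    have m1 : Num.min (d / 2) (pi / 2) <= d / 2 by rewrite ge_min lexx.
    have m2 : Num.min (d / 2) (pi / 2) <= pi / 2 by rewrite ge_min lexx orbT.
    have := hd t; rewrite /= sub0r /t opprK (ger0_norm (ltW m0)) => /(_ ltac:(lra)).
    have := @w_le0 t z ltac:(rewrite /t; apply/andP; split; lra) zp; rewrite -/t.
    by move=> h1; rewrite ltr_norml => /andP[]; lra.
  have lt' : 0 < - w 0 z by lra.
  have /cvgrPdist_lt/(_ _ lt')[d /= d0 hd] := @cwt z 0.
  pose t := Num.min (d / 2) (pi / 2).
  have m0 : 0 < t by rewrite lt_min !divr_gt0.
  have m1 : t <= d / 2 by rewrite ge_min lexx.
  have m2 : t <= pi / 2 by rewrite ge_min lexx orbT.
  have := hd t; rewrite /= sub0r normrN (ger0_norm (ltW m0)) => /(_ ltac:(lra)).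
  have := @w_ge0 t z ltac:(apply/andP; split; lra) zp.
  by move=> h1; rewrite ltr_norml => /andP[]; lra.
case: (w_alt 0) => [h|h]; first by have := h x; rewrite /w sub0r add0r; lra.
have hp : 0 < (pi : R) / 2 < pi by apply/andP; split; lra.
by have := h _ hp; rewrite w0// eqxx.
Qed.

(** [y] and [z] are mirror images about their midpoint, to which [w_ge0] applies. *)
Let noninc y z : 0 <= y -> y < z -> z <= pi -> f z <= f y.
Proof.
move=> y0 yz zp; have := @w_ge0 ((y + z) / 2) ((z - y) / 2).
rewrite /w (_ : (y + z) / 2 - (z - y) / 2 = y); last by field.
rewrite (_ : (y + z) / 2 + (z - y) / 2 = z); last by field.
by rewrite subr_ge0; apply; apply/andP; split; lra.
Qed.

Lemma reflection_decreasing y z : 0 <= y -> y < z -> z <= pi -> f z < f y.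
Proof.
move=> y0 yz zp; have pp := @pi_gt0 R.
pose t := (y + z) / 2.
have tp : 0 < t < pi by apply/andP; split; rewrite /t; lra.
have xp : 0 < (z - y) / 2 < pi by apply/andP; split; lra.
have E : w t ((z - y) / 2) = f y - f z.
  by rewrite /w /t; congr (f _ - f _); field.
case: (w_alt t) => [h|h]; last first.
  have wt : 0 < w t t by rewrite lt_neqAle eq_sym h//= /w subrr subr_ge0.
  by have := nonvanishing_pos (@cw t) h tp xp wt; rewrite E subr_gt0.
(* Two distinct symmetry axes would force [f] to be constant. *)
exfalso; move: tp => /andP[t0 t1].
have f2t : f (t *+ 2) = f 0.
  by have := h t; rewrite /w subrr -mulr2n; lra.
(* [p] represents the second maximum [2 t] in [0, pi], up to evenness and the period. *)
pose p := Num.min (t *+ 2) ((pi - t) *+ 2).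
have p0 : 0 < p by rewrite lt_min !pmulrn_lgt0// t0 subr_gt0.
have p1 : p <= t *+ 2 by rewrite ge_min lexx.
have p2 : p <= (pi - t) *+ 2 by rewrite ge_min lexx orbT.
have pp' : p <= pi by rewrite !mulr2n in p1 p2; lra.
have fp : f p = f 0.
  rewrite /p; have [_|_] := leP (t *+ 2) ((pi - t) *+ 2) => //.
  rewrite -f2t -reflection_even -(pf (- _)); congr f; rewrite !mulr2n; ring.
have cst x : 0 <= x <= p -> f x = f 0.
  move=> /andP[x0 xp']; apply/eqP; rewrite eq_le fmax/= -fp.
  have [->//|xne] := eqVneq x p.
  by apply: noninc => //; rewrite lt_neqAle xne.
(* As [f] stays at its maximum on [0, p], the second alternative fails at [d / 2], which is thus a
   further axis. Composed with evenness, that reflection gives the translation by [d], an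
   arbitrarily small period. *)
have per d : 0 < d < p -> forall x, f (x + d) = f x.
  move=> /andP[d0 dp] x; have dd : 0 < d / 2 < pi by apply/andP; split; lra.
  have [h2|h2] := w_alt (d / 2).
    have := h2 (x + d / 2); rewrite /w (_ : d / 2 - (x + d / 2) = - x); last by ring.
    rewrite reflection_even (_ : d / 2 + (x + d / 2) = x + d); last by field.
    lra.
  have /eqP := h2 (d / 2) dd; rewrite /w subrr (_ : d / 2 + d / 2 = d); last by field.
  by rewrite (cst d) ?subrr//; apply/andP; split; lra.
have pern d n : 0 < d < p -> f (d *+ n) = f 0.
  move=> dp; elim: n => [|n IH]; first by rewrite mulr0n.
  by rewrite mulrSr per.
have all_pos x : 0 < x -> f x = f 0.
  move=> x0; pose n := (Num.bound (x / p)).+1.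
  have xn : x / p < n%:R.
    apply: lt_le_trans (archi_boundP _) _; first by rewrite divr_ge0 ?ltW.
    by rewrite ler_nat.
  have n0 : 0 < n%:R :> R by [].
  have dp : 0 < x / n%:R < p.
    by rewrite divr_gt0//= ltr_pdivrMr// mulrC -ltr_pdivrMr.
  have e : (x / n%:R) *+ n = x by rewrite -(mulr_natr (x / n%:R)) divfK// gt_eqF.
  by rewrite -(pern _ n dp) e.
have [x] := fnc; apply/negP; rewrite negbK; apply/eqP.
have [x0|x0|->//] := ltgtP 0 x; first exact: all_pos.
by rewrite -(reflection_even x) all_pos// oppr_gt0.
Qed.

Lemma reflection_single_lobe : single_lobe f.
Proof.
have pp := @pi_gt0 R.
have minf y : f pi <= f y.
  have [z /andP[z1 z2]] := circle_reduce y; rewrite -(periodicz z y pf).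
  move: (y + _) z1 z2 => {}y y1 y2.
  have H t : 0 <= t <= pi -> f pi <= f t.
    move=> /andP[t0 tp]; have [->//|ne] := eqVneq t pi.
    by apply: noninc => //; rewrite lt_neqAle ne.
  have [y0|y0] := leP 0 y; first by apply: H; rewrite y0.
  by rewrite -(reflection_even y); apply: H; apply/andP; split; lra.
split; first exact: cf.
- exists 0; split.
    split; first by rewrite in_itv/= oppr_lt0 pp (ltW pp).
    by apply/nbhs_ballP; exists 1; rewrite //= => y _; exact: fmax.
  move=> x []; rewrite in_itv/= => /andP[x1 x2] /nbhs_ballP[d /= d0 hd].
  have [x0|x0|//] := ltgtP 0 x; exfalso.
    pose m := Num.min (d / 2) (x / 2).
    have m0 : 0 < m by rewrite lt_min !divr_gt0.
    have m1 : m <= d / 2 by rewrite ge_min lexx.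
    have m2 : m <= x / 2 by rewrite ge_min lexx orbT.
    have := hd (x - m); rewrite /ball/= opprB addrCA subrr addr0 ger0_norm ?(ltW m0)//.
    move=> /(_ ltac:(lra)).
    have := @reflection_decreasing (x - m) x ltac:(lra) ltac:(lra) x2; lra.
  pose m := Num.min (d / 2) (- x / 2).
  have m0 : 0 < m by rewrite lt_min !divr_gt0// oppr_gt0.
  have m1 : m <= d / 2 by rewrite ge_min lexx.
  have m2 : m <= - x / 2 by rewrite ge_min lexx orbT.
  have := hd (x + m); rewrite /ball/= opprD addrA subrr add0r normrN ger0_norm ?(ltW m0)//.
  move=> /(_ ltac:(lra)).
  rewrite -(reflection_even x) -(reflection_even (x + m)).
  have := @reflection_decreasing (- (x + m)) (- x) ltac:(lra) ltac:(lra) ltac:(lra); lra.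
- exists pi; split.
    split; first by rewrite in_itv/= lexx andbT; lra.
    by apply/nbhs_ballP; exists 1; rewrite //= => y _; exact: minf.
  move=> x []; rewrite in_itv/= => /andP[x1 x2] /nbhs_ballP[d /= d0 hd].
  have [//|ne] := eqVneq x pi; exfalso.
  have xp : x < pi by rewrite lt_neqAle ne.
  have [x0|x0] := leP 0 x.
    pose m := Num.min (d / 2) (pi - x).
    have m0 : 0 < m by rewrite lt_min divr_gt0// subr_gt0.
    have m1 : m <= d / 2 by rewrite ge_min lexx.
    have m2 : m <= pi - x by rewrite ge_min lexx orbT.
    have := hd (x + m); rewrite /ball/= opprD addrA subrr add0r normrN ger0_norm ?(ltW m0)//.
    move=> /(_ ltac:(lra)).
    have := @reflection_decreasing x (x + m) x0 ltac:(lra) ltac:(lra); lra.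
  pose m := Num.min (d / 2) (x + pi).
  have m0 : 0 < m by rewrite lt_min divr_gt0//; lra.
  have m1 : m <= d / 2 by rewrite ge_min lexx.
  have m2 : m <= x + pi by rewrite ge_min lexx orbT.
  have := hd (x - m); rewrite /ball/= opprB addrCA subrr addr0 ger0_norm ?(ltW m0)//.
  move=> /(_ ltac:(lra)).
  rewrite -(reflection_even x) -(reflection_even (x - m)).
  have := @reflection_decreasing (- x) (- (x - m)) ltac:(lra) ltac:(lra) ltac:(lra); lra.
Qed.

End Monotone.

End Reflections.

Theorem theorem2p1 (R : realType) (alpha : R) (halpha : 1 / 3 < alpha)
    (c : R) (hc : -1 < c) :
  (exists phi : R -> R, ground_state alpha c phi) /\
  (alpha <= 2 ->
   forall phi : R -> R, ground_state alpha c phi ->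
   exists (a : R) (psi : R -> R),
     [/\ {ae lebesgue_measure, forall x : R, psi x = phi (x + a)},
         ground_state alpha c psi,
         (forall x : R, psi (- x) = psi x),
         single_lobe psi
       & (forall x : R, psi x <= psi 0)]).
Proof.
split; first exact: exists_ground_state.
move=> a2 phi gs.
have a0 : 0 < alpha by apply: lt_trans halpha; rewrite divr_gt0.
have [gf aef] := ground_state_synth halpha hc gs.
have [_ habs] := ground_state_abscv halpha hc gs.
set f := synth (coef phi) in gf aef.
have cf : continuous f by exact: continuous_synth.
have pf : periodic f (pi *+ 2) by exact: periodic_synth.
have pp := @pi_gt0 R.
have [m _ hm] := @EVT_max R f (- pi) pi ltac:(lra) (continuous_subspaceT cf).
have fm x : f x <= f m.
  have [z /andP[z1 z2]] := circle_reduce x; rewrite -(periodicz z x pf).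
  by apply: hm; rewrite in_itv/= z2 ltW.
pose psi x := f (x + m).
have gpsi : ground_state alpha c psi by exact: ground_state_shift.
have cshift t : continuous (fun x => f (x + t)).
  move=> x; apply: (@continuous_comp _ _ _ (fun x => x + t) f); last exact: cf.
  by apply: cvgD; [exact: cvg_id|exact: cvg_cst].
have cpsi : continuous psi by exact: cshift.
have ppsi : periodic psi (pi *+ 2) by move=> x; rewrite /psi addrAC pf.
have psimax x : psi x <= psi 0 by rewrite /psi add0r.
(* A constant of mean zero is 0 and could not have third moment 1. *)
have nc : exists x, psi x != psi 0.
  apply: contrapT => H.
  have E : psi = fun=> psi 0.
    by apply/funext => x; apply/eqP; apply: contrapT => /negP ne; apply: H; exists x.
  have /(ground_stateP a0 hc)[Ypsi _] := gpsi.
  have [_ L2psi _ I3 c0] := Y0_facts halpha hc Ypsi.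
  have /(coef0_I L2psi) := c0; rewrite E I_cst => /eqP; rewrite mulf_eq0 => /orP[/eqP z|].
    move: I3; rewrite (_ : (fun x => _) = fun=> psi 0 ^+ 3); last by rewrite [in LHS]E.
    by rewrite z expr0n/= I_cst mul0r => /eqP; rewrite eq_sym oner_eq0.
  by rewrite gt_eqF// pmulrn_lgt0.
have refl t : (forall x, psi (t - x) = psi (t + x)) \/
    (forall x, 0 < sin x -> psi (t - x) != psi (t + x)).
  have gt_ : ground_state alpha c (fun x => f (x + (t + m))) by exact: ground_state_shift.
  have E x : f (x + (t + m)) = psi (t + x) by rewrite /psi; congr f; ring.
  have [h|h] := reflection_dichotomy halpha hc a2 gt_ (cshift _).
    by left=> x; rewrite -!E h.
  by right=> x sx; rewrite -!E; exact: h.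
exists m, psi; split => //.
- exact: (ae_shift m aef).
- exact: (reflection_even cpsi psimax refl).
- exact: (reflection_single_lobe cpsi ppsi psimax nc refl).
Qed.
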